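(* Let $K$ be a field with a non-zero element $r$ such that $r^l \neq 1$ for all $l \geq 1$, and let $c_1, \dots , c_n$ be $n$ pairwise distinct non-zero elements of $K$. Let $A_r$ be the Liu-Schulz algebra, let $N:=A_r \oplus M_{c_1} \oplus \cdots \oplus M_{c_n}$ and $B:=\operatorname{End}_{A_r}(N)$. (1) $B$ is a gendo-symmetric algebra of dominant dimension equal to two with $n+1$ simple modules. (2) $B$ has infinite finitistic codominant dimension and is not weakly Gorenstein.
   Context: Algebras are finite dimensional, connected and non-semisimple over a field $K$; modules are finite dimensional right modules. $D=\operatorname{Hom}_K(-,K)$. For $r\in K$ non-zero, the Liu-Schulz algebra is $A_r:=K\langle x,y,z\rangle/(x^2,y^2,z^2,yx+rxy,zy+ryz,xz+rzx)$. For $c\in K$ non-zero, $M_c:=A_r/(x+cy)A_r$, a right $A_r$-module. An algebra is symmetric if it is isomorphic to its $K$-dual as a bimodule. An algebra is gendo-symmetric if it is isomorphic to $\operatorname{End}_A(N)$ for a symmetric algebra $A$ and a generator $N$ of $\operatorname{mod-}A$. The dominant dimension of a module $M$ with minimal injective coresolution $0 \to M \to I_0 \to I_1 \to \cdots$ is the smallest $n\ge0$ such that $I_n$ is not projective (infinite if no such $n$ exists); the codominant dimension of $M$ is the dominant dimension of $D(M)$; the dominant dimension of an algebra is that of its right regular module. The finitistic codominant dimension of an algebra is the supremum of the codominant dimensions of all modules having finite codominant dimension. A module $M$ over an algebra $A$ is Gorenstein-projective if $\operatorname{Ext}_A^i(M,A)=0=\operatorname{Ext}_A^i(\operatorname{Tr}(M),A)$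 for all $i\ge1$, where $\operatorname{Tr}$ is the Auslander-Bridger transpose; $M$ is Gorenstein-injective if $D(M)$ is Gorenstein-projective. $A$ is left weakly Gorenstein if every $M$ with $\operatorname{Ext}_A^i(M,A)=0$ for all $i\ge1$ is Gorenstein-projective; right weakly Gorenstein if every $M$ with $\operatorname{Ext}_A^i(D(A),M)=0$ for all $i\ge 1$ is Gorenstein-injective; weakly Gorenstein if it is both. *)

(* Defs.v *)
From HB Require Import structures.
From mathcomp Require Import all_boot all_order all_algebra all_field.
From mathcomp Require Import monalg.

Set Implicit Arguments.
Unset Strict Implicit.
Unset Printing Implicit Defensive.

Import GRing.Theory.
Local Open Scope ring_scope.

(* The opposite algebra.  MathComp provides the converse multiplication on
   A^c only up to the unit ring structure; the K-linear structure is that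
   of A. *)
HB.instance Definition _ (K : nzRingType) (V : lmodType K) :=
  GRing.Lmodule.copy V^c V.
HB.instance Definition _ (K : nzRingType) (V : vectType K) :=
  Vector.copy V^c V.

Section Opposite.
Variables (K : fieldType) (A : falgType K).

Fact conv_scaleAl (k : K) (a b : A^c) :
  k *: (a * b) = ((k *: a : A^c) * b : A^c).
Proof. exact: (@scalerAr K A k b a). Qed.
HB.instance Definition _ := GRing.Lmodule_isLalgebra.Build K A^c conv_scaleAl.

Fact conv_scaleAr (k : K) (a b : A^c) :
  k *: (a * b) = (a * (k *: b : A^c) : A^c).
Proof. exact: (@scalerAl K A k b a). Qed.
HB.instance Definition _ := GRing.Lalgebra_isAlgebra.Build K A^c conv_scaleAr.
End Opposite.

(* Finite dimensional right modules; left A-modules are right modules over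
   A^c. *)
Record rmod (K : fieldType) (A : falgType K) := RMod {
  rmod_sort :> vectType K;
  ract : A -> 'End(rmod_sort);
  ract_linear : linear ract;
  ract1 : ract 1 = \1%VF;
  ractM : forall a b, ract (a * b) = (ract b \o ract a)%VF
}.
Arguments ract {K A} M a : rename.
HB.instance Definition _ (K : fieldType) (A : falgType K) (M : rmod A) :=
  GRing.isSemilinear.Build K A 'End(M) _ (ract M)
    (GRing.semilinear_linear (@ract_linear K A M)).

Record mhom (K : fieldType) (A : falgType K) (M N : rmod A) := MHom {
  mhom_fun :> 'Hom(M, N);
  mhomP : forall a v, mhom_fun (ract M a v) = ract N a (mhom_fun v)
}.

Section Modules.
Variables (K : fieldType) (A : falgType K).
Implicit Types M N P I X : rmod A.

Definition is_mono M N (f : mhom M N) := lker f = 0%VS.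
Definition is_epi M N (f : mhom M N) := limg f = fullv.
Definition iso M N := exists f : mhom M N, is_mono f /\ is_epi f.

Definition submod M (U : {vspace M}) := forall a v, v \in U -> ract M a v \in U.

Definition simple_mod M :=
  (fullv : {vspace M}) <> 0%VS /\
  forall U : {vspace M}, submod U -> U = 0%VS \/ U = fullv.

Definition number_of_simples k :=
  exists S : 'I_k -> rmod A,
    [/\ forall i, simple_mod (S i),
        forall i j, iso (S i) (S j) -> i = j
      & forall X, simple_mod X -> exists i, iso X (S i)].

Definition projective P :=
  forall M N (g : mhom M N) (f : mhom P N), is_epi g ->
    exists h : mhom P M, f =1 g \o h.

Definition injective_mod I :=
  forall M N (g : mhom M N) (f : mhom M I), is_mono g ->
    exists h : mhom N I, f =1 h \o g.

Definition generator N :=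
  forall M, exists m (f : 'I_m -> mhom N M), (\sum_i limg (f i))%VS = fullv.

Definition essential M (U : {vspace M}) :=
  forall W : {vspace M}, submod W -> (U :&: W)%VS = 0%VS -> W = 0%VS.

Definition superfluous M (U : {vspace M}) :=
  forall W : {vspace M}, submod W -> (U + W)%VS = fullv -> W = fullv.

Definition minimal_injective_coresolution M (J : nat -> rmod A)
    (e : mhom M (J 0)) (d : forall k, mhom (J k) (J k.+1)) :=
  [/\ forall k, injective_mod (J k),
      [/\ is_mono e, limg e = lker (d 0)
         & forall k, limg (d k) = lker (d k.+1)]
    & essential (limg e) /\ forall k, essential (limg (d k))].

(* The m-th term is the first one that is not projective; no m qualifies when
   the dominant dimension is infinite. *)
Definition has_domdim M (m : nat) :=
  exists J e d,
    [/\ @minimal_injective_coresolution M J e d,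
        forall k, (k < m)%N -> projective (J k)
      & ~ projective (J m)].

Definition projective_resolution M (Q : nat -> rmod A)
    (e : mhom (Q 0) M) (d : forall k, mhom (Q k.+1) (Q k)) :=
  [/\ forall k, projective (Q k), is_epi e, limg (d 0) = lker e
    & forall k, limg (d k.+1) = lker (d k)].

(* Ext^(i+1)(M, N) = 0: every (i+1)-cocycle of Hom(Q, N) is a coboundary. *)
Definition extS_eq0 M N (i : nat) :=
  exists Q e d, @projective_resolution M Q e d /\
    forall f : mhom (Q i.+1) N, (forall v, f (d i.+1 v) = 0) ->
      exists g : mhom (Q i) N, f =1 g \o d i.

Definition ext_pos_eq0 M N := forall i, extS_eq0 M N i.

Definition minimal_projective_presentation M P0 P1
    (p0 : mhom P0 M) (p1 : mhom P1 P0) :=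
  [/\ projective P0 /\ projective P1, is_epi p0, limg p1 = lker p0,
      superfluous (lker p0) & superfluous (lker p1)].

End Modules.

Section Constructions.
Variables (K : fieldType) (A : falgType K).
Implicit Types M N P : rmod A.

Fact regular_act_linear : linear (@amulr K A : A -> 'End(A)).
Proof. exact: linearP. Qed.
Fact regular_act1 : amulr 1 = \1%VF :> 'End(A).
Proof. by apply/lfunP=> w; rewrite id_lfunE !lfunE /= mulr1. Qed.
Fact regular_actM (a b : A) : (amulr (a * b) = amulr b \o amulr a)%VF.
Proof. by apply/lfunP=> w; rewrite comp_lfunE !lfunE /= mulrA. Qed.
Definition regular := RMod regular_act_linear regular_act1 regular_actM.

Lemma amull_amulrC (u a v : A) : amull u (amulr a v) = amulr a (amull u v).
Proof. by rewrite !lfunE /= mulrA. Qed.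
Fact left_mul_hom (u : A) (a : A) (v : regular) :
  amull u (ract regular a v) = ract regular a (amull u v).
Proof. exact: amull_amulrC. Qed.
Definition left_mul (u : A) : mhom regular regular :=
  @MHom K A regular regular (amull u) (left_mul_hom u).


Section DirectSum.
Variables M N : rmod A.

Definition dsum_fun (a : A) (v : M * N) : M * N :=
  (ract M a v.1, ract N a v.2).
Fact dsum_fun_linear a : linear (dsum_fun a).
Proof. by move=> k u v; rewrite /dsum_fun !linearP. Qed.
HB.instance Definition _ a := GRing.isSemilinear.Build K _ _ _ (dsum_fun a)
  (GRing.semilinear_linear (dsum_fun_linear a)).
Definition dsum_act a : 'End((M * N)%type) := linfun (dsum_fun a).

Fact dsum_act_linear : linear dsum_act.
Proof.
move=> k a b; apply/lfunP=> v; rewrite add_lfunE scale_lfunE !lfunE /=.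
by rewrite /dsum_fun !linearP !lfun_simp.
Qed.
Fact dsum_act1 : dsum_act 1 = \1%VF.
Proof.
by apply/lfunP=> -[u v]; rewrite !lfunE /= /dsum_fun !ract1 !id_lfunE.
Qed.
Fact dsum_actM a b : dsum_act (a * b) = (dsum_act b \o dsum_act a)%VF.
Proof.
apply/lfunP=> v; rewrite comp_lfunE !lfunE /= /dsum_fun !ractM.
by rewrite !comp_lfunE.
Qed.
Definition dsum := RMod dsum_act_linear dsum_act1 dsum_actM.
End DirectSum.

(* M / U, carried by a complement of U. *)
Section Quotient.
Variables (M : rmod A) (U : {vspace M}) (subU : submod U).

Definition quo_proj : 'Hom(M, subvs_of U^C%VS) :=
  (linfun (vsproj U^C%VS) \o daddv_pi U^C%VS U)%VF.
Definition quo_act a : 'End(subvs_of U^C%VS) :=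
  (quo_proj \o ract M a \o linfun vsval)%VF.

Lemma quo_projK : cancel (linfun vsval) quo_proj.
Proof.
move=> v; rewrite /quo_proj comp_lfunE !lfunE /=.
by rewrite daddv_pi_id ?vsvalK ?subvsP // capvC capv_compl.
Qed.
Lemma quo_proj_eq0 v : (quo_proj v == 0) = (v \in U).
Proof.
rewrite /quo_proj comp_lfunE lfunE /=.
have CU : (U^C :&: U = 0)%VS by rewrite capvC capv_compl.
have vE : daddv_pi U^C%VS U v + daddv_pi U U^C%VS v = v.
  by apply: daddv_pi_add; rewrite // addvC addv_complf memvf.
apply/eqP/idP=> [/(congr1 vsval)|Uv].
  rewrite vsprojK ?memv_pi //= => pv0; rewrite -vE pv0 add0r.
  exact: memv_pi.
have -> : daddv_pi U^C%VS U v = v - daddv_pi U U^C%VS v.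
  by apply/eqP; rewrite eq_sym subr_eq vE.
by rewrite daddv_pi_id ?capv_compl // subrr linear0.
Qed.
Lemma quo_actE a v : quo_act a v = quo_proj (ract M a (linfun vsval v)).
Proof. by rewrite /quo_act !comp_lfunE. Qed.
Lemma quo_projE a v :
  quo_act a (quo_proj v) = quo_proj (ract M a v).
Proof.
rewrite quo_actE; apply/eqP; rewrite -subr_eq0 -!linearB /= quo_proj_eq0; apply: subU.
by rewrite -quo_proj_eq0 linearB /= quo_projK subrr.
Qed.

Fact quo_act_linear : linear quo_act.
Proof.
move=> k a b; apply/lfunP=> v.
by rewrite add_lfunE scale_lfunE !quo_actE linearP add_lfunE scale_lfunE linearP.
Qed.
Fact quo_act1 : quo_act 1 = \1%VF.
Proof.
by apply/lfunP=> v; rewrite quo_actE ract1 !id_lfunE quo_projK.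
Qed.
Fact quo_actM a b : quo_act (a * b) = (quo_act b \o quo_act a)%VF.
Proof.
apply/lfunP=> v; rewrite [RHS]comp_lfunE [quo_act a v]quo_actE quo_projE.
by rewrite quo_actE ractM comp_lfunE.
Qed.
Definition quo := RMod quo_act_linear quo_act1 quo_actM.
End Quotient.

Fact limg_submod M N (f : mhom M N) : submod (limg f).
Proof. by move=> a _ /memv_imgP[u _ ->]; rewrite -mhomP memv_img ?memvf. Qed.
Definition coker M N (f : mhom M N) : rmod A := quo (@limg_submod M N f).
End Constructions.

Section Composition.
Variables (K : fieldType) (U V W : vectType K).

Definition precomp_fun (g : 'Hom(U, V)) (f : 'Hom(V, W)) := (f \o g)%VF.
Fact precomp_fun_linear g : linear (precomp_fun g).
Proof. by move=> k f1 f2; rewrite /precomp_fun comp_lfunDl comp_lfunZl. Qed.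
HB.instance Definition _ g := GRing.isSemilinear.Build K _ _ _ (precomp_fun g)
  (GRing.semilinear_linear (precomp_fun_linear g)).
Definition precomp g : 'Hom('Hom(V, W), 'Hom(U, W)) := linfun (precomp_fun g).

Definition postcomp_fun (g : 'Hom(V, W)) (f : 'Hom(U, V)) := (g \o f)%VF.
Fact postcomp_fun_linear g : linear (postcomp_fun g).
Proof. by move=> k f1 f2; rewrite /postcomp_fun comp_lfunDr comp_lfunZr. Qed.
HB.instance Definition _ g := GRing.isSemilinear.Build K _ _ _ (postcomp_fun g)
  (GRing.semilinear_linear (postcomp_fun_linear g)).
Definition postcomp g : 'Hom('Hom(U, V), 'Hom(U, W)) := linfun (postcomp_fun g).

Lemma precompE g f : precomp g f = (f \o g)%VF. Proof. exact: lfunE. Qed.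
Lemma postcompE g f : postcomp g f = (g \o f)%VF. Proof. exact: lfunE. Qed.
End Composition.

Section Duality.
Variables (K : fieldType) (A : falgType K).

(* D = Hom_K(-, K), from right to left modules and back. *)
Section RightToLeft.
Variable M : rmod A.
Definition dual_act (a : A^c) : 'End('Hom(M, K^o)) := precomp K^o (ract M a).
Lemma dual_actE a f : dual_act a f = (f \o ract M a)%VF.
Proof. exact: precompE. Qed.
Fact dual_act_linear : linear dual_act.
Proof.
move=> k a b; apply/lfunP=> f; rewrite add_lfunE scale_lfunE !dual_actE.
by rewrite (ract_linear M) comp_lfunDr comp_lfunZr.
Qed.
Fact dual_act1 : dual_act 1 = \1%VF.
Proof. by apply/lfunP=> f; rewrite dual_actE (ract1 M) comp_lfun1r id_lfunE. Qed.
Fact dual_actM a b : dual_act (a * b) = (dual_act b \o dual_act a)%VF.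
Proof.
apply/lfunP=> f; rewrite comp_lfunE !dual_actE.
by rewrite -[a * b]/((b : A) * (a : A)) (ractM M) comp_lfunA.
Qed.
Definition rdual : rmod A^c := RMod dual_act_linear dual_act1 dual_actM.
End RightToLeft.

Section LeftToRight.
Variable M : rmod A^c.
Definition ldual_act (a : A) : 'End('Hom(M, K^o)) := precomp K^o (ract M a).
Lemma ldual_actE a f : ldual_act a f = (f \o ract M a)%VF.
Proof. exact: precompE. Qed.
Fact ldual_act_linear : linear ldual_act.
Proof.
move=> k a b; apply/lfunP=> f; rewrite add_lfunE scale_lfunE !ldual_actE.
by rewrite (ract_linear M) comp_lfunDr comp_lfunZr.
Qed.
Fact ldual_act1 : ldual_act 1 = \1%VF.
Proof. by apply/lfunP=> f; rewrite ldual_actE (ract1 M) comp_lfun1r id_lfunE. Qed.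
Fact ldual_actM a b : ldual_act (a * b) = (ldual_act b \o ldual_act a)%VF.
Proof.
apply/lfunP=> f; rewrite comp_lfunE !ldual_actE.
by rewrite -[a * b]/((b : A^c) * (a : A^c) : A^c) (ractM M) comp_lfunA.
Qed.
Definition ldual : rmod A := RMod ldual_act_linear ldual_act1 ldual_actM.
End LeftToRight.

(* The space of A-homomorphisms, tested on a basis of A. *)
Definition homs (M N : rmod A) : {vspace 'Hom(M, N)} :=
  (\bigcap_(i < \dim {:A})
     lker (precomp N (ract M (vbasis {:A})`_i)
           - postcomp M (ract N (vbasis {:A})`_i)))%VS.

Lemma homsP (M N : rmod A) (f : 'Hom(M, N)) :
  reflect (forall a v, f (ract M a v) = ract N a (f v)) (f \in homs M N).
Proof.
apply: (iffP idP) => [fH a v|fH].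
  rewrite (coord_vbasis (memvf a)) !linear_sum !sum_lfunE linear_sum.
  apply: eq_bigr => i _; rewrite !linearZ !scale_lfunE linearZ; congr (_ *: _).
  have: f \in lker (precomp N (ract M (vbasis {:A})`_i)
           - postcomp M (ract N (vbasis {:A})`_i)).
    by apply: (subvP _ f fH); apply: (bigcapv_inf i).
  rewrite memv_ker add_lfunE opp_lfunE precompE postcompE subr_eq0 => /eqP/lfunP/(_ v).
  by rewrite !comp_lfunE.
rewrite memvE; apply/subv_bigcapP => i _; rewrite -memvE memv_ker.
rewrite add_lfunE opp_lfunE precompE postcompE subr_eq0; apply/eqP/lfunP=> v.
by rewrite !comp_lfunE fH.
Qed.

(* The left module Hom_A(P, A). *)
Section Star.
Variable P : rmod A.
Let reg := regular A.

Definition star_act (a : A^c) : 'End(subvs_of (homs P reg)) :=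
  (linfun (vsproj (homs P reg)) \o postcomp P (@amull K A a) \o linfun vsval)%VF.

Fact star_act_val (a : A^c) f :
  vsval (star_act a f) = (@amull K A a \o vsval f)%VF.
Proof.
have fH : (@amull K A a \o vsval f)%VF \in homs P reg.
  apply/homsP=> b v; rewrite !comp_lfunE; have /homsP -> := subvsP f.
  exact: left_mul_hom.
rewrite /star_act [LHS]/=; do 2![rewrite comp_lfunE].
by rewrite [linfun vsval f]lfunE postcompE lfunE /= vsprojK.
Qed.
Fact star_act_linear : linear star_act.
Proof.
move=> k a b; apply/lfunP=> f; apply: val_inj.
rewrite add_lfunE scale_lfunE [LHS]star_act_val.
rewrite -[RHS]/(k *: vsval (star_act a f) + vsval (star_act b f)).
by rewrite !star_act_val (linearP (@amull K A)) comp_lfunDl comp_lfunZl.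
Qed.
Fact star_act1 : star_act 1 = \1%VF.
Proof.
apply/lfunP=> f; apply: val_inj.
by rewrite [LHS]star_act_val (@amull1 K A) comp_lfun1l id_lfunE.
Qed.
Fact star_actM a b : star_act (a * b) = (star_act b \o star_act a)%VF.
Proof.
apply/lfunP=> f; apply: val_inj.
rewrite comp_lfunE [LHS]star_act_val [RHS]star_act_val star_act_val.
by rewrite (@amullM K A) comp_lfunA.
Qed.
Definition star : rmod A^c := RMod star_act_linear star_act1 star_actM.
End Star.

Section StarMap.
Variables (P Q : rmod A) (p : mhom P Q).
Let reg := regular A.

Definition star_map_lfun : 'Hom(star Q, star P) :=
  (linfun (vsproj (homs P reg)) \o precomp reg p \o linfun vsval)%VF.
Fact star_map_val f : vsval (star_map_lfun f) = (vsval f \o p)%VF.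
Proof.
have fH : (vsval f \o p)%VF \in homs P reg.
  by apply/homsP=> b v; rewrite !comp_lfunE mhomP; have /homsP -> := subvsP f.
rewrite /star_map_lfun; do 2![rewrite comp_lfunE].
by rewrite [linfun vsval f]lfunE precompE lfunE /= vsprojK.
Qed.
Fact star_map_hom a f :
  star_map_lfun (ract (star Q) a f) = ract (star P) a (star_map_lfun f).
Proof.
apply: val_inj; rewrite [LHS]star_map_val [RHS]star_act_val star_map_val.
rewrite [vsval _]star_act_val.
by rewrite comp_lfunA.
Qed.
Definition star_map : mhom (star Q) (star P) := MHom star_map_hom.
End StarMap.

Definition is_transpose (M : rmod A) (T : rmod A^c) :=
  exists P0 P1 (p0 : mhom P0 M) (p1 : mhom P1 P0),
    minimal_projective_presentation p0 p1 /\ iso T (coker (star_map p1)).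

End Duality.

Section AlgebraProperties.
Variables (K : fieldType) (A : falgType K).

Definition connected_algebra :=
  forall e : A, e * e = e -> (forall a, a * e = e * a) -> e = 0 \/ e = 1.

Definition semisimple_algebra :=
  forall U : {vspace regular A}, submod U ->
    exists W : {vspace regular A},
      [/\ submod W, (U :&: W = 0)%VS & (U + W)%VS = fullv].

(* All algebras are assumed connected and non-semisimple. *)
Definition standing_algebra := connected_algebra /\ ~ semisimple_algebra.

(* An isomorphism A -> D(A) of bimodules, with (a phi b)(x) = phi (b x a). *)
Definition symmetric_algebra :=
  exists theta : 'Hom(A, 'Hom(A, K^o)),
    [/\ lker theta = 0%VS, limg theta = fullv
      & forall a u b x, theta (a * u * b) x = theta u (b * x * a)].

Definition algebra_domdim (m : nat) := has_domdim (regular A) m.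

Definition has_codomdim (M : rmod A) (m : nat) := has_domdim (rdual M) m.

Definition infinite_finitistic_codomdim :=
  forall m, exists (M : rmod A) k, has_codomdim M k /\ (m <= k)%N.

Definition Gorenstein_projective (M : rmod A) :=
  ext_pos_eq0 M (regular A) /\
  exists T : rmod A^c, is_transpose M T /\ ext_pos_eq0 T (regular A^c).

Definition left_weakly_Gorenstein :=
  forall M : rmod A, ext_pos_eq0 M (regular A) -> Gorenstein_projective M.

End AlgebraProperties.

Section MoreAlgebraProperties.
Variables (K : fieldType) (A : falgType K).

Definition Gorenstein_injective (M : rmod A) := Gorenstein_projective (rdual M).

Definition right_weakly_Gorenstein :=
  forall M : rmod A,
    ext_pos_eq0 (ldual (regular A^c)) M -> Gorenstein_injective M.

Definition weakly_Gorenstein :=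
  left_weakly_Gorenstein A /\ right_weakly_Gorenstein.

(* B is isomorphic to End_A(N), multiplication being composition. *)
Definition is_endomorphism_algebra (N : rmod A) (B : falgType K) :=
  exists phi : 'Hom(B, 'End(N)),
    [/\ lker phi = 0%VS, limg phi = homs N N, phi 1 = \1%VF
      & forall a b, phi (a * b) = (phi a \o phi b)%VF].
End MoreAlgebraProperties.

Definition gendo_symmetric (K : fieldType) (B : falgType K) :=
  standing_algebra B /\
  exists (A : falgType K) (N : rmod A),
    [/\ standing_algebra A, symmetric_algebra A, generator N
      & is_endomorphism_algebra N B].

Inductive two_sided_ideal (R : nzRingType) (G : R -> Prop) : R -> Prop :=
| tsi_gen g : G g -> two_sided_ideal G g
| tsi_0 : two_sided_ideal G 0
| tsi_add a b :
    two_sided_ideal G a -> two_sided_ideal G b -> two_sided_ideal G (a + b)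
| tsi_mul a u b : two_sided_ideal G u -> two_sided_ideal G (a * u * b).

Section LiuSchulz.
Variables (K : fieldType) (r : K).

Definition free_algebra3 : lalgType K := {malg K[{fmonom 'I_3}]}.
Definition free_gen (i : 'I_3) : free_algebra3 := << fmu i >>.
Let X := free_gen (inord 0).
Let Y := free_gen (inord 1).
Let Z := free_gen (inord 2).

Definition Liu_Schulz_relations : seq free_algebra3 :=
  [:: X * X; Y * Y; Z * Z;
      Y * X + r *: (X * Y); Z * Y + r *: (Y * Z); X * Z + r *: (Z * X)].

(* A is K<X,Y,Z>/(relations), x, y, z being the classes of X, Y, Z. *)
Definition is_Liu_Schulz (A : falgType K) (x y z : A) :=
  exists phi : {lrmorphism free_algebra3 -> A},
    [/\ [/\ phi X = x, phi Y = y & phi Z = z],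
        forall a, exists p, phi p = a
      & forall p, phi p = 0 <->
          two_sided_ideal (fun q => q \in Liu_Schulz_relations) p].
End LiuSchulz.

(* M_c = A / (x + c y) A *)
Definition Liu_Schulz_module (K : fieldType) (A : falgType K) (x y : A)
    (c : K) : rmod A :=
  coker (left_mul (x + c *: y)).

(* A (+) M_(c_1) (+) ... (+) M_(c_n) *)
Definition Liu_Schulz_sum (K : fieldType) (A : falgType K) (x y : A) (n : nat)
    (c : 'I_n -> K) : rmod A :=
  foldl (@dsum K A) (regular A)
    [seq Liu_Schulz_module x y (c i) | i <- enum 'I_n].

(* Main.v *)
Require Import Defs.
From HB Require Import structures.
From mathcomp Require Import all_boot all_order all_algebra all_field.
From mathcomp Require Import monalg ring.
From Stdlib Require Import Classical ClassicalEpsilon.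

(** The whole computation takes place along the pencil [u a = x + a y].  Since
    [(x + a y) (x + b y) = (b - r a) xy], the right annihilator of [u a] is
    [u (r a) A], so that the syzygy of [M_a = A / u a A] is [M_(r a)]; as [r] has
    infinite order, syzygies never repeat.  Multiplication by the elements
    [u (r^k a)] gives a sequence on [Hom(M_c, A)] and a sequence on [M_c].  Both
    are exact at a place unless [c] is there [r^t] times the parameter with
    [t <= 3] ([resonant_exactl], [resonant_exactr]).  Each orbit of [r] carries
    finitely many [c_i], so one may start beyond all of them, or stop at the
    first one met ([orbit_extremal]).

    [A] has the basis [1, x, y, z, xy, yz, zx, xyz], because the multiplication
    table of these words is that of an associative algebra [oct], to which the
    free algebra maps ([elt_inj]).  The coefficient of [xyz] is a nondegenerate
    symmetric form, which makes [A] symmetric.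

    Let [e] be the idempotent of [B] that projects [N] to [A].  Then [B e = N],
    [e B e = A], and the form of [A] makes [e B] and [B e] dual to each other
    ([end_corner]), on either side of [B].  In this situation call a module
    torsion-free when no nonzero element is killed by [B e]; projective modules
    are torsion-free, and torsion-free injective modules are projective.
    Comparing coresolutions then shows that the dominant dimension of a module
    is the step at which any of its coresolutions by torsion-free injective
    modules leaves the torsion-free modules ([DD_domdim]), so that it can be read off
    from explicit coresolutions.

    For [B] itself the first cosyzygy is torsion-free, because maps from [B e]
    to itself over [A] are elements of [B] ([tf_coker_regular]).  The second is
    not: [y] represents a nonzero self-extension of [M_c], which produces a
    torsion element ([ntf_second_cosyzygy]).  So the dominant dimension is two.

    For large codominant dimension, the left module [Hom(M_b, N)], which is the
    kernel of [u b] on [N], is coresolved by [N -> N -> ...] with differentials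
    [u (r^k b)], as long as [r^k b] does not resonate with any [c_i].  If [c_j]
    is the first of the [c_i] in its orbit and [b = r^-(m + 3) c_j], the
    coresolution breaks down exactly at step [m + 2] ([pencil_ker_DD]).

    For the failure of the left weak Gorenstein property, let [c_j] be the last
    of the [c_i] in its orbit and [a = r c_j].  No resonance occurs from [a] on,
    so [e B / u a e B] has no positive extensions by [B].  Its dual is
    [Hom(M_a, N)].  Composition with the map [M_c -> M_a], [1 |-> zx], [c = c_j],
    is a functional on this dual; were the module Gorenstein-projective, it
    would be a restriction of a functional on [N]
    ([Gorenstein_projective_extend]), and the map [M_c -> M_a] would factor
    through [A], which is not the case ([zx_not_projective]).

    The [n + 1] summands of [N] are pairwise nonisomorphic with local
    endomorphism rings; concretely, [B] has [n + 1] characters [chi], whose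
    common kernel is nilpotent ([radB_nilpotent]), and these give all the simple
    modules. *)

Set Implicit Arguments.
Unset Strict Implicit.
Unset Printing Implicit Defensive.

Import GRing.Theory.
Local Open Scope ring_scope.

Reserved Notation "v |> a" (at level 40, left associativity).
Notation "v |> a" := (ract _ a v) : ring_scope.

(** * Modules and homomorphisms *)
Section Building.
Variables (K : fieldType) (R : falgType K).

Lemma linear_lfun (V W : vectType K) (f : V -> W) :
  linear f -> {h : 'Hom(V, W) | forall v, h v = f v}.
Proof.
move=> lf; pose F : {linear V -> W} := HB.pack f
  (GRing.isSemilinear.Build K V W _ f (GRing.semilinear_linear lf)).
by exists (linfun F) => v; rewrite lfunE.
Qed.

Lemma ex_hom (M N : rmod R) (f : M -> N) :
  linear f -> (forall a v, f (v |> a) = f v |> a) ->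
  {h : mhom M N | forall v, h v = f v}.
Proof.
move=> lf hf; have [h hE] := linear_lfun lf.
by unshelve eexists (@MHom _ _ _ _ h _) => // a v; rewrite !hE.
Qed.

Section ModuleOfAction.
Variables (V : vectType K) (act : R -> V -> V).
Hypothesis act_linear : forall a, linear (act a).
Hypothesis act_linearl : forall v, linear (act^~ v).
Hypothesis act_1 : forall v, act 1 v = v.
Hypothesis act_M : forall a b v, act (a * b) v = act b (act a v).

Let actl a : 'End(V) := sval (linear_lfun (act_linear a)).
Let actlE a v : actl a v = act a v.
Proof. exact: (svalP (linear_lfun (act_linear a))). Qed.
Let actl_linear : linear actl.
Proof.
move=> k a b; apply/lfunP=> v.
by rewrite add_lfunE scale_lfunE !actlE act_linearl.
Qed.
Let actl_1 : actl 1 = \1%VF.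
Proof. by apply/lfunP=> v; rewrite actlE act_1 id_lfunE. Qed.
Let actl_M a b : actl (a * b) = (actl b \o actl a)%VF.
Proof. by apply/lfunP=> v; rewrite comp_lfunE !actlE act_M. Qed.

Definition rmod_of : rmod R := RMod actl_linear actl_1 actl_M.
Lemma rmod_ofE a (v : rmod_of) : v |> a = act a v :> V.
Proof. exact: actlE. Qed.
End ModuleOfAction.
Variables M N P : rmod R.

Lemma ractDr (v : M) a b : v |> (a + b) = v |> a + v |> b.
Proof. by rewrite linearD add_lfunE. Qed.
Lemma ractBr (v : M) a b : v |> (a - b) = v |> a - v |> b.
Proof. by rewrite linearB /= add_lfunE opp_lfunE. Qed.
Lemma ractZr (v : M) k a : v |> (k *: a) = k *: (v |> a).
Proof. by rewrite linearZ scale_lfunE. Qed.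
Lemma ract0r (v : M) : v |> 0 = 0.
Proof. by rewrite linear0 zero_lfunE. Qed.
Lemma ract_sumr I (s : seq I) (Q : pred I) (v : M) F :
  v |> (\sum_(i <- s | Q i) F i) = \sum_(i <- s | Q i) v |> F i.
Proof. by rewrite linear_sum sum_lfunE. Qed.
Lemma ract_mul (v : M) a b : v |> (a * b) = v |> a |> b.
Proof. by rewrite ractM comp_lfunE. Qed.
Lemma ract_1 (v : M) : v |> 1 = v.
Proof. by rewrite ract1 id_lfunE. Qed.

Lemma monoP (f : mhom M N) : is_mono f <-> (forall v, f v = 0 -> v = 0).
Proof.
split=> [kf v fv|h].
  by apply/eqP; rewrite -memv0 -kf memv_ker fv.
by apply/eqP; rewrite -subv0; apply/subvP=> v; rewrite memv_ker memv0 => /eqP/h->.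
Qed.
Lemma mhom_inj (f : mhom M N) : is_mono f -> injective f.
Proof. by move/eqP/lker0P. Qed.
Lemma epiP (f : mhom M N) : is_epi f <-> (forall w, exists v, f v = w).
Proof.
split=> [kf w|h].
  have /memv_imgP[v _ ->] : w \in limg f by rewrite kf memvf.
  by exists v.
apply/eqP; rewrite eqEsubv subvf /=; apply/subvP=> w _.
by have [v <-] := h w; rewrite memv_img ?memvf.
Qed.
Lemma exactP (f : mhom M N) (g : mhom N P) :
  limg f = lker g <-> (forall w, g w = 0 <-> exists v, f v = w).
Proof.
split=> [fg w|h].
  split=> [gw|[v <-]].
    have /memv_imgP[v _ ->] : w \in limg f by rewrite fg memv_ker gw.
    by exists v.
  by apply/eqP; rewrite -memv_ker -fg memv_img ?memvf.
apply/vspaceP=> w; rewrite memv_ker; apply/memv_imgP/eqP=> [[v _ ->]|/h[v <-]].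
  by apply/h; exists v.
by exists v; rewrite ?memvf.
Qed.
End Building.

Section Homs.
Variables (K : fieldType) (R : falgType K).
Implicit Types M N P Q X Y Z I J E : rmod R.

Definition idh M : mhom M M.
Proof. by exists \1%VF => a v; rewrite !id_lfunE. Defined.
Definition comph M N P (g : mhom N P) (f : mhom M N) : mhom M P.
Proof. by exists (g \o f)%VF => a v; rewrite !comp_lfunE !mhomP. Defined.
Definition subh M N (g f : mhom M N) : mhom M N.
Proof.
by exists ((g : 'Hom(M, N)) - (f : 'Hom(M, N))) => a v; rewrite !add_lfunE !opp_lfunE !mhomP linearB.
Defined.
Definition zeroh M N : mhom M N.
Proof. by exists (0 : 'Hom(M, N)) => a v; rewrite !zero_lfunE linear0. Defined.

Lemma idhE M v : idh M v = v. Proof. exact: id_lfunE. Qed.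
Lemma comphE M N P (g : mhom N P) (f : mhom M N) v : comph g f v = g (f v).
Proof. exact: comp_lfunE. Qed.
Lemma subhE M N (g f : mhom M N) v : subh g f v = g v - f v.
Proof. by rewrite add_lfunE opp_lfunE. Qed.
Lemma zerohE M N v : zeroh M N v = 0.
Proof. exact: zero_lfunE. Qed.
Definition homE := (idhE, comphE, subhE, zerohE).

Lemma lift_mono M X Y (i : mhom X Y) (f : mhom M Y) :
  is_mono i -> (forall v, exists w, i w = f v) ->
  exists h : mhom M X, forall v, i (h v) = f v.
Proof.
move=> mi fi; have hE v : i ((i^-1)%VF (f v)) = f v.
  by apply: limg_lfunVK; have [w <-] := fi v; rewrite memv_img ?memvf.
unshelve eexists (@MHom _ _ _ _ (i^-1 \o f)%VF _).
  by move=> a v; apply: (mhom_inj mi); rewrite !comp_lfunE hE [RHS]mhomP hE mhomP.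
by move=> v; rewrite /= comp_lfunE hE.
Qed.

Lemma factor_epi M Q X (p : mhom M Q) (f : mhom M X) :
  is_epi p -> (forall v, p v = 0 -> f v = 0) ->
  exists h : mhom Q X, forall v, h (p v) = f v.
Proof.
move=> ep fp; have pf v w : p v = p w -> f v = f w.
  by move/eqP; rewrite -subr_eq0 -linearB => /eqP/fp/eqP; rewrite linearB subr_eq0 => /eqP.
have pK v : p ((p^-1)%VF v) = v by apply: limg_lfunVK; rewrite ep memvf.
unshelve eexists (@MHom _ _ _ _ (f \o p^-1)%VF _).
  by move=> a v; rewrite !comp_lfunE -mhomP; apply: pf; rewrite mhomP !pK.
by move=> v; rewrite /= comp_lfunE; apply: pf; rewrite pK.
Qed.

Lemma iso_ex M N (f : mhom M N) : is_mono f -> is_epi f ->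
  exists g : mhom N M, (forall v, g (f v) = v) /\ (forall w, f (g w) = w).
Proof.
move=> mf ef; have [|g gE] := @lift_mono N M N f (idh N) mf.
  by move=> v; rewrite idhE; apply: (epiP f).1.
have fg w : f (g w) = w by rewrite gE idhE.
by exists g; split=> // v; apply: (mhom_inj mf); rewrite fg.
Qed.

Section Sub.
Variables (M : rmod R) (U : {vspace M}) (sU : submod U).
Let act a (v : subvs_of U) : subvs_of U := vsproj U (vsval v |> a).
Let actE a v : vsval (act a v) = vsval v |> a.
Proof. by rewrite vsprojK // sU // subvsP. Qed.
Let act_lin a : linear (act a).
Proof. by move=> k u v; rewrite /act !linearP. Qed.
Let act_linl v : linear (act^~ v).
Proof.
move=> k a b; apply: val_inj.
rewrite -[RHS]/(k *: vsval (act a v) + vsval (act b v)) [LHS]actE !actE.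
by rewrite ractDr ractZr.
Qed.
Let act_1 v : act 1 v = v.
Proof. by apply: val_inj; rewrite [LHS]actE ract_1. Qed.
Let act_M a b v : act (a * b) v = act b (act a v).
Proof. by apply: val_inj; rewrite [LHS]actE [RHS]actE actE ract_mul. Qed.
Definition subm : rmod R := rmod_of act_lin act_linl act_1 act_M.
Definition incl : mhom subm M.
Proof.
by exists (linfun vsval) => a v; rewrite !lfunE /= -actE rmod_ofE.
Defined.
Lemma inclE v : incl v = vsval v. Proof. by rewrite lfunE. Qed.
Lemma incl_mono : is_mono incl.
Proof. by apply/monoP=> v; rewrite inclE => h; apply: val_inj; rewrite [LHS]h. Qed.
Lemma incl_mem v : incl v \in U. Proof. by rewrite inclE subvsP. Qed.
Lemma incl_ex v : v \in U -> exists w, incl w = v.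
Proof. by move=> vU; exists (vsproj U v); rewrite inclE vsprojK. Qed.
End Sub.

Section Quo.
Variables (M : rmod R) (U : {vspace M}) (sU : submod U).
Definition quop : mhom M (quo sU).
Proof. by exists (quo_proj U) => a v; rewrite [RHS](quo_projE sU). Defined.
Lemma quop_eq0 v : quop v = 0 <-> v \in U.
Proof. by rewrite -quo_proj_eq0; split=> [->//|/eqP]. Qed.
Lemma quop_epi : is_epi quop.
Proof. by apply/epiP=> w; exists (linfun vsval w); exact: quo_projK. Qed.
End Quo.

Lemma lker_submod M N (f : mhom M N) : submod (lker f).
Proof. by move=> a v; rewrite !memv_ker mhomP => /eqP->; rewrite linear0. Qed.

Lemma inj_ext M N I (g : mhom M N) (f : mhom M I) : injective_mod I -> is_mono g ->
  exists h : mhom N I, forall v, h (g v) = f v.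
Proof. by move=> injI mg; have [h hE] := injI _ _ g f mg; exists h => v; rewrite hE. Qed.
Lemma proj_lift M N P (g : mhom M N) (f : mhom P N) : projective P -> is_epi g ->
  exists h : mhom P M, forall v, g (h v) = f v.
Proof. by move=> pP eg; have [h hE] := pP _ _ g f eg; exists h => v; rewrite hE. Qed.

(** Injectivity is tested on monomorphisms only; a map defined on the image of
    [f] is the same as a map killing the kernel of [f]. *)
Lemma injective_extend M N I (f : mhom M N) (g : mhom M I) :
  injective_mod I -> (forall v, f v = 0 -> g v = 0) ->
  exists h : mhom N I, forall v, h (f v) = g v.
Proof.
move=> injI fg; pose U := subm (@limg_submod _ _ _ _ f).
pose j : mhom U N := incl (@limg_submod _ _ _ _ f).
have [p pE] : exists p : mhom M U, forall v, j (p v) = f v.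
  by apply: lift_mono; [exact: incl_mono|move=> v; apply: incl_ex; rewrite memv_img ?memvf].
have ep : is_epi p.
  apply/epiP=> w; have /memv_imgP[v _ jw] := incl_mem w.
  by exists v; apply: (mhom_inj (incl_mono _)); rewrite -[LHS]/(j (p v)) pE -jw.
have [g' g'E] : exists g' : mhom U I, forall v, g' (p v) = g v.
  by apply: factor_epi => // v pv; apply: fg; rewrite -pE pv linear0.
have [h hE] := inj_ext g' injI (incl_mono _ : is_mono j).
by exists h => v; rewrite -pE -g'E hE.
Qed.

Lemma injective_retract I E (i : mhom I E) (p : mhom E I) :
  (forall v, p (i v) = v) -> injective_mod E -> injective_mod I.
Proof.
move=> pi injE M N g f mg; have [h hE] := inj_ext (comph i f) injE mg.
by exists (comph p h) => v; rewrite [RHS]comphE hE comphE pi.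
Qed.

Lemma projective_retract P Q (i : mhom P Q) (p : mhom Q P) :
  (forall v, p (i v) = v) -> projective Q -> projective P.
Proof.
move=> pi projQ M N g f eg; have [h hE] := proj_lift (comph f p) projQ eg.
by exists (comph h i) => v; rewrite [RHS](congr1 g (comphE _ _ _)) hE comphE pi.
Qed.

(** * Coinduced modules *)

Section Coinduced.
Variable V : vectType K.
Let act (a : R) (h : 'Hom(R, V)) : 'Hom(R, V) := (h \o amull a)%VF.
Let actE a h c : act a h c = h (a * c).
Proof. by rewrite comp_lfunE lfunE. Qed.
Let act_lin a : linear (act a).
Proof. by move=> k g h; apply/lfunP=> c; rewrite add_lfunE scale_lfunE !actE add_lfunE scale_lfunE. Qed.
Let act_linl h : linear (act^~ h).
Proof.
move=> k a b; apply/lfunP=> c; rewrite add_lfunE scale_lfunE !actE mulrDl -scalerAl.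
by rewrite linearP.
Qed.
Let act_1 h : act 1 h = h.
Proof. by apply/lfunP=> c; rewrite actE mul1r. Qed.
Let act_M a b h : act (a * b) h = act b (act a h).
Proof. by apply/lfunP=> c; rewrite !actE mulrA. Qed.
Definition coind : rmod R := rmod_of act_lin act_linl act_1 act_M.
Lemma coindE a (h : coind) c : (h |> a : 'Hom(R, V)) c = (h : 'Hom(R, V)) (a * c).
Proof. by rewrite rmod_ofE actE. Qed.

(** Frobenius reciprocity: a linear map to [V] is a module map to [coind]. *)
Lemma coind_hom M (f : 'Hom(M, V)) :
  exists h : mhom M coind, forall v c, (h v : 'Hom(R, V)) c = f (v |> c).
Proof.
have F v : {t : 'Hom(R, V) | forall c, t c = f (v |> c)}.
  by apply: linear_lfun => k a b; rewrite ractDr ractZr linearP.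
have [||h hE] := @ex_hom _ _ M coind (fun v => sval (F v)).
- move=> k u v; apply/lfunP=> c; rewrite add_lfunE scale_lfunE !(svalP (F _)).
  by rewrite !linearP.
- by move=> a v; apply/lfunP=> c; rewrite coindE !(svalP (F _)) ract_mul.
by exists h => v c; rewrite hE (svalP (F v)).
Qed.

Lemma coind_injective : injective_mod coind.
Proof.
move=> M N g f mg.
pose f1 : 'Hom(M, V) := sval (@linear_lfun _ M V (fun v => (f v : 'Hom(R, V)) 1)
  (fun k u v => etrans (f_equal (fun h : 'Hom(R, V) => h 1) (linearP f k u v))
     (etrans (add_lfunE _ _ _) (f_equal (+%R^~ _) (scale_lfunE _ _ _))))).
have f1E v : f1 v = (f v : 'Hom(R, V)) 1 by apply: (svalP (linear_lfun _)).
have [h hE] := coind_hom (f1 \o g^-1)%VF.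
exists h => v /=; apply/lfunP=> c; rewrite hE comp_lfunE -mhomP.
rewrite lker0_lfunK ?(introT eqP mg) // f1E mhomP.
by rewrite coindE mulr1.
Qed.
End Coinduced.

Lemma enough_injectives M : exists E (i : mhom M E), injective_mod E /\ is_mono i.
Proof.
have [h hE] := coind_hom (\1%VF : 'Hom(M, M)).
exists (coind M), h; split; first exact: coind_injective.
apply/monoP=> v hv; have := hE v 1.
by rewrite hv zero_lfunE ract_1 id_lfunE.
Qed.

(** * Free modules *)

Section Free.
Variable m : nat.
Let V := {ffun 'I_m -> R}.
Let act (a : R) (h : V) : V := [ffun i => h i * a].
Let act_lin a : linear (act a).
Proof. by move=> k g h; apply/ffunP=> c; rewrite !ffunE mulrDl scalerAl. Qed.
Let act_linl h : linear (act^~ h).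
Proof. by move=> k a b; apply/ffunP=> c; rewrite !ffunE mulrDr scalerAr. Qed.
Let act_1 h : act 1 h = h.
Proof. by apply/ffunP=> c; rewrite !ffunE mulr1. Qed.
Let act_M a b h : act (a * b) h = act b (act a h).
Proof. by apply/ffunP=> c; rewrite !ffunE mulrA. Qed.
Definition free_mod : rmod R := rmod_of act_lin act_linl act_1 act_M.
Lemma free_modE a (h : free_mod) i : (h |> a : V) i = (h : V) i * a.
Proof. by rewrite rmod_ofE ffunE. Qed.

Lemma free_hom M (p : 'I_m -> M) :
  exists h : mhom free_mod M, forall v, h v = \sum_i p i |> (v : V) i.
Proof.
have [||h hE] := @ex_hom _ _ free_mod M (fun v => \sum_i p i |> (v : V) i).
- move=> k u v; rewrite scaler_sumr -big_split /=; apply: eq_bigr => i _.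
  by rewrite !ffunE ractDr ractZr.
- move=> a v; rewrite linear_sum /=; apply: eq_bigr => i _.
  by rewrite free_modE ract_mul.
by exists h.
Qed.

Lemma hom_free M (f : 'I_m -> mhom M (regular R)) :
  exists h : mhom M free_mod, forall v i, (h v : V) i = f i v.
Proof.
have [||h hE] := @ex_hom _ _ M free_mod (fun v => [ffun i => f i v] : V).
- by move=> k u v; apply/ffunP=> i; rewrite !ffunE linearP.
- by move=> a v; apply/ffunP=> i; rewrite free_modE !ffunE mhomP lfunE.
by exists h => v i; rewrite hE ffunE.
Qed.

Definition free_basis (i : 'I_m) : free_mod := [ffun j => (j == i)%:R] : V.
Lemma free_sum (v : free_mod) : v = \sum_i free_basis i |> (v : V) i.
Proof.
apply/ffunP=> j; rewrite sum_ffunE (bigD1 j) //= free_modE ffunE eqxx mul1r.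
by rewrite big1 ?addr0 // => i /negPf ij; rewrite free_modE ffunE eq_sym ij mul0r.
Qed.

Lemma free_projective : projective free_mod.
Proof.
move=> M N g f /epiP eg.
pose p i := epsilon (inhabits 0) (fun v => g v = f (free_basis i)).
have pE i : g (p i) = f (free_basis i).
  by apply: (@epsilon_spec _ (inhabits 0) (fun v => g v = _)); apply: eg.
have [h hE] := free_hom p; exists h => v /=.
rewrite hE [in LHS](free_sum v) !linear_sum; apply: eq_bigr => i _.
by rewrite [LHS](mhomP f) [RHS](mhomP g) pE.
Qed.
End Free.

Lemma free_cover M : exists m (p : mhom (free_mod m) M), is_epi p.
Proof.
have [p pE] := @free_hom (\dim (fullv : {vspace M})) M (fun i => (vbasis (fullv : {vspace M}))`_i).
exists _, p; apply/epiP => w.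
exists ([ffun i => (coord (vbasis fullv) i w)%:A] : {ffun _ -> R}).
rewrite pE [RHS](coord_vbasis (memvf w)); apply: eq_bigr => i _.
by rewrite ffunE ractZr ract_1.
Qed.

Lemma regular_actE (v : regular R) (a : R) : v |> a = (v : R) * a :> R.
Proof. by rewrite lfunE. Qed.

Lemma regular_projective : projective (regular R).
Proof.
move=> M N g f /epiP eg; have [v gv] := eg (f (1 : R)).
have [||h hE] := @ex_hom _ _ (regular R) M (fun a => v |> a).
- by move=> k a b; rewrite ractDr ractZr.
- by move=> a b; rewrite regular_actE ract_mul.
exists h => a /=; rewrite hE mhomP gv -mhomP; congr (f _).
by rewrite regular_actE mul1r.
Qed.

Lemma projective_split P : projective P ->
  exists m (p : mhom (free_mod m) P) (i : mhom P (free_mod m)), forall v, p (i v) = v.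
Proof.
move=> pP; have [m [p ep]] := free_cover P.
have [i iE] := proj_lift (idh P) pP ep.
by exists m, p, i => v; rewrite iE idhE.
Qed.

End Homs.

(** * Injective hulls and minimal coresolutions *)
Lemma nat_minimizer (T : Type) (P : T -> Prop) (f : T -> nat) :
  (exists x, P x) -> exists x, P x /\ forall y, P y -> (f x <= f y)%N.
Proof.
case=> x0; have [m] := ubnP (f x0); elim: m x0 => // m IH x xm Px.
have [[y [Py yx]]|nex] := classic (exists y, P y /\ (f y < f x)%N).
  exact: (IH y (leq_trans yx _)).
by exists x; split=> // y Py; rewrite leqNgt; apply/negP=> yx; apply: nex; exists y.
Qed.

Section Hulls.
Variables (K : fieldType) (R : falgType K).
Implicit Types M N P Q X Y Z I J E W : rmod R.

Lemma limg_incl M (U : {vspace M}) (sU : submod U) : limg (incl sU) = U.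
Proof.
apply/vspaceP=> v; apply/memv_imgP/idP=> [[w _ ->]|/(incl_ex sU)[w <-]].
  exact: incl_mem.
by exists w; rewrite ?memvf.
Qed.

(** Splicing: a map with the image of a monomorphism from [Z] is one step
    [lker f -> X -> Z] of a coresolution. *)
Lemma ker_cover X Y Z (f : mhom X Y) (j : mhom Z Y) :
  is_mono j -> limg f = limg j ->
  exists p : mhom X Z, is_epi p /\ limg (incl (@lker_submod _ _ _ _ f)) = lker p.
Proof.
move=> mj fj; have [|p pE] := @lift_mono _ _ _ _ _ j f mj.
  move=> v; have : f v \in limg j by rewrite -fj memv_img ?memvf.
  by case/memv_imgP=> w _ ->; exists w.
exists p; split.
  apply/epiP=> w; have : j w \in limg f by rewrite fj memv_img ?memvf.
  by case/memv_imgP=> v _ E; exists v; apply: (mhom_inj mj); rewrite pE.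
rewrite limg_incl; apply/vspaceP=> v; rewrite !memv_ker -pE.
by apply/eqP/eqP=> [/((monoP j).1 mj)//|->]; rewrite linear0.
Qed.

Lemma limg_in_submod M N (f : mhom M N) (U : {vspace M}) :
  submod U -> submod (f @: U)%VS.
Proof.
by move=> sU a _ /memv_imgP[v vU ->]; rewrite -mhomP memv_img // sU.
Qed.

Lemma limg_comph_epi M N P (g : mhom N P) (f : mhom M N) :
  is_epi f -> limg (comph g f) = limg g.
Proof. by move=> ef; rewrite limg_comp ef. Qed.

Lemma lker_comph_mono M N P (g : mhom N P) (f : mhom M N) :
  is_mono g -> lker (comph g f) = lker f.
Proof.
move=> mg; apply/vspaceP=> v; rewrite !memv_ker comphE.
by apply/eqP/eqP=> [/((monoP g).1 mg)//|->]; rewrite linear0.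
Qed.

Lemma capv_lker0 (V W : vectType K) (f : 'Hom(V, W)) (U : {vspace V}) :
  (\dim U <= \dim (f @: U))%N -> (U :&: lker f = 0)%VS.
Proof.
move=> h; apply/eqP; rewrite -dimv_eq0; have := limg_ker_dim f U.
by case: (\dim (U :&: _)) => // k E; move: h; rewrite -E addSn ltnNge leq_addl.
Qed.

(** Among the endomorphisms of an injective module [E] that fix [X], one of
    minimal rank has an injective image in which [X] is essential: it cannot
    lose rank on its own image, which makes that image a retract, and a
    submodule meeting [X] trivially could be killed by a further one. *)
Lemma injective_hull X : exists J (i : mhom X J),
  [/\ injective_mod J, is_mono i & essential (limg i)].
Proof.
have [E [i [injE mi]]] := enough_injectives X.
have [|phi [phiX phimin]] := @nat_minimizer (mhom E E)
  (fun f => forall x, f (i x) = i x) (fun f => \dim (limg f)).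
  by exists (idh E) => x; rewrite idhE.
pose sU := @limg_submod _ _ _ _ phi; pose U := subm sU; pose j : mhom U E := incl sU.
have mj : is_mono j by exact: incl_mono.
have [p pE] : exists p : mhom E U, forall v, j (p v) = phi v.
  by apply: lift_mono => // v; apply: incl_ex; rewrite memv_img ?memvf.
have kerpj : (limg phi :&: lker phi = 0)%VS.
  apply: capv_lker0; rewrite -limg_comp.
  by apply: (phimin (comph phi phi)) => x; rewrite comphE !phiX.
have mpj : is_mono (comph p j).
  apply/monoP=> v; rewrite comphE => pjv; apply: ((monoP j).1 mj).
  apply/eqP; rewrite -memv0 -kerpj memv_cap incl_mem memv_ker -pE.
  by rewrite pjv linear0 eqxx.
have epj : is_epi (comph p j).
  apply: lker0_limgf; exact/eqP.
have [q [_ qE]] := iso_ex mpj epj.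
have [iU iUE] : exists iU : mhom X U, forall v, j (iU v) = i v.
  apply: lift_mono => // v; apply: incl_ex; rewrite -phiX memv_img ?memvf //.
exists U, iU; split.
- apply: (@injective_retract _ _ U E (comph j q) p _ injE) => v.
  by rewrite comphE -comphE qE.
- by apply/monoP=> v /(congr1 j); rewrite iUE linear0; apply: (monoP i).1.
move=> W sW WX.
(* maps out of [E / W'] extend [i], so an endomorphism of [E] fixing [X] kills [W'] *)
pose W' := (j @: W)%VS; have sW' : submod W' by apply: limg_in_submod.
have miq : is_mono (comph (quop sW') i).
  apply/monoP=> v; rewrite comphE => /quop_eq0/memv_imgP[w wW iv].
  have: w \in (limg iU :&: W)%VS.
    rewrite memv_cap wW andbT; have -> : w = iU v.
      by apply: (mhom_inj mj); rewrite iUE.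
    by rewrite memv_img ?memvf.
  by rewrite WX memv0 => /eqP w0; apply: (mhom_inj mi); rewrite iv w0 !linear0.
have [h hE] := inj_ext i injE miq.
pose f := comph h (quop sW').
have W0 : (limg phi :&: lker f = 0)%VS.
  apply: capv_lker0; rewrite -limg_comp; apply: (phimin (comph f phi)) => x.
  by have := hE x; rewrite !comphE phiX.
apply/eqP; rewrite -subv0; apply/subvP=> w wW.
rewrite memv0; apply/eqP/((monoP j).1 mj)/eqP.
rewrite -memv0 -W0 memv_cap incl_mem memv_ker /f comphE.
have -> : quop sW' (j w) = 0 by apply/quop_eq0; rewrite memv_img.
by rewrite linear0 eqxx.
Qed.

Definition hull_sig X : {J : rmod R & {i : mhom X J |
  [/\ injective_mod J, is_mono i & essential (limg i)]}}.
Proof.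
have h : exists J, exists i : mhom X J,
    [/\ injective_mod J, is_mono i & essential (limg i)].
  exact: injective_hull.
have [J hJ] := constructive_indefinite_description _ h.
exists J; exact: constructive_indefinite_description.
Qed.
Definition hull X := projT1 (hull_sig X).
Definition hull_map X : mhom X (hull X) := sval (projT2 (hull_sig X)).
Lemma hull_injective X : injective_mod (hull X).
Proof. by case: (svalP (projT2 (hull_sig X))). Qed.
Lemma hull_mono X : is_mono (hull_map X).
Proof. by case: (svalP (projT2 (hull_sig X))). Qed.
Lemma hull_essential X : essential (limg (hull_map X)).
Proof. by case: (svalP (projT2 (hull_sig X))). Qed.

Section MinimalCoresolution.
Variable X : rmod R.
Fixpoint cosyzygy k := if k is k'.+1 then coker (hull_map (cosyzygy k')) else X.
Definition hull_diff k : mhom (hull (cosyzygy k)) (hull (cosyzygy k.+1)) :=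
  comph (hull_map (cosyzygy k.+1)) (quop (@limg_submod _ _ _ _ (hull_map (cosyzygy k)))).

Lemma lker_quop M (U : {vspace M}) (sU : submod U) : lker (quop sU) = U.
Proof. apply/vspaceP=> v; rewrite memv_ker.
by apply/eqP/idP=> [/(quop_eq0 sU)|?] //; apply/quop_eq0. Qed.

Lemma limg_hull_diff k : limg (hull_diff k) = limg (hull_map (cosyzygy k.+1)).
Proof. by rewrite limg_comph_epi //; apply: quop_epi. Qed.
Lemma lker_hull_diff k : lker (hull_diff k) = limg (hull_map (cosyzygy k)).
Proof. by rewrite lker_comph_mono ?lker_quop //; apply: hull_mono. Qed.

Lemma hull_coresolution :
  @minimal_injective_coresolution _ _ X (fun k => hull (cosyzygy k)) (hull_map X) hull_diff.
Proof.
split; first by move=> k; apply: hull_injective.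
- split; first exact: hull_mono.
    by rewrite lker_hull_diff.
  by move=> k; rewrite lker_hull_diff limg_hull_diff.
split; first exact: hull_essential.
by move=> k; rewrite limg_hull_diff; apply: hull_essential.
Qed.
End MinimalCoresolution.

Lemma has_domdim_cons X J (i : mhom X J) m :
  injective_mod J -> is_mono i -> essential (limg i) -> projective J ->
  has_domdim (coker i) m -> has_domdim X m.+1.
Proof.
move=> injJ mi ei pJ [J' [e [d [[injJ' [me ed dd] [ee ed']] pJ' npJ]]]].
pose Jc k := if k is k'.+1 then J' k' else J.
pose q := quop (@limg_submod _ _ _ _ i).
pose dc k : mhom (Jc k) (Jc k.+1) :=
  match k return mhom (Jc k) (Jc k.+1) with 0 => comph e q | k'.+1 => d k' end.
have le : limg (comph e q) = limg e by apply: limg_comph_epi; apply: quop_epi.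
exists Jc, i, dc; split=> //; last by case.
split; first by case.
- split=> //; first by rewrite (lker_comph_mono _ me) lker_quop.
  by case=> [|k]; [rewrite le|exact: dd].
by split=> // -[|k]; [rewrite le|exact: ed'].
Qed.

Lemma has_domdim_iso X Y m : iso X Y -> has_domdim Y m -> has_domdim X m.
Proof.
move=> [f [mf ef]] [J [e [d [[injJ [me ed dd] [ee ed']] pJ npJ]]]].
exists J, (comph e f), d; split=> //; split=> //; last by rewrite limg_comph_epi.
split=> //; last by rewrite limg_comph_epi.
by rewrite /is_mono lker_comph_mono.
Qed.
End Hulls.

(** * Corners with a nondegenerate form *)
Section Corner.
Variable K : fieldType.

(** The situation of a gendo-symmetric algebra [R] with symmetric corner
    [e R e]: the form makes [e R] and [R e] dual to each other, so that [e R] is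
    projective and injective, and by faithfulness it cogenerates [R].  The
    clauses other than [corner_idem] and [corner_form] come in pairs exchanged
    by passing to the opposite algebra. *)
Record gendo_corner (R : falgType K) (e : R) (lam : 'Hom(R, K^o)) := GendoCorner {
  corner_idem : e * e = e;
  corner_faithr : forall b, (forall c, b * c * e = 0) -> b = 0;
  corner_faithl : forall b, (forall c, e * c * b = 0) -> b = 0;
  corner_form : forall b, lam (e * b * e) = lam b;
  corner_ndr : forall g, (forall c, lam (g * c) = 0) -> e * g = 0;
  corner_ndl : forall g, (forall c, lam (c * g) = 0) -> g * e = 0
}.

Lemma gendo_corner_op (R : falgType K) (e : R) (lam : 'Hom(R, K^o)) :
  gendo_corner e lam -> @gendo_corner R^c e lam.
Proof.
case=> ? fr fl cf nr nl; split=> // b.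
- by move=> h; apply: fl => c; rewrite -[RHS](h c) -mulrA.
- by move=> h; apply: fr => c; rewrite -[RHS](h c) -mulrA.
- by rewrite -[RHS]cf -mulrA.
Qed.

Lemma bidual (V : vectType K) (psi : 'Hom('Hom(V, K^o), K^o)) :
  exists v, forall f, psi f = f v.
Proof.
pose c i : 'Hom(V, K^o) := linfun (coord (vbasis fullv) i : V -> K^o).
exists (\sum_i psi (c i) *: (vbasis (fullv : {vspace V}))`_i) => f.
have fE : f = \sum_(i < _) f (vbasis (fullv : {vspace V}))`_i *: c i.
  apply/lfunP=> v; rewrite [in LHS](coord_vbasis (memvf v)) linear_sum sum_lfunE.
  by apply: eq_bigr => i _; rewrite linearZ scale_lfunE lfunE; apply: mulrC.
rewrite [in LHS]fE [LHS]linear_sum [RHS]linear_sum; apply: eq_bigr => i _.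
by rewrite [LHS]linearZ [RHS]linearZ; apply: mulrC.
Qed.

Variables (R : falgType K) (e : R) (lam : 'Hom(R, K^o)) (cor : gendo_corner e lam).
Implicit Types M N P Q X Y Z I J E W : rmod R.

Lemma corner_uniq g h : (forall c, lam (g * c) = lam (h * c)) -> e * g = e * h.
Proof.
move=> gh; apply/eqP; rewrite -subr_eq0 -mulrBr; apply/eqP/(corner_ndr cor) => c.
by rewrite mulrBl linearB /= gh subrr.
Qed.

Lemma corner_form_l b : lam (e * b) = lam b.
Proof. by rewrite -(corner_form cor) mulrA (corner_idem cor) (corner_form cor). Qed.

(** The duality of [e R] with [R e]: functionals on [R e] are represented by
    elements of [e R]. *)
Lemma corner_rep : exists rho : mhom (coind R K^o) (regular R),
  forall th, e * (rho th : R) = rho th /\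
    forall c, lam ((rho th : R) * c) = (th : 'Hom(R, K^o)) (c * e).
Proof.
have [T TE] : {T : 'Hom(R, 'Hom(R, K^o)) | forall g c, T g c = lam (g * c)}.
  have [|T TE] := @linear_lfun K R 'Hom(R, K^o) (fun g => (lam \o amull g)%VF).
    move=> k g h; apply/lfunP=> c.
    by rewrite add_lfunE scale_lfunE !comp_lfunE !lfunE /= mulrDl -scalerAl linearP.
  by exists T => g c; rewrite TE comp_lfunE lfunE.
have [F FE] : {F : 'Hom(R, 'Hom(R, K^o)) | forall c g, F c g = lam (g * c)}.
  have [|F FE] := @linear_lfun K R 'Hom(R, K^o) (fun c => (lam \o amulr c)%VF).
    move=> k g h; apply/lfunP=> c.
    by rewrite add_lfunE scale_lfunE !comp_lfunE !lfunE /= mulrDr -scalerAr linearP.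
  by exists F => g c; rewrite FE comp_lfunE lfunE.
(* a functional killing the common zeros of the family [lam (g * _)] belongs to it *)
have imT (th : 'Hom(R, K^o)) : (th \o amulr e)%VF \in limg T.
  have [g gE] := bidual (th \o amulr e \o F^-1)%VF.
  apply/memv_imgP; exists g; rewrite ?memvf //; apply/lfunP=> c.
  rewrite TE -FE -gE !comp_lfunE !lfunE /=.
  apply/eqP; rewrite eq_sym -subr_eq0 -linearB -mulrBl /=; apply/eqP.
  rewrite (corner_ndl cor) ?linear0 // => g'.
  have FF : F (F^-1%VF (F c)) = F c by apply: limg_lfunVK; rewrite memv_img ?memvf.
  rewrite -FE [F _]linearB /= FF.
  by rewrite subrr zero_lfunE.
pose rho (th : 'Hom(R, K^o)) := e * T^-1%VF (th \o amulr e)%VF.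
have rhoe th : e * rho th = rho th by rewrite /rho mulrA (corner_idem cor).
have rhoE th c : lam (rho th * c) = th (c * e).
  by rewrite -mulrA corner_form_l -TE limg_lfunVK ?imT // comp_lfunE lfunE.
have [||h hE] := @ex_hom _ _ (coind R K^o) (regular R) rho.
- by move=> k u v; rewrite /rho comp_lfunDl -comp_lfunZl linearP /= mulrDr scalerAr.
- move=> a th; rewrite regular_actE -rhoe -[in RHS]rhoe -mulrA.
  apply: corner_uniq => c.
  by rewrite rhoE coindE -mulrA rhoE mulrA.
by exists h => th; rewrite hE; split; [exact: rhoe|exact: rhoE].
Qed.

(** The modules cogenerated by [e R]; the dual of [R e] detects exactly the
    multiples by [R e]. *)
Definition tf M := forall v : M, (forall c, v |> (c * e) = 0) -> v = 0.

Lemma tf_sub X Y (i : mhom X Y) : is_mono i -> tf Y -> tf X.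
Proof.
move=> /monoP mi tY v vc; apply: mi; apply: tY => c.
by rewrite -mhomP vc linear0.
Qed.

Lemma tf_regular : tf (regular R).
Proof.
move=> v vc; apply: (corner_faithr cor) => c.
by have := vc c; rewrite regular_actE mulrA.
Qed.

Lemma tf_projective P : projective P -> tf P.
Proof.
move=> /projective_split[m [p [i pi]]].
have mi : is_mono i by apply/monoP=> v iv; rewrite -(pi v) iv linear0.
apply: tf_sub mi _ => v vc; apply/ffunP=> k; rewrite ffunE.
apply: (corner_faithr cor) => c.
by have /ffunP/(_ k) := vc c; rewrite free_modE ffunE mulrA.
Qed.

(** Functionals on [J], represented through [corner_rep], give maps to [e R]
    that together embed [J] in a free module; the embedding splits as [J] is
    injective. *)
Lemma tf_injective_projective J : injective_mod J -> tf J -> projective J.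
Proof.
move=> injJ tJ; have [rho rhoP] := corner_rep.
pose mu i : 'Hom(J, K^o) := linfun (coord (vbasis fullv) i : J -> K^o).
pose f i : {h : mhom J (coind R K^o) | forall v c, (h v : 'Hom(R, K^o)) c = mu i (v |> c)} :=
  constructive_indefinite_description _ (coind_hom (mu i)).
have [H HE] := hom_free (fun i => comph rho (sval (f i))).
have mH : is_mono H.
  apply/monoP=> v Hv; apply: tJ => c.
  rewrite [LHS](coord_vbasis (memvf _)) big1 // => i _.
  have := HE v i; rewrite Hv ffunE comphE => /esym r0.
  have [_ /(_ c)] := rhoP (sval (f i) v).
  by rewrite r0 mul0r linear0 (svalP (f i)) lfunE /= => <-; rewrite scale0r.
have [s sE] := inj_ext (idh J) injJ mH.
apply: (@projective_retract _ _ J _ H s) => [v|]; last exact: free_projective.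
by rewrite sE idhE.
Qed.

Definition corner_mod := subm (@limg_submod _ _ _ _ (left_mul e)).
Definition corner_incl : mhom corner_mod (regular R) := incl _.
Lemma corner_inclE v : e * (corner_incl v : R) = corner_incl v.
Proof.
have /memv_imgP[w _ ->] := incl_mem v.
by rewrite !lfunE /= mulrA (corner_idem cor).
Qed.
Lemma corner_incl_ex (a : R) : e * a = a -> exists v, corner_incl v = a.
Proof.
move=> ea; apply: incl_ex; apply/memv_imgP; exists a; rewrite ?memvf //.
by rewrite lfunE /= ea.
Qed.

Lemma corner_mod_tf : tf corner_mod.
Proof. exact: tf_sub (incl_mono _) tf_regular. Qed.

Lemma corner_mod_injective : injective_mod corner_mod.
Proof.
have [rho rhoP] := corner_rep.
have [i iE] := coind_hom (lam \o (corner_incl : 'Hom(corner_mod, regular R)))%VF.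
have [|p pE] := @lift_mono _ _ (coind R K^o) _ _ corner_incl rho (incl_mono _).
  by move=> th; apply: corner_incl_ex; case: (rhoP th).
apply: (@injective_retract _ _ _ _ i p _ (@coind_injective _ _ _)) => v.
apply: (mhom_inj (incl_mono _)); rewrite -!/corner_incl [LHS]pE.
have [re rE] := rhoP (i v); rewrite -re -[RHS]corner_inclE; apply: corner_uniq => c.
rewrite rE iE comp_lfunE (mhomP corner_incl) regular_actE mulrA.
by rewrite -[RHS](corner_form cor) -[LHS]corner_form_l mulrA.
Qed.

(** An element killed by [R e] generates a submodule of such elements, which
    cannot meet [X], and [X] is essential. *)
Lemma tf_hull X : tf X -> tf (hull X).
Proof.
move=> tX v vc.
have [||h hE] := @ex_hom _ _ (regular R) (hull X) (fun a => v |> a).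
- by move=> k a b; rewrite ractDr ractZr.
- by move=> a b; rewrite regular_actE ract_mul.
suff h0 : limg h = 0%VS.
  apply/eqP; rewrite -memv0 -h0; apply/memv_imgP; exists (1 : R); rewrite ?memvf //.
  by rewrite hE ract_1.
apply: (@hull_essential _ _ X) (@limg_submod _ _ _ _ h) _.
apply/eqP; rewrite -subv0; apply/subvP=> w; rewrite memv_cap => /andP[].
move=> /memv_imgP[x _ ->] /memv_imgP[a _ xa]; rewrite memv0; apply/eqP.
rewrite (tX x) ?linear0 // => c; apply: (mhom_inj (hull_mono X)).
by rewrite mhomP xa hE linear0 -ract_mul mulrA vc.
Qed.

(** * Dominant dimension from torsion-free coresolutions *)
(** The cosyzygies of some coresolution by torsion-free injectives are
    torsion-free before step [m], but not at step [m]. *)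
Inductive DD : rmod R -> nat -> Prop :=
| DD0 X : ~ tf X -> DD X 0
| DDS X I Z (i : mhom X I) (p : mhom I Z) m :
    is_mono i -> is_epi p -> limg i = lker p -> injective_mod I -> tf I ->
    DD Z m -> DD X m.+1.

(** [X] is a retract of [Y] up to maps that factor through a torsion-free
    injective; this is what two coresolutions of one module have in common. *)
Definition stable_retract X Y := exists (al : mhom X Y) (be : mhom Y X) E
  (u : mhom X E) (v : mhom E X),
  [/\ injective_mod E, tf E & forall x, be (al x) = x + v (u x)].

Lemma stable_retract_tf X Y : stable_retract X Y -> tf Y -> tf X.
Proof.
move=> [al [be [E [u [v [_ tE h]]]]]] tY x xc.
have ax : al x = 0 by apply: tY => c; rewrite -mhomP xc linear0.
have ux : u x = 0 by apply: tE => c; rewrite -mhomP xc linear0.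
by have := h x; rewrite ax ux !linear0 addr0.
Qed.

(** The extensions [a'], [b'] of the two maps to the injective terms satisfy the
    relation [b' a' = 1] up to [i v u'] and a map that kills [X], hence factors
    through [Z]: on cosyzygies the correction passes through [I]. *)
Lemma stable_retract_shift X Y I J Z W (i : mhom X I) (p : mhom I Z)
    (j : mhom Y J) (q : mhom J W) :
  is_mono i -> is_epi p -> limg i = lker p -> injective_mod I -> tf I ->
  is_mono j -> is_epi q -> limg j = lker q -> injective_mod J ->
  stable_retract X Y -> stable_retract Z W.
Proof.
move=> mi ep /exactP ip injI tI mj eq /exactP jq injJ.
move=> [al [be [E [u [v [injE tE h]]]]]].
have pi x : p (i x) = 0 by apply/ip; exists x.
have qj x : q (j x) = 0 by apply/jq; exists x.
have [a' a'E] := inj_ext (comph j al) injJ mi.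
have [b' b'E] := inj_ext (comph i be) injI mj.
have [u' u'E] := inj_ext u injE mi.
have {}a'E x : a' (i x) = j (al x) by rewrite a'E comphE.
have {}b'E x : b' (j x) = i (be x) by rewrite b'E comphE.
have [|al' al'E] := @factor_epi _ _ _ _ _ p (comph q a') ep.
  by move=> w /ip[x <-]; rewrite comphE a'E qj.
have [|be' be'E] := @factor_epi _ _ _ _ _ q (comph p b') eq.
  by move=> w /jq[x <-]; rewrite comphE b'E pi.
pose g := subh (subh (comph b' a') (idh I)) (comph i (comph v u')).
have [|g' g'E] := @factor_epi _ _ _ _ _ p g ep.
  move=> w /ip[x <-]; rewrite !homE a'E b'E h u'E linearD /=.
  by rewrite [i x + _]addrC addrK subrr.
exists al', be', I, g', p; split=> // z; have [w <-] := (epiP p).1 ep z.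
rewrite al'E comphE be'E g'E !homE !linearB /= pi subr0.
by rewrite addrC subrK.
Qed.

(** The minimal coresolution follows the given one up to stable retracts, which
    preserve torsion-freeness; its terms are torsion-free, hence projective, as
    long as the cosyzygies are. *)
Lemma DD_has_domdim X m : DD X m ->
  forall Y, stable_retract X Y -> stable_retract Y X -> has_domdim Y m.
Proof.
elim=> {X m} [X ntX|X I Z i p m mi ep ip injI tI _ IH] Y XY YX.
  exists (fun k => hull (cosyzygy Y k)), (hull_map Y), (@hull_diff _ _ Y).
  split; first exact: hull_coresolution.
    by [].
  move=> /tf_projective tY; apply: ntX; apply: stable_retract_tf XY _.
  exact: tf_sub (hull_mono Y) tY.
have tX := tf_sub mi tI.
have tY := stable_retract_tf YX tX.
have tH := tf_hull tY.
apply: (@has_domdim_cons _ _ Y _ (hull_map Y) m) => //.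
- exact: hull_injective.
- exact: hull_mono.
- exact: hull_essential.
- by apply: tf_injective_projective; first exact: hull_injective.
have kq : limg (hull_map Y) = lker (quop (@limg_submod _ _ _ _ (hull_map Y))).
  by rewrite lker_quop.
apply: IH.
- by apply: (stable_retract_shift mi ep ip _ _ (hull_mono Y) (@quop_epi _ _ _ _ _) kq _ XY) => //;
    exact: hull_injective.
- by apply: (stable_retract_shift (hull_mono Y) (@quop_epi _ _ _ _ _) kq _ _ mi ep ip _ YX) => //;
    exact: hull_injective.
Qed.

Lemma DD_domdim X m : DD X m -> has_domdim X m.
Proof.
move=> h; have s : stable_retract X X.
  exists (idh X), (idh X), corner_mod, (zeroh _ _), (zeroh _ _); split.
  - exact: corner_mod_injective.
  - exact: corner_mod_tf.
  by move=> x; rewrite !homE addr0.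
exact: (DD_has_domdim h s s).
Qed.

(** Divisibility form of injectivity for maps out of principal right ideals. *)
Lemma injective_div I (a : R) (q : I) : injective_mod I ->
  (forall b, a * b = 0 -> q |> b = 0) -> exists w : I, w |> a = q.
Proof.
move=> injI aq.
have [||g gE] := @ex_hom _ _ (regular R) I (fun b => q |> b).
- by move=> k b c; rewrite ractDr ractZr.
- by move=> c b; rewrite regular_actE ract_mul.
have [|h hE] := @injective_extend _ _ _ _ _ (left_mul a) g injI.
  by move=> v; rewrite lfunE /= gE; apply: aq.
exists (h (1 : R)); rewrite -mhomP regular_actE mul1r.
by have := hE (1 : R); rewrite lfunE /= mulr1 gE ract_1.
Qed.
End Corner.

(** * Duality, extensions and the transpose *)
Section DoubleDual.
Variables (K : fieldType) (A : falgType K).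

Lemma double_dual_iso (M : rmod A^c) : iso (rdual (ldual M)) M.
Proof.
have F v : {t : 'Hom('Hom(M, K^o), K^o) | forall f, t f = f v}.
  by apply: linear_lfun => k f f'; rewrite add_lfunE scale_lfunE.
have [||h hE] := @ex_hom _ _ M (rdual (ldual M)) (fun v => sval (F v)).
- move=> k u v; apply/lfunP=> f; rewrite add_lfunE scale_lfunE !(svalP (F _)).
  by rewrite linearP.
- move=> a v; apply/lfunP=> f; rewrite (svalP (F _)) [in RHS]dual_actE comp_lfunE.
  by rewrite (svalP (F _)) [in RHS]ldual_actE comp_lfunE.
have mh : is_mono h.
  apply/monoP=> v hv; rewrite (coord_vbasis (memvf v)) big1 // => i _.
  have := svalP (F v) (linfun (coord (vbasis fullv) i : M -> K^o)).
  by rewrite -hE hv zero_lfunE lfunE /= => <-; rewrite scale0r.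
have eh : is_epi h.
  apply/epiP=> psi; have [v vE] := bidual psi.
  by exists v; rewrite hE; apply/lfunP=> f; rewrite (svalP (F v)) vE.
have [h' [hh' h'h]] := iso_ex mh eh.
exists h'; split; first by apply/monoP=> w h'w; rewrite -(h'h w) h'w linear0.
by apply/epiP=> v; exists (h v).
Qed.
End DoubleDual.

Section Ext.
Variables (K : fieldType) (R : falgType K).
Implicit Types M N P Q X Y Z T : rmod R.

Lemma left_mulE (a b : R) : left_mul a b = a * b :> R.
Proof. by rewrite [LHS]lfunE. Qed.

(** Left multiplications by the [p k] resolve the cokernel; a cochain is the
    left multiplication by some [b], so that cocycles and coboundaries are
    governed by left annihilators. *)
Lemma ext_cyclic (p : nat -> R) :
  (forall k b, p k * b = 0 <-> exists s, b = p k.+1 * s) ->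
  (forall k b, b * p k.+1 = 0 -> exists s, b = s * p k) ->
  ext_pos_eq0 (coker (left_mul (p 0))) (regular R).
Proof.
move=> rann lann i.
exists (fun=> regular R), (quop (@limg_submod _ _ _ _ (left_mul (p 0)))),
  (fun k => left_mul (p k)); split.
  split; first by move=> _; apply: regular_projective.
  - exact: quop_epi.
  - by rewrite lker_quop.
  move=> k; apply/exactP => b; rewrite left_mulE.
  split=> [/rann[s ->]|[s <-]]; first by exists s; rewrite left_mulE.
  by apply/rann; exists s; rewrite left_mulE.
move=> f fd; have fE (v : R) : f v = (f (1 : R) : R) * v :> R.
  by rewrite -[v in LHS]mul1r -[1 * v]/((1 : R) * v) -regular_actE mhomP regular_actE.
have [|s sE] := lann i (f (1 : R)).
  by rewrite -fE -[p _]mulr1 -left_mulE fd.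
by exists (left_mul s) => v /=; rewrite fE sE left_mulE left_mulE mulrA.
Qed.

Lemma proj_lift_im M N P (g : mhom M N) (f : mhom P N) :
  projective P -> (forall v, exists w, g w = f v) ->
  exists h : mhom P M, forall v, g (h v) = f v.
Proof.
move=> pP fg; pose j := incl (@limg_submod _ _ _ _ g).
have mj : is_mono j by exact: incl_mono.
have [|g' g'E] := @lift_mono _ _ _ _ _ j g mj.
  by move=> v; apply: incl_ex; rewrite memv_img ?memvf.
have [|f' f'E] := @lift_mono _ _ _ _ _ j f mj.
  by move=> v; apply: incl_ex; have [w <-] := fg v; rewrite memv_img ?memvf.
have eg' : is_epi g'.
  apply/epiP=> w; have /memv_imgP[v _ vE] := incl_mem w.
  by exists v; apply: (mhom_inj mj); rewrite g'E -vE.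
have [h hE] := proj_lift f' pP eg'.
by exists h => v; rewrite -g'E hE f'E.
Qed.

(** Comparison of an arbitrary resolution [Q] with the start [R1 -> R0] of
    another one: the two composites differ from the identity by a homotopy
    [h0], [h1], which corrects the extension found over [Q]. *)
Lemma ext2_extend T X R0 R1 Z (p : mhom R0 T) (d : mhom R1 R0) (j : mhom Z R1) :
  is_epi p -> limg d = lker p -> is_mono j -> limg j = lker d ->
  projective R0 -> projective R1 -> extS_eq0 T X 1 ->
  forall f : mhom Z X, exists F : mhom R1 X, forall v, F (j v) = f v.
Proof.
move=> ep /exactP dp mj /exactP jd pR0 pR1 [Q [eq [dq [[pQ eeq /exactP d0 dk] cob]]]] f.
have d1 := (exactP (dq 1) (dq 0)).1 (dk 0).
have d2 := (exactP (dq 2) (dq 1)).1 (dk 1).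
have [f0 f0E] := proj_lift p pR0 eeq.
have [g0 g0E] := proj_lift eq (pQ 0) ep.
have [|f1 f1E] := @proj_lift_im _ _ _ (dq 0) (comph f0 d) pR1.
  by move=> v; apply/d0; rewrite comphE f0E; apply/dp; exists v.
have [|g1 g1E] := @proj_lift_im _ _ _ d (comph g0 (dq 0)) (pQ 1).
  by move=> v; apply/dp; rewrite comphE g0E; apply/d0; exists v.
have [|g2 g2E] := @lift_mono _ _ _ _ _ j (comph g1 (dq 1)) mj.
  move=> v; apply/jd; rewrite comphE g1E comphE.
  by have -> : dq 0 (dq 1 v) = 0 by [apply/d1; exists v]; rewrite linear0.
have [|G GE] := cob (comph f g2).
  move=> v; rewrite comphE (_ : g2 _ = 0) ?linear0 //; apply: (mhom_inj mj).
  rewrite g2E comphE (_ : dq 1 (dq 2 v) = 0) ?linear0 //.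
  by apply/d2; exists v.
have {}GE v : f (g2 v) = G (dq 1 v) by rewrite -comphE GE.
have [|h0 h0E] := @proj_lift_im _ _ _ d (subh (comph g0 f0) (idh R0)) pR0.
  by move=> v; apply/dp; rewrite !homE linearB /= g0E f0E subrr.
have [|h1 h1E] := @lift_mono _ _ _ _ _ j
    (subh (subh (comph g1 f1) (idh R1)) (comph h0 d)) mj.
  move=> v; apply/jd; rewrite !homE !linearB /= g1E !comphE f1E h0E !homE.
  by rewrite subrr.
(* [g1 f1 - 1 - h0 d] takes values in the kernel of [d]; [h1] is this map to [Z] *)
exists (subh (comph G f1) (comph f h1)) => v; rewrite !homE.
have dj : d (j v) = 0 by apply/jd; exists v.
have [q qE] : exists q, dq 1 q = f1 (j v).
  by apply/d1; rewrite f1E comphE dj linear0.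
have -> : h1 (j v) = g2 q - v.
  have jq : j (g2 q) = g1 (f1 (j v)) by rewrite g2E comphE qE.
  have jB : j (g2 q - v) = j (g2 q) - j v by exact: linearB.
  by apply: (mhom_inj mj); rewrite h1E !homE dj linear0 subr0 jB jq.
have fB : f (g2 q - v) = f (g2 q) - f v by exact: linearB.
by rewrite fB GE qE opprB addrC subrK.
Qed.

Lemma dual_basis_projective P m (p : 'I_m -> P) (f : 'I_m -> mhom P (regular R)) :
  (forall v, v = \sum_i p i |> (f i v : R)) -> projective P.
Proof.
move=> pf; have [s sE] := free_hom p; have [i iE] := hom_free f.
apply: (@projective_retract _ _ P _ i s) => [v|]; last exact: free_projective.
by rewrite sE [RHS]pf; apply: eq_bigr => k _; rewrite iE.
Qed.

Lemma projective_dual_basis P : projective P ->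
  exists m (p : 'I_m -> P) (f : 'I_m -> mhom P (regular R)),
    forall v, v = \sum_i p i |> (f i v : R).
Proof.
move=> /projective_split[m [s [i si]]].
have pr k : exists h : mhom (free_mod R m) (regular R),
    forall v, h v = (v : {ffun 'I_m -> R}) k.
  have [||h hE] := @ex_hom _ _ (free_mod R m) (regular R) (fun v => (v : {ffun 'I_m -> R}) k).
  - by move=> a u v; rewrite !ffunE.
  - by move=> a v; rewrite free_modE regular_actE.
  by exists h.
pose q k := sval (constructive_indefinite_description _ (pr k)).
exists m, (fun k => s (free_basis R k)), (fun k => comph (q k) i) => v.
rewrite -[LHS]si [in LHS](free_sum (i v)) linear_sum; apply: eq_bigr => k _.
rewrite [LHS](mhomP s); congr (_ |> _); rewrite comphE.
by rewrite (svalP (constructive_indefinite_description _ (pr k))).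
Qed.
End Ext.

Section Star.
Variables (K : fieldType) (A : falgType K).
Implicit Types M N P Q : rmod A.

Lemma star_elt P (f : mhom P (regular A)) : exists s : star P, forall v, vsval s v = f v.
Proof.
exists (vsproj (homs P (regular A)) f) => v; rewrite vsprojK //.
exact/homsP/mhomP.
Qed.

Lemma star_hom P (s : star P) : exists f : mhom P (regular A), forall v, f v = vsval s v.
Proof.
have /homsP sP := subvsP s.
by exists (MHom sP).
Qed.

Lemma star_eq P (s t : star P) : (forall v, vsval s v = vsval t v) -> s = t.
Proof. by move=> st; apply: val_inj; apply/lfunP. Qed.

Lemma star_actE P (s : star P) (a : A) v :
  vsval (s |> (a : A^c)) v = a * (vsval s v : A) :> A.
Proof. by rewrite [LHS](congr1 (fun h : 'Hom(_, _) => h v) (star_act_val _ _)) comp_lfunE lfunE. Qed.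

Lemma star_mapE P Q (p : mhom P Q) s v : vsval (star_map p s) v = vsval s (p v).
Proof. by rewrite [LHS](congr1 (fun h : 'Hom(_, _) => h v) (star_map_val _ _)) comp_lfunE. Qed.

Lemma star_eval P v : exists h : mhom (star P) (regular A^c),
  forall s, h s = vsval s v.
Proof.
have [||h hE] := @ex_hom _ _ (star P) (regular A^c) (fun s => vsval s v).
- by move=> k s t; rewrite linearP add_lfunE scale_lfunE.
- by move=> a s; rewrite star_actE regular_actE.
by exists h.
Qed.

(** A dual basis of [P] becomes one of [star P] when points and functionals are
    exchanged. *)
Lemma star_projective P : projective P -> projective (star P).
Proof.
move=> /projective_dual_basis[m [p [f pf]]].
pose s i := sval (constructive_indefinite_description _ (star_elt (f i))).
have sE i v : vsval (s i) v = f i v.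
  exact: (svalP (constructive_indefinite_description _ (star_elt (f i)))).
pose ev i := sval (constructive_indefinite_description _ (star_eval (p i))).
have evE i t : ev i t = vsval t (p i).
  exact: (svalP (constructive_indefinite_description _ (star_eval (p i)))).
apply: (@dual_basis_projective _ _ (star P) m s ev) => t; apply: star_eq => v.
have [h hE] := star_hom t.
rewrite -hE [in LHS](pf v) linear_sum linear_sum sum_lfunE; apply: eq_bigr => i _ /=.
by rewrite star_actE sE evE -hE (mhomP h) regular_actE.
Qed.

Lemma star_epi_mono P Q (p : mhom P Q) : is_epi p -> is_mono (star_map p).
Proof.
move=> /epiP ep; apply/monoP=> s s0; apply: star_eq => w.
by have [v <-] := ep w; rewrite -star_mapE s0 linear0 !zero_lfunE.
Qed.

Lemma star_exact P1 P0 M (p1 : mhom P1 P0) (p0 : mhom P0 M) :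
  is_epi p0 -> limg p1 = lker p0 -> limg (star_map p0) = lker (star_map p1).
Proof.
move=> ep /exactP e10; apply/exactP => s; split=> [s0|[t <-]].
  have [h hE] := star_hom s; have [|f fE] := @factor_epi _ _ _ _ _ p0 h ep.
    move=> v /e10[w <-]; rewrite hE -star_mapE s0.
    by rewrite linear0 zero_lfunE.
  have [t tE] := star_elt f; exists t; apply: star_eq => v.
  by rewrite star_mapE tE fE hE.
apply: star_eq => v; rewrite !star_mapE (_ : p0 (p1 v) = 0) ?linear0 ?zero_lfunE //.
by apply/e10; exists v.
Qed.

(** [Ext^2 (Tr M, A) = 0] makes every functional on [star M] a restriction from
    [star P], for any presentation [P -> M]. *)
Lemma Gorenstein_projective_extend M P (q : mhom P M) :
  is_epi q -> Gorenstein_projective M -> forall f : mhom (star M) (regular A^c),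
  exists F : mhom (star P) (regular A^c), forall s, F (star_map q s) = f s.
Proof.
move=> eq [_ [T [[P0 [P1 [p0 [p1 [[[pP0 pP1] ep0 e10 _ _] [i [mi ei]]]]]]] ext]]] f.
have [i' [i'i ii']] := iso_ex mi ei.
pose pT := comph i' (quop (@limg_submod _ _ _ _ (star_map p1))).
have mi' : is_mono i' by apply/monoP=> v i'v; rewrite -(ii' v) i'v linear0.
have epT : is_epi pT.
  apply/epiP=> t; have [s sE] := (epiP _).1
    (@quop_epi _ _ _ _ (@limg_submod _ _ _ _ (star_map p1))) (i t).
  by exists s; rewrite comphE sE i'i.
have kpT : limg (star_map p1) = lker pT by rewrite (lker_comph_mono _ mi') lker_quop.
have [F FE] := ext2_extend epT kpT (star_epi_mono ep0) (star_exact ep0 e10)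
  (star_projective pP1) (star_projective pP0) (ext 1%N) f.
have [k kE] := proj_lift p0 pP0 eq.
exists (comph F (star_map k)) => s; rewrite comphE -FE; congr (F _).
by apply: star_eq => v; rewrite !star_mapE kE.
Qed.
End Star.

(** * A model of the Liu-Schulz algebra *)
(** The algebra with basis [1, x, y, z, xy, yz, zx, xyz], in this order, whose
    table is read off the relations.  Its existence is what makes these eight
    words linearly independent in the Liu-Schulz algebra. *)
Definition oct (K : fieldType) (r : K) := (K * K * K * K * K * K * K * K)%type.
HB.instance Definition _ K r := GRing.Zmodule.copy (@oct K r)
  (K * K * K * K * K * K * K * K)%type.

Section Oct.
Variables (K : fieldType) (r : K).

Definition oct1 : oct r := (1, 0, 0, 0, 0, 0, 0, 0).
Definition oct_mul (p q : oct r) : oct r :=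
  let: (p0, p1, p2, p3, p4, p5, p6, p7) := p in
  let: (q0, q1, q2, q3, q4, q5, q6, q7) := q in
  (p0 * q0, p0 * q1 + p1 * q0, p0 * q2 + p2 * q0, p0 * q3 + p3 * q0,
   p0 * q4 + p4 * q0 + p1 * q2 - r * p2 * q1,
   p0 * q5 + p5 * q0 + p2 * q3 - r * p3 * q2,
   p0 * q6 + p6 * q0 + p3 * q1 - r * p1 * q3,
   p0 * q7 + p7 * q0 + p1 * q5 + p5 * q1 + p2 * q6 + p6 * q2 + p3 * q4 + p4 * q3).

Lemma oct_eq (a0 a1 a2 a3 a4 a5 a6 a7 b0 b1 b2 b3 b4 b5 b6 b7 : K) :
  a0 = b0 -> a1 = b1 -> a2 = b2 -> a3 = b3 ->
  a4 = b4 -> a5 = b5 -> a6 = b6 -> a7 = b7 ->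
  (a0, a1, a2, a3, a4, a5, a6, a7) = (b0, b1, b2, b3, b4, b5, b6, b7) :> oct r.
Proof. by do 8!move=> ->. Qed.

Fact oct_mulA : associative oct_mul.
Proof.
by do 3![case=> [[[[[[[? ?] ?] ?] ?] ?] ?] ?]]; apply: oct_eq; ring.
Qed.
Fact oct_mul1l : left_id oct1 oct_mul.
Proof. by case=> [[[[[[[? ?] ?] ?] ?] ?] ?] ?]; apply: oct_eq; ring. Qed.
Fact oct_mul1r : right_id oct1 oct_mul.
Proof. by case=> [[[[[[[? ?] ?] ?] ?] ?] ?] ?]; apply: oct_eq; ring. Qed.
Lemma oct_addE (a0 a1 a2 a3 a4 a5 a6 a7 b0 b1 b2 b3 b4 b5 b6 b7 : K) :
  ((a0, a1, a2, a3, a4, a5, a6, a7) : oct r) + (b0, b1, b2, b3, b4, b5, b6, b7)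
  = (a0 + b0, a1 + b1, a2 + b2, a3 + b3, a4 + b4, a5 + b5, a6 + b6, a7 + b7).
Proof. by []. Qed.

Lemma oct_oppE (a0 a1 a2 a3 a4 a5 a6 a7 : K) :
  - ((a0, a1, a2, a3, a4, a5, a6, a7) : oct r)
  = (- a0, - a1, - a2, - a3, - a4, - a5, - a6, - a7).
Proof. by []. Qed.

Fact oct_mulDl : left_distributive oct_mul +%R.
Proof.
do 3![case=> [[[[[[[? ?] ?] ?] ?] ?] ?] ?]].
rewrite oct_addE /oct_mul oct_addE; apply: oct_eq; ring.
Qed.
Fact oct_mulDr : right_distributive oct_mul +%R.
Proof.
do 3![case=> [[[[[[[? ?] ?] ?] ?] ?] ?] ?]].
rewrite oct_addE /oct_mul oct_addE; apply: oct_eq; ring.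
Qed.
Fact oct1_neq0 : oct1 != 0.
Proof. by apply/eqP=> -[]; apply/eqP; rewrite oner_eq0. Qed.
End Oct.

HB.instance Definition _ (K : fieldType) (r : K) :=
  GRing.Zmodule_isNzRing.Build (oct r) (@oct_mulA K r) (@oct_mul1l K r)
    (@oct_mul1r K r) (@oct_mulDl K r) (@oct_mulDr K r) (oct1_neq0 r).

Section OctOfFree.
Variables (K : fieldType) (r : K).

Definition oct_scalar (k : K) : oct r := (k, 0, 0, 0, 0, 0, 0, 0).
Fact oct_scalar_additive : additive oct_scalar.
Proof.
by move=> a b; rewrite /oct_scalar oct_oppE oct_addE; apply: oct_eq; ring.
Qed.
HB.instance Definition _ :=
  GRing.isAdditive.Build K (oct r) oct_scalar oct_scalar_additive.
Fact oct_scalar_multiplicative : multiplicative oct_scalar.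
Proof.
split=> [a b|//]; rewrite -[RHS]/(oct_mul _ _) /oct_scalar /oct_mul.
by apply: oct_eq; ring.
Qed.
HB.instance Definition _ :=
  GRing.isMultiplicative.Build K (oct r) oct_scalar oct_scalar_multiplicative.

Definition octx : oct r := (0, 1, 0, 0, 0, 0, 0, 0).
Definition octy : oct r := (0, 0, 1, 0, 0, 0, 0, 0).
Definition octz : oct r := (0, 0, 0, 1, 0, 0, 0, 0).
Definition oct_gen (i : 'I_3) := nth 0 [:: octx; octy; octz] i.
Definition oct_word (m : {fmonom 'I_3}) : oct r := \prod_(i <- (m : seq 'I_3)) oct_gen i.
Fact oct_word_mmorphism : mmorphism oct_word.
Proof.
split=> [m1 m2|]; first by rewrite /oct_word fmM big_cat.
by rewrite /oct_word fm1 big_nil.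
Qed.
HB.instance Definition _ := monalg.isMultiplicative.Build {fmonom 'I_3} (oct r)
  oct_word oct_word_mmorphism.

Definition oct_of_free : free_algebra3 K -> oct r := mmap oct_scalar oct_word.

Lemma oct_scalar_comm k p : oct_scalar k * p = p * oct_scalar k.
Proof.
case: p => [[[[[[[? ?] ?] ?] ?] ?] ?] ?].
rewrite -[LHS]/(oct_mul _ _) -[RHS]/(oct_mul _ _) /oct_scalar /oct_mul.
by apply: oct_eq; ring.
Qed.

Lemma oct_of_free_additive : additive oct_of_free.
Proof. exact: mmap_is_additive. Qed.
Lemma oct_of_free_multiplicative : multiplicative oct_of_free.
Proof.
by apply: commr_mmap_is_multiplicative => g m m'; apply: oct_scalar_comm.
Qed.
Lemma oct_of_freeZ k p : oct_of_free (k *: p) = oct_scalar k * oct_of_free p.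
Proof. exact: mmapZ. Qed.
Lemma oct_of_free_gen i : oct_of_free (free_gen K i) = oct_gen i.
Proof.
transitivity ((1 : oct r) * oct_word (fmu i)); first exact: mmapU.
by rewrite mul1r /oct_word fmU big_seq1.
Qed.

HB.instance Definition _ := GRing.isAdditive.Build (free_algebra3 K) (oct r)
  oct_of_free oct_of_free_additive.
HB.instance Definition _ := GRing.isMultiplicative.Build (free_algebra3 K) (oct r)
  oct_of_free oct_of_free_multiplicative.

Lemma oct_gensE : [/\ oct_gen (inord 0) = octx, oct_gen (inord 1) = octy
  & oct_gen (inord 2) = octz].
Proof. by split; rewrite /oct_gen inordK. Qed.

Lemma oct_mulE (p q : oct r) : p * q = oct_mul p q. Proof. by []. Qed.

Lemma oct_scaleE k (p0 p1 p2 p3 p4 p5 p6 p7 : K) :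
  oct_scalar k * ((p0, p1, p2, p3, p4, p5, p6, p7) : oct r)
  = (k * p0, k * p1, k * p2, k * p3, k * p4, k * p5, k * p6, k * p7).
Proof. by rewrite oct_mulE /oct_scalar /oct_mul; apply: oct_eq; ring. Qed.

Lemma oct_relations_ideal p :
  two_sided_ideal (fun q => q \in Liu_Schulz_relations r) p -> oct_of_free p = 0.
Proof.
have [gx gy gz] := oct_gensE.
elim=> {p} [p||a b _ ha _ hb|a u b _ hu].
- have octE : (0 : oct r) = (0, 0, 0, 0, 0, 0, 0, 0) by [].
  rewrite !inE => /or4P[/eqP->|/eqP->|/eqP->|/or3P[/eqP->|/eqP->|/eqP->]];
    rewrite ?rmorphD ?oct_of_freeZ ?rmorphM /= ?oct_of_freeZ ?rmorphM /= !oct_of_free_gen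
      ?gx ?gy ?gz !oct_mulE /octx /octy /octz /oct_mul -?oct_mulE ?oct_scaleE ?oct_addE octE;
    apply: oct_eq; ring.
- by rewrite rmorph0.
- by rewrite rmorphD /= ha hb addr0.
- by rewrite !rmorphM /= hu mulr0 mul0r.
Qed.
End OctOfFree.

Section Coordinates.
Variables (K : fieldType) (r : K) (hr0 : r != 0).
Variables (A : falgType K) (x y z : A) (hA : is_Liu_Schulz r x y z).

Definition elt (p : oct r) : A :=
  let: (p0, p1, p2, p3, p4, p5, p6, p7) := p in
  p0%:A + p1 *: x + p2 *: y + p3 *: z + p4 *: (x * y) + p5 *: (y * z)
  + p6 *: (z * x) + p7 *: (x * y * z).

Lemma LS_relations : [/\ [/\ x * x = 0, y * y = 0 & z * z = 0],
  y * x = - r *: (x * y), z * y = - r *: (y * z) & x * z = - r *: (z * x)].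
Proof.
case: hA => phi [[px py pz] _ pideal].
have rel k : (k < 6)%N -> phi (nth 0 (Liu_Schulz_relations r) k) = 0.
  by move=> hk; apply/pideal; apply: tsi_gen; apply: mem_nth.
have [r0 r1 r2] : [/\ x * x = 0, y * y = 0 & z * z = 0].
  rewrite -px -py -pz -!rmorphM.
  split; [exact: (rel 0)|exact: (rel 1)|exact: (rel 2)].
split=> //; apply/eqP; rewrite scaleNr -addr_eq0 -1?px -1?py -1?pz -!rmorphM -linearZ -rmorphD;
  apply/eqP; [exact: (rel 3)|exact: (rel 4)|exact: (rel 5)].
Qed.

Lemma eltD p q : elt (p + q) = elt p + elt q.
Proof.
case: p q => [[[[[[[p0 p1] p2] p3] p4] p5] p6] p7] [[[[[[[q0 q1] q2] q3] q4] q5] q6] q7].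
rewrite oct_addE /elt !scalerDl.
by do 7![rewrite [RHS]addrACA; congr (_ + _)].
Qed.
Lemma eltZ k p : elt (oct_scalar r k * p) = k *: elt p.
Proof.
case: p => [[[[[[[p0 p1] p2] p3] p4] p5] p6] p7].
by rewrite oct_scaleE /elt !scalerDr !scalerA.
Qed.
Lemma elt0 : elt 0 = 0.
Proof. by have := eltZ 0 0; rewrite mulr0 scale0r. Qed.

Lemma yzx : y * z * x = x * y * z.
Proof.
have [_ yx zy xz] := LS_relations.
apply: (@scalerI _ _ (- r)); first by rewrite oppr_eq0.
by rewrite -mulrA scalerAr -xz mulrA yx -scalerAl.
Qed.
Lemma zxy : z * x * y = x * y * z.
Proof.
have [_ yx zy xz] := LS_relations.
apply: (@scalerI _ _ (- r)); first by rewrite oppr_eq0.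
by rewrite [LHS]scalerAl -xz -[LHS]mulrA zy -[LHS]scalerAr mulrA.
Qed.

Lemma elt_mul_gen p : [/\ elt (p * octx r) = elt p * x,
  elt (p * octy r) = elt p * y & elt (p * octz r) = elt p * z].
Proof.
have [[xx yy zz] yx zy xz] := LS_relations.
have xyx : x * y * x = 0 by rewrite -mulrA yx -scalerAr mulrA xx mul0r scaler0.
have yzy : y * z * y = 0 by rewrite -mulrA zy -scalerAr mulrA yy mul0r scaler0.
have zxz : z * x * z = 0 by rewrite -mulrA xz -scalerAr mulrA zz mul0r scaler0.
have xyy : x * y * y = 0 by rewrite -mulrA yy mulr0.
have yzz : y * z * z = 0 by rewrite -mulrA zz mulr0.
have zxx : z * x * x = 0 by rewrite -mulrA xx mulr0.
have xyzx : x * y * z * x = 0.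
  by rewrite -2!mulrA [y * _]mulrA yzx 2!mulrA xx !mul0r.
have xyzy : x * y * z * y = 0.
  by rewrite -2!mulrA [y * _]mulrA yzy mulr0.
have xyzz : x * y * z * z = 0 by rewrite -mulrA zz mulr0.
case: p => [[[[[[[p0 p1] p2] p3] p4] p5] p6] p7].
split; rewrite oct_mulE /octx /octy /octz /oct_mul
  !(mulr0, mulr1, mul0r, add0r, addr0, subr0, sub0r) /elt
  !mulrDl -!scalerAl !mul1r ?xx ?yx ?xyx ?yzx ?zxx ?xyzx ?yy ?zy ?zxy ?yzy ?xyy ?xyzy
   ?zz ?xz ?zxz ?yzz ?xyzz !(scaler0, scale0r, addr0, add0r) ?scalerA.
- by rewrite oppr0 scale0r addr0 mulrN [p2 * r]mulrC.
- by rewrite oppr0 scale0r addr0 mulrN [p3 * r]mulrC.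
- by rewrite oppr0 scale0r addr0 mulrN [p1 * r]mulrC; congr (_ + _); rewrite addrAC.
Qed.

Lemma elt1 : elt 1 = 1.
Proof. by rewrite /elt /= scale1r !scale0r !addr0. Qed.

Lemma elt_gen p i :
  elt (p * oct_gen r i) = elt p * nth 0 [:: x; y; z] i.
Proof.
have [ex ey ez] := elt_mul_gen p.
case: i => [[|[|[|//]]]] ?; [exact: ex|exact: ey|exact: ez].
Qed.

(** Both sides are the algebra map that sends the free generators to
    [x], [y], [z]. *)
Lemma elt_of_free (phi : {lrmorphism free_algebra3 K -> A}) p :
  phi (free_gen K (inord 0)) = x -> phi (free_gen K (inord 1)) = y ->
  phi (free_gen K (inord 2)) = z -> elt (oct_of_free r p) = phi p.
Proof.
move=> px py pz.
have phig i : phi (free_gen K i) = nth 0 [:: x; y; z] i.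
  have -> : i = inord i by apply: val_inj; rewrite /= inordK.
  by case: i => [[|[|[|//]]]] ? /=; rewrite inordK.
have word (s : seq 'I_3) :
    elt (oct_of_free r (<< FMonom s >> : {malg K[{fmonom 'I_3}]})) = phi << FMonom s >>.
  elim/last_ind: s => [|s i IH].
    rewrite -fmoneE -[<< fmone _ >>]/(1 : free_algebra3 K).
    by rewrite !rmorph1 elt1.
  have -> : (<< FMonom (rcons s i) >> : {malg K[{fmonom 'I_3}]})
      = (<< FMonom s >> : free_algebra3 K) * free_gen K i.
    rewrite -cats1 malgM_def fgmulUU mulr1; congr << _ >>.
    by apply/eqP; rewrite fmP fmM fmU.
  by rewrite !rmorphM /= oct_of_free_gen elt_gen IH phig.
rewrite [p]monalgE !raddf_sum /= (big_morph elt eltD elt0); apply: eq_bigr => -[s] _.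
have -> : << p@_(FMonom s) *g FMonom s >> = p@_(FMonom s) *: << FMonom s >>.
  by apply/malgP=> k; rewrite mcoeffZ !mcoeffU mulrnAr mulr1.
by rewrite oct_of_freeZ eltZ linearZ word.
Qed.

Lemma elt_surj a : exists p, elt p = a.
Proof.
case: hA => phi [[px py pz] surj _]; have [p <-] := surj a.
by exists (oct_of_free r p); apply: elt_of_free.
Qed.

Lemma oct_of_free_surj p : exists q, oct_of_free r q = p.
Proof.
have [gx gy gz] := oct_gensE r; pose im p := exists q, oct_of_free r q = p.
have imD u v : im u -> im v -> im (u + v).
  by move=> [a <-] [b <-]; exists (a + b); apply: (rmorphD (oct_of_free r)).
have imM u v : im u -> im v -> im (u * v).
  by move=> [a <-] [b <-]; exists (a * b); apply: (rmorphM (oct_of_free r)).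
have imZ k u : im u -> im (oct_scalar r k * u).
  by move=> [a <-]; exists (k *: a); apply: oct_of_freeZ.
have im1 : im 1 by exists 1; apply: (rmorph1 (oct_of_free r)).
have imx : im (octx r) by exists (free_gen K (inord 0)); rewrite oct_of_free_gen gx.
have imy : im (octy r) by exists (free_gen K (inord 1)); rewrite oct_of_free_gen gy.
have imz : im (octz r) by exists (free_gen K (inord 2)); rewrite oct_of_free_gen gz.
case: p => [[[[[[[p0 p1] p2] p3] p4] p5] p6] p7].
have xy : octx r * octy r = (0, 0, 0, 0, 1, 0, 0, 0).
  by rewrite oct_mulE; apply: oct_eq; ring.
have yz : octy r * octz r = (0, 0, 0, 0, 0, 1, 0, 0).
  by rewrite oct_mulE; apply: oct_eq; ring.
have zx : octz r * octx r = (0, 0, 0, 0, 0, 0, 1, 0).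
  by rewrite oct_mulE; apply: oct_eq; ring.
have xyz : octx r * octy r * octz r = (0, 0, 0, 0, 0, 0, 0, 1).
  by rewrite xy oct_mulE; apply: oct_eq; ring.
have -> : ((p0, p1, p2, p3, p4, p5, p6, p7) : oct r) = oct_scalar r p0 * 1
    + oct_scalar r p1 * octx r + oct_scalar r p2 * octy r + oct_scalar r p3 * octz r
    + oct_scalar r p4 * (octx r * octy r) + oct_scalar r p5 * (octy r * octz r)
    + oct_scalar r p6 * (octz r * octx r) + oct_scalar r p7 * (octx r * octy r * octz r).
  have a1 : ((p0, 0, 0, 0, 0, 0, 0, 0) : oct r)
      + (0, p1, 0, 0, 0, 0, 0, 0)
      = (p0, p1, 0, 0, 0, 0, 0, 0).
    by rewrite oct_addE !(addr0, add0r).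
  have a2 : ((p0, p1, 0, 0, 0, 0, 0, 0) : oct r)
      + (0, 0, p2, 0, 0, 0, 0, 0)
      = (p0, p1, p2, 0, 0, 0, 0, 0).
    by rewrite oct_addE !(addr0, add0r).
  have a3 : ((p0, p1, p2, 0, 0, 0, 0, 0) : oct r)
      + (0, 0, 0, p3, 0, 0, 0, 0)
      = (p0, p1, p2, p3, 0, 0, 0, 0).
    by rewrite oct_addE !(addr0, add0r).
  have a4 : ((p0, p1, p2, p3, 0, 0, 0, 0) : oct r)
      + (0, 0, 0, 0, p4, 0, 0, 0)
      = (p0, p1, p2, p3, p4, 0, 0, 0).
    by rewrite oct_addE !(addr0, add0r).
  have a5 : ((p0, p1, p2, p3, p4, 0, 0, 0) : oct r)
      + (0, 0, 0, 0, 0, p5, 0, 0)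
      = (p0, p1, p2, p3, p4, p5, 0, 0).
    by rewrite oct_addE !(addr0, add0r).
  have a6 : ((p0, p1, p2, p3, p4, p5, 0, 0) : oct r)
      + (0, 0, 0, 0, 0, 0, p6, 0)
      = (p0, p1, p2, p3, p4, p5, p6, 0).
    by rewrite oct_addE !(addr0, add0r).
  have a7 : ((p0, p1, p2, p3, p4, p5, p6, 0) : oct r)
      + (0, 0, 0, 0, 0, 0, 0, p7)
      = (p0, p1, p2, p3, p4, p5, p6, p7).
    by rewrite oct_addE !(addr0, add0r).
  rewrite xyz xy yz zx mulr1 /octx /octy /octz !oct_scaleE /oct_scalar.
  by rewrite !(mulr0, mulr1) a1 a2 a3 a4 a5 a6 a7.
have im3 : im (octx r * octy r * octz r) by apply: (imM _ _ _ imz); apply: imM.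
do 7![apply: (imD); last by apply: (imZ) => //; apply: imM].
exact: imZ.
Qed.

(** An element of [oct] is the image of some [q] in the free algebra; when the
    corresponding element of [A] vanishes, [q] lies in the ideal of relations,
    which [oct] satisfies. *)
Lemma elt_inj p : elt p = 0 -> p = 0.
Proof.
case: hA => phi [[px py pz] _ pideal]; have [q <-] := oct_of_free_surj p.
by rewrite (elt_of_free q px py pz) => /pideal/oct_relations_ideal.
Qed.

Lemma eltM p q : elt (p * q) = elt p * elt q.
Proof.
case: hA => phi [[px py pz] _ _].
have [P <-] := oct_of_free_surj p; have [Q <-] := oct_of_free_surj q.
by rewrite -rmorphM !(elt_of_free _ px py pz) rmorphM.
Qed.
End Coordinates.
Arguments elt : simpl never.

(** * Annihilators in the Liu-Schulz algebra *)
Section LiuSchulzFacts.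
Variables (K : fieldType) (r : K) (hr0 : r != 0).
Variables (A : falgType K) (x y z : A) (hA : is_Liu_Schulz r x y z).

Local Notation elt := (@elt K r A x y z).
Definition oct_coord0 (p : oct r) : K := let: (p0, _, _, _, _, _, _, _) := p in p0.
Definition oct_coord7 (p : oct r) : K := let: (_, _, _, _, _, _, _, p7) := p in p7.

Lemma elt_eq0 p : elt p = 0 -> p = 0. Proof. exact: (elt_inj hr0 hA). Qed.
Lemma elt_surjE a : exists p, a = elt p.
Proof. by have [p <-] := elt_surj hr0 hA a; exists p. Qed.
Lemma elt_mulE p q : elt p * elt q = elt (oct_mul p q).
Proof. by rewrite -(eltM hr0 hA). Qed.

Lemma elt_eqP (p0 p1 p2 p3 p4 p5 p6 p7 q0 q1 q2 q3 q4 q5 q6 q7 : K) :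
  elt ((p0, p1, p2, p3, p4, p5, p6, p7) : oct r)
    = elt ((q0, q1, q2, q3, q4, q5, q6, q7) : oct r) ->
  [/\ p0 = q0, p1 = q1, p2 = q2 & p3 = q3] /\ [/\ p4 = q4, p5 = q5, p6 = q6 & p7 = q7].
Proof.
move=> /eqP; rewrite -subr_eq0 => /eqP.
have oppE (q : oct r) : - elt q = elt (- q).
  by apply/eqP; rewrite eq_sym -addr_eq0 -eltD addNr elt0.
rewrite oppE -eltD oct_oppE oct_addE => /elt_eq0[].
by do 8!move=> /subr0_eq->.
Qed.

Lemma elt_subE (p0 p1 p2 p3 p4 p5 p6 p7 q0 q1 q2 q3 q4 q5 q6 q7 : K) :
  elt ((p0, p1, p2, p3, p4, p5, p6, p7) : oct r)
    - elt ((q0, q1, q2, q3, q4, q5, q6, q7) : oct r) =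
  elt ((p0 - q0, p1 - q1, p2 - q2, p3 - q3, p4 - q4, p5 - q5, p6 - q6, p7 - q7) : oct r).
Proof.
apply/eqP; rewrite subr_eq -eltD oct_addE; apply/eqP; congr elt.
by apply: oct_eq; rewrite subrK.
Qed.

Definition pencil a : A := x + a *: y.
Local Notation u := pencil.
Lemma uE a : u a = elt ((0, 1, a, 0, 0, 0, 0, 0) : oct r).
Proof. by rewrite /elt !scale0r scale1r !addr0 add0r. Qed.

Lemma mul_uE p a : elt p * u a = elt (oct_mul p (0, 1, a, 0, 0, 0, 0, 0)).
Proof. by rewrite uE elt_mulE. Qed.

Lemma elt_zero : 0 = elt ((0, 0, 0, 0, 0, 0, 0, 0) : oct r).
Proof. by rewrite -[X in elt X]/(0 : oct r) elt0. Qed.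

Lemma zE : z = elt ((0, 0, 0, 1, 0, 0, 0, 0) : oct r).
Proof. by rewrite /elt !scale0r scale1r !addr0 !add0r. Qed.
Lemma yE : y = elt ((0, 0, 1, 0, 0, 0, 0, 0) : oct r).
Proof. by rewrite /elt !scale0r scale1r !addr0 !add0r. Qed.
Lemma yzE : y * z = elt ((0, 0, 0, 0, 0, 1, 0, 0) : oct r).
Proof. by rewrite /elt !scale0r scale1r !addr0 !add0r. Qed.
Lemma zxE : z * x = elt ((0, 0, 0, 0, 0, 0, 1, 0) : oct r).
Proof. by rewrite /elt !scale0r scale1r !addr0 !add0r. Qed.
Lemma xyzE : x * y * z = elt ((0, 0, 0, 0, 0, 0, 0, 1) : oct r).
Proof. by rewrite /elt !scale0r scale1r !add0r. Qed.

Ltac oct_var w w0 w1 w2 w3 w4 w5 w6 w7 :=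
  have [[[[[[[[w0 w1] w2] w3] w4] w5] w6] w7] ->] := elt_surjE w.

(** [(x + a y) (x + b y) = (b - r a) xy] vanishes for [b = r a]: annihilators move
    the pencil along the orbits of [r], and the syzygy of [M_a] is [M_(r a)]. *)
Lemma u_annr a w : u a * w = 0 <-> exists v, w = u (r * a) * v.
Proof.
split=> [|[v ->]]; last first.
  oct_var v v0 v1 v2 v3 v4 v5 v6 v7.
  by rewrite elt_zero !uE !elt_mulE /oct_mul; congr elt; apply: oct_eq; ring.
oct_var w w0 w1 w2 w3 w4 w5 w6 w7.
rewrite uE elt_mulE /oct_mul elt_zero => /elt_eqP[[e0 e1 e2 e3] [e4 e5 e6 e7]].
have E0 : w0 = 0 by rewrite -[RHS]e1; ring.
have E3 : w3 = 0.
  by apply: (mulfI hr0); rewrite mulr0; apply: oppr_inj; rewrite oppr0 -[RHS]e6; ring.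
have E2 : w2 = r * a * w1.
  by apply/eqP; rewrite -subr_eq0; apply/eqP; rewrite -[RHS]e4 E0; ring.
have E5 : w5 = - a * w6.
  by apply/eqP; rewrite -subr_eq0; apply/eqP; rewrite -[RHS]e7 E0; ring.
exists (elt ((w1, 0, w4, - w6 / r, 0, w7, 0, 0) : oct r)).
by rewrite uE elt_mulE /oct_mul E0 E3 E2 E5; congr elt; apply: oct_eq; field.
Qed.

Lemma u_annl_coords a (p : oct r) : a != 0 -> elt p * u a = 0 ->
  let: (w0, w1, w2, w3, w4, w5, w6, w7) := p in
  [/\ w0 = 0, w3 = 0, a * w1 = r * w2 & w5 = - a * w6].
Proof.
case: p => [[[[[[[w0 w1] w2] w3] w4] w5] w6] w7] a0.
rewrite uE elt_mulE /oct_mul elt_zero => /elt_eqP[[e0 e1 e2 e3] [e4 e5 e6 e7]].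
have E0 : w0 = 0 by rewrite -[RHS]e1; ring.
have E3 : w3 = 0 by rewrite -[RHS]e6 E0; ring.
split=> //; apply/eqP; rewrite -subr_eq0; apply/eqP; first by rewrite -[RHS]e4 E0; ring.
by rewrite -[RHS]e7 E0; ring.
Qed.

Lemma u_annl a w : a != 0 -> w * u (r * a) = 0 <-> exists v, w = v * u a.
Proof.
move=> a0; split=> [|[v ->]]; last first.
  oct_var v v0 v1 v2 v3 v4 v5 v6 v7.
  by rewrite elt_zero !uE !elt_mulE /oct_mul; congr elt; apply: oct_eq; ring.
oct_var w w0 w1 w2 w3 w4 w5 w6 w7.
move=> /u_annl_coords[|-> -> E ->]; first by rewrite mulf_neq0.
have -> : w2 = a * w1 by apply: (mulfI hr0); rewrite mulrA E.
exists (elt ((w1, 0, - w4 / r, w6, 0, w7, 0, 0) : oct r)).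
by rewrite uE elt_mulE /oct_mul; congr elt; apply: oct_eq; field.
Qed.

Definition right_multiple (b : A) (a : A) := exists v, a = b * v.
Local Notation uA := right_multiple.

Lemma uA_coords c w0 w1 w2 w3 w4 w5 w6 w7 :
  uA (u c) (elt ((w0, w1, w2, w3, w4, w5, w6, w7) : oct r)) <->
  [/\ w0 = 0, w3 = 0, w2 = c * w1 & r * w5 = - c * w6].
Proof.
split=> [[v]|[-> -> -> E]].
  oct_var v v0 v1 v2 v3 v4 v5 v6 v7.
  rewrite uE elt_mulE /oct_mul => /elt_eqP[[-> -> -> ->] [_ -> -> _]].
  by split; ring.
have -> : w5 = - c * w6 / r.
  by apply: (mulfI hr0); rewrite E; field.
exists (elt ((w1, 0, w4, - w6 / r, 0, w7, 0, 0) : oct r)).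
by rewrite uE elt_mulE /oct_mul; congr elt; apply: oct_eq; field.
Qed.

(** The four values of [c] for which one of the linear equations in the next
    two lemmas degenerates. *)
Definition resonant (b c : K) :=
  [|| c == b, c == r * b, c == r ^+ 2 * b | c == r ^+ 3 * b].

Lemma eqf_eq (a b w : K) : a != b -> a * w = b * w -> w = 0.
Proof.
move=> ab /eqP; rewrite -subr_eq0 -mulrBl mulf_eq0 subr_eq0 (negPf ab) /= => /eqP//.
Qed.

(** Exactness of multiplication by the [u (r ^+ k * b)] on [Hom(M_c, A)]. *)
Lemma resonant_exactl b c l : c != 0 -> ~~ resonant b c ->
  l * u c = 0 -> u b * l = 0 -> exists2 v, v * u c = 0 & l = u (r * b) * v.
Proof.
rewrite !negb_or => c0 /and4P[n0 n1 n2 n3].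
oct_var l l0 l1 l2 l3 l4 l5 l6 l7.
move=> /(u_annl_coords c0)[-> -> E1 ->].
move=> /u_annr/uA_coords[_ _ E2 E5].
have l10 : l1 = 0.
  by apply: (eqf_eq n2); rewrite E1 E2; ring.
have l20 : l2 = 0 by rewrite E2 l10; ring.
have l60 : l6 = 0.
  apply: (eqf_eq n0); apply: (mulfI hr0); apply: oppr_inj.
  by rewrite -mulrN -mulNr E5; ring.
(* solve for the coordinates of [xy] and [xyz] in [u (r * b) * v] *)
pose al := l4 * r / (c - r ^+ 3 * b); pose ga := l7 / (r * b - c).
have d1 : c - r ^+ 3 * b != 0 by rewrite subr_eq0.
have d2 : r * b - c != 0 by rewrite subr_eq0 eq_sym.
exists (elt ((0, al, al * c / r, 0, 0, - c * ga, ga, 0) : oct r)).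
  by rewrite uE elt_mulE /oct_mul elt_zero; congr elt; apply: oct_eq; field.
rewrite uE elt_mulE /oct_mul l10 l20 l60 /al /ga; congr elt; apply: oct_eq; field;
  by rewrite ?hr0 ?d1 ?d2.
Qed.

(** The same sequence on [M_c]: representatives of elements of [A / u c A]. *)
Lemma resonant_exactr b c m : b != 0 -> ~~ resonant b c ->
  uA (u c) (m * u (r * b)) -> exists v, uA (u c) (m - v * u b).
Proof.
rewrite !negb_or => b0 /and4P[n0 n1 n2 n3].
oct_var m m0 m1 m2 m3 m4 m5 m6 m7.
rewrite mul_uE /oct_mul => /uA_coords[_ _ E1 E2].
have m00 : m0 = 0.
  by apply: (eqf_eq n1); apply/esym; move: E1; rewrite !(mulr0, mul0r, mulr1, addr0, add0r) => <-; ring.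
have m30 : m3 = 0.
  apply: (eqf_eq n3); apply/esym/oppr_inj.
  transitivity (r * (m0 * 0 + 0 * 0 + m2 * 0 - r * m3 * (r * b)));
    first by ring.
  transitivity (- c * (m0 * 0 + 0 * 0 + m3 * 1 - r * m1 * 0)); last by ring.
  by move: E2; rewrite !(mulr0, mul0r, mulr1, addr0, add0r).
have d1 : c - b != 0 by rewrite subr_eq0.
have d2 : r ^+ 2 * b - c != 0 by rewrite subr_eq0 eq_sym.
(* [v = v0 + v3 z] makes the coordinates of [x, y] and of [yz, zx] in [m - v u b]
   satisfy the two equations of [uA_coords] *)
pose v0 := (c * m1 - m2) / (c - b); pose v3 := - (c * m6 + r * m5) / (r ^+ 2 * b - c).
exists (elt ((v0, 0, 0, v3, 0, 0, 0, 0) : oct r)).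
rewrite mul_uE /oct_mul m00 m30 elt_subE; apply/uA_coords.
by split; rewrite /v0 /v3; field; rewrite ?d1 ?d2.
Qed.

(** For [c = r ^+ 3 * b] the equation that forces the coordinate of [z] in a
    cycle to vanish degenerates, whereas boundaries still have no [z]. *)
Lemma resonant_nonexactr b c : c = r ^+ 3 * b ->
  uA (u c) (z * u (r * b)) /\ forall v, ~ uA (u c) (z - v * u b).
Proof.
move=> ->; split=> [|v].
  rewrite [X in uA _ (X * _)]zE mul_uE /oct_mul; apply/uA_coords.
  by split; ring.
oct_var v v0 v1 v2 v3 v4 v5 v6 v7.
rewrite [X in uA _ (X - _)]zE mul_uE /oct_mul elt_subE => /uA_coords[_ /eqP + _ _].
by rewrite !(mulr0, mul0r, addr0, subr0) oner_eq0.
Qed.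

(** [y] represents a nonsplit self-extension of [M_c]: it is a cocycle for the
    resolution by the pencil, and no coboundary. *)
Lemma y_self_extension c :
  uA (u c) (y * u (r * c)) /\ forall v, ~ uA (u c) (y - v * u c).
Proof.
split=> [|v].
  rewrite [X in uA _ (X * _)]yE mul_uE /oct_mul; apply/uA_coords.
  by split; ring.
oct_var v v0 v1 v2 v3 v4 v5 v6 v7.
rewrite [X in uA _ (X - _)]yE mul_uE /oct_mul elt_subE => /uA_coords[_ _ E _].
have /eqP : (1 : K) = 0; last by rewrite oner_eq0.
transitivity (1 - (v0 * c + v2 * 0) - c * (0 - (v0 * 1 + v1 * 0))); last by rewrite E; ring.
by ring.
Qed.

(** [1 |-> zx] is a well-defined map from [M_b] to [M_a], for all [a] and [b]. *)
Lemma zx_commutation a b : z * x * u b = b *: (u a * (y * z)).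
Proof.
rewrite zxE yzE !uE !elt_mulE /oct_mul -eltZ oct_scaleE.
by congr elt; apply: oct_eq; ring.
Qed.

(** The maps [M_c -> A] are the [l] with [l * u c = 0], and left multiplication
    by [u c] embeds [M_(r c)] in [A]; so the map [1 |-> zx] from [M_c] to
    [M_(r c)] factors through no projective module. *)
Lemma zx_not_projective c l : c != 0 -> l * u c = 0 -> u c * l <> u c * (z * x).
Proof.
move=> c0; oct_var l l0 l1 l2 l3 l4 l5 l6 l7 => /(u_annl_coords c0)[-> -> _ ->].
rewrite zxE !uE !elt_mulE /oct_mul => /elt_eqP[_ [_ _ _ E]].
case/eqP: c0; apply/esym.
transitivity (0 * l7 + 0 * 0 + 1 * (- c * l6) + 0 * l1 + c * l6 + 0 * l2 + 0 * l4 + 0 * 0);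
  first by ring.
by rewrite E; ring.
Qed.

Lemma coord_form (f : oct r -> K) :
  (forall k p q, f (oct_scalar r k * p + q) = k * f p + f q) ->
  {h : 'Hom(A, K^o) | forall p, h (elt p) = f p}.
Proof.
move=> lf; pose co a := sval (constructive_indefinite_description _ (elt_surjE a)).
have coE a : elt (co a) = a by rewrite -(svalP (constructive_indefinite_description _ (elt_surjE a))).
have coK p : co (elt p) = p.
  have oppE (q : oct r) : - elt q = elt (- q).
    by apply/eqP; rewrite eq_sym -addr_eq0 -eltD addNr elt0.
  by apply/eqP; rewrite -subr_eq0; apply/eqP/elt_eq0; rewrite eltD -oppE coE subrr.
have [|h hE] := @linear_lfun K A K^o (fun a => f (co a)).
  by move=> k a b; rewrite -lf -[in LHS](coE a) -[in LHS](coE b) -eltZ -eltD coK.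
by exists h => p; rewrite hE coK.
Qed.

Definition aug_sig : {h : 'Hom(A, K^o) | forall p, h (elt p) = oct_coord0 p}.
Proof.
apply: coord_form => k.
move=> [[[[[[[p0 p1] p2] p3] p4] p5] p6] p7] [[[[[[[q0 q1] q2] q3] q4] q5] q6] q7].
by rewrite oct_scaleE oct_addE.
Qed.
Definition aug : 'Hom(A, K^o) := sval aug_sig.
Lemma augE p : aug (elt p) = oct_coord0 p. Proof. exact: (svalP aug_sig). Qed.

Definition socle_form_sig : {h : 'Hom(A, K^o) | forall p, h (elt p) = oct_coord7 p}.
Proof.
apply: coord_form => k.
move=> [[[[[[[p0 p1] p2] p3] p4] p5] p6] p7] [[[[[[[q0 q1] q2] q3] q4] q5] q6] q7].
by rewrite oct_scaleE oct_addE.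
Qed.
Definition socle_form : 'Hom(A, K^o) := sval socle_form_sig.
Lemma socle_formE p : socle_form (elt p) = oct_coord7 p. Proof. exact: (svalP socle_form_sig). Qed.

Lemma augM a b : aug (a * b) = aug a * aug b.
Proof.
oct_var a a0 a1 a2 a3 a4 a5 a6 a7; oct_var b b0 b1 b2 b3 b4 b5 b6 b7.
by rewrite elt_mulE !augE.
Qed.
Lemma aug1 : aug 1 = 1.
Proof. by rewrite -(elt1 r x y z) augE. Qed.

(** The products [xyz], [yzx] and [zxy] coincide. *)
Lemma socle_formC a b : socle_form (a * b) = socle_form (b * a).
Proof.
oct_var a a0 a1 a2 a3 a4 a5 a6 a7; oct_var b b0 b1 b2 b3 b4 b5 b6 b7.
by rewrite !elt_mulE !socle_formE /oct_coord7 /oct_mul; ring.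
Qed.

Lemma socle_form_nondegenerate a : (forall b, socle_form (a * b) = 0) -> a = 0.
Proof.
oct_var a a0 a1 a2 a3 a4 a5 a6 a7 => h.
have H p : oct_coord7 (oct_mul (a0, a1, a2, a3, a4, a5, a6, a7) p) = 0.
  by rewrite -socle_formE -elt_mulE h.
rewrite /oct_coord7 /oct_mul in H.
have -> : a0 = 0 by rewrite -[RHS](H (0, 0, 0, 0, 0, 0, 0, 1)); ring.
have -> : a1 = 0 by rewrite -[RHS](H (0, 0, 0, 0, 0, 1, 0, 0)); ring.
have -> : a2 = 0 by rewrite -[RHS](H (0, 0, 0, 0, 0, 0, 1, 0)); ring.
have -> : a3 = 0 by rewrite -[RHS](H (0, 0, 0, 0, 1, 0, 0, 0)); ring.
have -> : a4 = 0 by rewrite -[RHS](H (0, 0, 0, 1, 0, 0, 0, 0)); ring.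
have -> : a5 = 0 by rewrite -[RHS](H (0, 1, 0, 0, 0, 0, 0, 0)); ring.
have -> : a6 = 0 by rewrite -[RHS](H (0, 0, 1, 0, 0, 0, 0, 0)); ring.
have -> : a7 = 0 by rewrite -[RHS](H (1, 0, 0, 0, 0, 0, 0, 0)); ring.
by rewrite -elt_zero.
Qed.

(** Powers of the augmentation ideal, read off the degrees of the basis. *)
Definition aug_pow_coords k (p : oct r) :=
  let: (p0, p1, p2, p3, p4, p5, p6, p7) := p in
  [&& (0 < k)%N ==> (p0 == 0),
      (1 < k)%N ==> [&& p1 == 0, p2 == 0 & p3 == 0],
      (2 < k)%N ==> [&& p4 == 0, p5 == 0 & p6 == 0]
    & (3 < k)%N ==> (p7 == 0)].
Definition aug_pow k (a : A) := exists2 p, a = elt p & aug_pow_coords k p.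

Lemma aug_pow0 a : aug_pow 0 a.
Proof. by oct_var a a0 a1 a2 a3 a4 a5 a6 a7; eexists. Qed.
Lemma aug_pow4 a : aug_pow 4 a -> a = 0.
Proof.
case=> -[[[[[[[p0 p1] p2] p3] p4] p5] p6] p7] ->.
rewrite /aug_pow_coords /= => /and4P[/eqP-> /and3P[/eqP-> /eqP-> /eqP->]].
by move=> /and3P[/eqP-> /eqP-> /eqP->] /eqP->; rewrite -elt_zero.
Qed.
Lemma aug_pow1P a : aug_pow 1 a <-> aug a = 0.
Proof.
split=> [[p ->]|].
  by case: p => -[[[[[[p0 p1] p2] p3] p4] p5] p6] p7; rewrite augE /= andbT => /eqP.
oct_var a a0 a1 a2 a3 a4 a5 a6 a7; rewrite augE /= => a00.
by eexists; first reflexivity; rewrite /= a00 eqxx.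
Qed.
Lemma aug_powD k a b : aug_pow k a -> aug_pow k b -> aug_pow k (a + b).
Proof.
case=> -[[[[[[[p0 p1] p2] p3] p4] p5] p6] p7] -> Hp.
case=> -[[[[[[[q0 q1] q2] q3] q4] q5] q6] q7] -> Hq.
eexists; first by rewrite -eltD.
move: Hp Hq; rewrite oct_addE /aug_pow_coords.
case/and4P=> h0 h1 h2 h3; case/and4P=> g0 g1 g2 g3.
have D (bb : bool) (s t : K) : bb ==> (s == 0) -> bb ==> (t == 0) -> bb ==> (s + t == 0).
  by case: bb => //= /eqP-> /eqP->; rewrite addr0.
have D3 (bb : bool) (s s' s'' t t' t'' : K) : bb ==> [&& s == 0, s' == 0 & s'' == 0] ->
    bb ==> [&& t == 0, t' == 0 & t'' == 0] ->
    bb ==> [&& s + t == 0, s' + t' == 0 & s'' + t'' == 0].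
  by case: bb => //= /and3P[/eqP-> /eqP-> /eqP->] /and3P[/eqP-> /eqP-> /eqP->]; rewrite !addr0 eqxx.
by apply/and4P; split; [exact: D|exact: D3|exact: D3|exact: D].
Qed.

Lemma aug_pow_mul k a b : aug_pow 1 a -> aug_pow k b -> aug_pow k.+1 (a * b).
Proof.
case=> -[[[[[[[p0 p1] p2] p3] p4] p5] p6] p7] -> /= /andP[/eqP-> _].
case=> -[[[[[[[q0 q1] q2] q3] q4] q5] q6] q7] -> Hq.
eexists; first by rewrite elt_mulE.
move: Hq; rewrite /aug_pow_coords /oct_mul !ltnS; case: k => [_|[|[|[|k]]]] /=.
- by rewrite !mul0r eqxx.
- by move=> /andP[/eqP-> _]; rewrite !(mul0r, mulr0, addr0) !eqxx.
- move=> /and3P[/eqP-> /and3P[/eqP-> /eqP-> /eqP->] _].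
  by rewrite !(mul0r, mulr0, addr0, subr0) !eqxx.
- move=> /and4P[/eqP-> /and3P[/eqP-> /eqP-> /eqP->] /and3P[/eqP-> /eqP-> /eqP->] _].
  by rewrite !(mul0r, mulr0, addr0, subr0) !eqxx.
move=> /and4P[/eqP-> /and3P[/eqP-> /eqP-> /eqP->] /and3P[/eqP-> /eqP-> /eqP->] /eqP->].
by rewrite !(mul0r, mulr0, addr0, subr0) !eqxx.
Qed.

Lemma xyz_neq0 : x * y * z <> 0.
Proof. by rewrite xyzE => /elt_eq0[] /eqP; rewrite oner_eq0. Qed.
Lemma xyz_sandwich a : x * y * z * a * (x * y * z) = 0.
Proof.
rewrite xyzE; oct_var a a0 a1 a2 a3 a4 a5 a6 a7.
rewrite !elt_mulE /oct_mul elt_zero; congr elt; apply: oct_eq; ring.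
Qed.

(** Maps between the summands of [N] are radical unless they start at [A] or
    are endomorphisms. *)
Lemma aug_annl c a : a * u c = 0 -> aug a = 0.
Proof.
oct_var a a0 a1 a2 a3 a4 a5 a6 a7.
rewrite mul_uE /oct_mul elt_zero augE => /elt_eqP[[_ E _ _] _] /=.
by rewrite -[RHS]E; ring.
Qed.
Lemma aug_transport c d a : c != d -> uA (u d) (a * u c) -> aug a = 0.
Proof.
move=> cd; oct_var a a0 a1 a2 a3 a4 a5 a6 a7.
rewrite [_ * u c]mul_uE /oct_mul augE => /uA_coords[_ _ E _] /=.
apply: (eqf_eq cd); transitivity (a0 * c + a2 * 0); first by ring.
by rewrite E; ring.
Qed.
Lemma aug_u c : aug (u c) = 0.
Proof. by rewrite uE augE. Qed.

Lemma Liu_Schulz_idempotent (a : A) : a * a = a -> a = 0 \/ a = 1.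
Proof.
have nil (b : A) : b * b = b -> aug b = 0 -> b = 0.
  move=> bb /aug_pow1P b1; apply: aug_pow4.
  by rewrite -bb -{2}bb -{3}bb; do 2![apply: (aug_pow_mul b1)]; apply: (aug_pow_mul b1).
move=> aa; have /eqP := augM a a; rewrite aa -subr_eq0 -{1}[aug a]mul1r -mulrBl.
rewrite mulf_eq0 => /orP[|/eqP a0]; last by left; apply: nil.
rewrite subr_eq0 => /eqP a1; right; apply/esym/eqP; rewrite -subr_eq0; apply/eqP/nil.
  by rewrite mulrBr mulr1 mulrBl mul1r aa subrr subr0.
by rewrite linearB /= aug1 a1 subrr.
Qed.

Lemma Liu_Schulz_symmetric : symmetric_algebra A.
Proof.
have [|th thE] := @linear_lfun K A 'Hom(A, K^o) (fun a => (socle_form \o amull a)%VF).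
  move=> k a b; apply/lfunP=> t; rewrite add_lfunE scale_lfunE !comp_lfunE !lfunE /=.
  by rewrite mulrDl -scalerAl linearP.
have tE a t : th a t = socle_form (a * t) by rewrite thE comp_lfunE lfunE.
have th0 : lker th = 0%VS.
  apply/eqP; rewrite -subv0; apply/subvP=> a; rewrite memv_ker memv0 => /eqP ha.
  by apply/eqP/socle_form_nondegenerate => b; rewrite -tE ha zero_lfunE.
exists th; split=> // [|a b t t']; last by rewrite !tE -!mulrA socle_formC -!mulrA.
apply/eqP; rewrite eqEsubv subvf /= -(geq_leqif (dimv_leqif_sup (subvf _))).
by rewrite limg_dim_eq ?th0 ?capv0 // !dimvf /dim /= muln1.
Qed.
End LiuSchulzFacts.

(** * Direct sums of cyclic modules *)
(** If [1 = b t + q] with [q] in a complement of [b R], then [b = q b] is in both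
    summands. *)
Lemma not_semisimple (K : fieldType) (R : falgType K) (b : R) :
  b <> 0 -> (forall t, b * t * b = 0) -> ~ semisimple_algebra R.
Proof.
move=> b0 bb /(_ (limg (left_mul b)) (@limg_submod _ _ _ _ _))[W [sW UW0 UW]].
have /memv_addP[p /memv_imgP[t _ pE] [q qW pq]] : (1 : R) \in (limg (left_mul b) + W)%VS.
  by rewrite UW memvf.
apply: b0; apply/eqP; rewrite -memv0 -UW0 memv_cap.
rewrite [left_mul b t]lfunE /= in pE.
have bq : b = (q : regular R) |> b.
  by rewrite lfunE /= -[LHS]mul1r pq mulrDl pE bb add0r.
apply/andP; split; last by rewrite bq; apply: sW.
by apply/memv_imgP; exists (1 : R); rewrite ?memvf // lfunE /= mulr1.
Qed.

Section CyclicSum.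
Variables (K : fieldType) (A : falgType K).

(** [N] is the direct sum of the cyclic modules [g i A], and [g i A] is
    [A / w i A]. *)
Definition cyclic_sum (N : rmod A) m (g : 'I_m -> N) (w : 'I_m -> A) :=
  (forall v, exists a : 'I_m -> A, v = \sum_i g i |> a i) /\
  (forall a : 'I_m -> A, \sum_i g i |> a i = 0 <-> forall i, exists v, a i = w i * v).

Lemma cyclic_regular : @cyclic_sum (regular A) 1 (fun=> 1 : A) (fun=> 0).
Proof.
split=> [v|a]; first by exists (fun=> v); rewrite big_ord1 regular_actE mul1r.
rewrite big_ord1 regular_actE mul1r; split=> [a0 i|/(_ ord0)[v ->]]; last by rewrite mul0r.
by exists 0; rewrite ord1 a0 mulr0.
Qed.

Section AddSummand.
Variables (M N : rmod A) (m : nat) (g : 'I_m -> M) (w : 'I_m -> A) (t : N) (s : A).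

Definition dsum_gen (i : 'I_m.+1) : dsum M N :=
  if unlift ord_max i is Some j then (g j, 0) : (M * N)%type else (0, t).
Definition dsum_rel (i : 'I_m.+1) : A :=
  if unlift ord_max i is Some j then w j else s.

Lemma dsumE (v : dsum M N) a :
  v |> a = ((v : M * N).1 |> a, (v : M * N).2 |> a) :> (M * N)%type.
Proof. exact: lfunE. Qed.

Lemma dsum_gen_sum (a : 'I_m.+1 -> A) :
  \sum_i dsum_gen i |> a i =
  ((\sum_(i < m) g i |> a (lift ord_max i), t |> a ord_max) : (M * N)%type).
Proof.
have pairE (v : M * N) : v = (v.1, 0) + (0, v.2).
  by case: v => v1 v2; congr pair; rewrite ?addr0 ?add0r.
rewrite big_ord_recr /= [RHS]pairE; congr (_ + _); last first.
  by rewrite dsumE /dsum_gen unlift_none /= linear0.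
have sumE (f : 'I_m -> M) : ((\sum_i f i, 0) : M * N) = \sum_i ((f i, 0) : M * N).
  elim/big_ind2: _ => // a1 a2 b1 b2 <- <-; congr pair; by rewrite addr0.
rewrite sumE; apply: eq_bigr => i _.
have -> : widen_ord (leqnSn m) i = lift ord_max i.
  by apply: val_inj; rewrite [RHS]lift_max.
by rewrite dsumE /dsum_gen liftK /= linear0.
Qed.

Lemma cyclic_dsum : cyclic_sum g w ->
  (forall v, exists a, v = t |> a) -> (forall a, t |> a = 0 <-> exists v, a = s * v) ->
  cyclic_sum dsum_gen dsum_rel.
Proof.
move=> [gen rel] tgen trel; split=> [[v1 v2]|a].
  have [a1 a1E] := gen v1; have [a2 a2E] := tgen v2.
  exists (fun i => if unlift ord_max i is Some j then a1 j else a2).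
  rewrite dsum_gen_sum unlift_none a1E a2E; congr pair.
  by apply: eq_bigr => i _; rewrite liftK.
rewrite dsum_gen_sum /dsum_rel; split.
  case=> /rel h1 /trel h2 i.
  by case: unliftP => [j|] ->; [exact: h1|exact: h2].
move=> h; congr pair.
  by apply/rel => i; have := h (lift ord_max i); rewrite liftK.
by apply/trel; have := h ord_max; rewrite unlift_none.
Qed.
End AddSummand.

Lemma coker_left_mul_cyclic (s : A) :
  let t := quop (@limg_submod _ _ _ _ (left_mul s)) (1 : A) in
  (forall v, exists a, v = t |> a) /\ (forall a, t |> a = 0 <-> exists v, a = s * v).
Proof.
move=> t; have tE a : t |> a = quop (@limg_submod _ _ _ _ (left_mul s)) a.
  by rewrite -mhomP regular_actE mul1r.
split=> [v|a].
  have [a aE] := (epiP _).1 (@quop_epi _ _ _ _ (@limg_submod _ _ _ _ (left_mul s))) v.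
  by exists a; rewrite tE aE.
rewrite tE; split=> [/quop_eq0/memv_imgP[v _ ->]|[v ->]].
  by exists v; rewrite lfunE.
by apply/quop_eq0/memv_imgP; exists (v : regular A); rewrite ?memvf // lfunE.
Qed.

Variables x y : A.

Lemma Liu_Schulz_foldl_cyclic (cs : seq K) :
  exists g : 'I_(size cs).+1 ->
    foldl (@dsum K A) (regular A) [seq Liu_Schulz_module x y c | c <- cs],
  cyclic_sum g (fun i => if val i is j.+1 then x + cs`_j *: y else 0).
Proof.
have ext (N : rmod A) m (g : 'I_m -> N) w w' :
    w =1 w' -> cyclic_sum g w -> cyclic_sum g w'.
  move=> ww [gen rel]; split=> // a; split=> [/rel h i|h].
    by rewrite -ww; apply: h.
  by apply/rel => i; rewrite ww.
elim/last_ind: cs => [|cs c [g IH]].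
  exists (fun=> 1 : A); apply: ext cyclic_regular => i.
  by rewrite ord1.
rewrite map_rcons foldl_rcons size_rcons.
have [tgen trel] := coker_left_mul_cyclic (x + c *: y).
eexists; apply: ext (cyclic_dsum IH tgen trel) => i.
rewrite /dsum_rel; case: unliftP => [j|] ->; last by rewrite /= nth_rcons ltnn eqxx.
rewrite [val (lift _ _)]lift_max; case: j => -[|j] //= jlt.
by rewrite nth_rcons -ltnS jlt.
Qed.

Lemma Liu_Schulz_sum_cyclic n (c : 'I_n -> K) :
  exists g : 'I_n.+1 -> Liu_Schulz_sum x y c,
  cyclic_sum g (fun i => if unlift ord0 i is Some j then x + c j *: y else 0).
Proof.
have [] := Liu_Schulz_foldl_cyclic [seq c i | i <- enum 'I_n].
rewrite -map_comp size_map size_enum_ord => g [gen rel]; exists g.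
have wE i : (if val i is j.+1 then x + [seq c i | i <- enum 'I_n]`_j *: y else 0)
    = if unlift ord0 i is Some j then x + c j *: y else 0 :> A.
  case: unliftP => [j|] -> //=.
  by rewrite (nth_map j) ?size_enum_ord ?ltn_ord // nth_ord_enum.
split=> // a; split=> [/rel h i|h]; first by rewrite -wE.
by apply/rel => i; rewrite wE.
Qed.
End CyclicSum.

(** * Endomorphisms of the direct sum *)
Section EndomorphismAlgebra.
Variables (K : fieldType) (r : K) (hr0 : r != 0).
Variables (A : falgType K) (x y z : A) (hA : is_Liu_Schulz r x y z).
Variables (n : nat) (c : 'I_n -> K) (hc0 : forall i, c i != 0).
Variables (N : rmod A) (g : 'I_n.+1 -> N).

Local Notation u := (@pencil K A x y).
Local Notation uA := (@right_multiple K A).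
Local Notation aug := (aug hr0 hA).
Local Notation socle_form := (socle_form hr0 hA).

Definition weight (i : 'I_n.+1) : A := if unlift ord0 i is Some j then u (c j) else 0.
Local Notation w := weight.

Lemma weight0 : w ord0 = 0. Proof. by rewrite /w unlift_none. Qed.
Lemma weightS j : w (lift ord0 j) = u (c j). Proof. by rewrite /w liftK. Qed.

Variable cyc : cyclic_sum g w.
Variables (B : falgType K) (phi : 'Hom(B, 'End(N))).
Hypotheses (phi_ker : lker phi = 0%VS) (phi_img : limg phi = homs N N)
  (phi_1 : phi 1 = \1%VF) (phi_M : forall a b, phi (a * b) = (phi a \o phi b)%VF).

Lemma gens_hom (X : rmod A) (t : 'I_n.+1 -> X) :
  (forall i, t i |> w i = 0) -> exists h : mhom N X, forall i, h (g i) = t i.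
Proof.
move=> tw; have [gen rel] := cyc.
have [p pE] := free_hom g; have [f fE] := free_hom t.
have basisE (X' : rmod A) (t' : 'I_n.+1 -> X') i :
    \sum_j t' j |> (free_basis A i : {ffun _ -> A}) j = t' i.
  rewrite (bigD1 i) //= ffunE eqxx ract_1 big1 ?addr0 // => j /negPf ij.
  by rewrite ffunE ij ract0r.
have [||h hE] := @factor_epi _ _ _ _ _ p f.
- apply/epiP=> v; have [a ->] := gen v.
  by exists ([ffun i => a i] : {ffun _ -> A}); rewrite pE; apply: eq_bigr => i _; rewrite ffunE.
- move=> v; rewrite pE => /rel h; rewrite fE big1 // => i _.
  by have [b ->] := h i; rewrite ract_mul tw linear0.
by exists h => i; rewrite -(basisE N g i) -pE hE fE basisE.
Qed.

Lemma gens_ext (X : rmod A) (h1 h2 : mhom N X) :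
  (forall i, h1 (g i) = h2 (g i)) -> forall v, h1 v = h2 v.
Proof.
move=> h v; have [a ->] := cyc.1 v; rewrite !linear_sum; apply: eq_bigr => i _ /=.
by rewrite !mhomP h.
Qed.

Definition ev (b : B) (v : N) : N := phi b v.

Lemma ev_homP b a v : phi b (v |> a) = phi b v |> a.
Proof.
have /homsP -> // : phi b \in homs N N by rewrite -phi_img memv_img ?memvf.
Qed.
Definition ev_hom b : mhom N N := MHom (ev_homP b).

Lemma evA b v a : ev b (v |> a) = ev b v |> a. Proof. exact: ev_homP. Qed.
Lemma evM b b' v : ev (b * b') v = ev b (ev b' v).
Proof. by rewrite /ev phi_M comp_lfunE. Qed.
Lemma ev1 v : ev 1 v = v. Proof. by rewrite /ev phi_1 id_lfunE. Qed.
Lemma evDl b b' v : ev (b + b') v = ev b v + ev b' v.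
Proof. by rewrite /ev linearD add_lfunE. Qed.
Lemma evZl k b v : ev (k *: b) v = k *: ev b v.
Proof. by rewrite /ev linearZ scale_lfunE. Qed.
Lemma ev_0 b : ev b 0 = 0. Proof. exact: linear0. Qed.
Lemma ev0l v : ev 0 v = 0. Proof. by rewrite /ev linear0 zero_lfunE. Qed.
Lemma ev_eq b b' : (forall v, ev b v = ev b' v) -> b = b'.
Proof.
move=> h; have /eqP/lker0P inj := phi_ker; apply: inj; exact/lfunP.
Qed.
Lemma ev_gens b b' : (forall i, ev b (g i) = ev b' (g i)) -> b = b'.
Proof. by move=> h; apply: ev_eq => v; apply: (@gens_ext N (ev_hom b) (ev_hom b')). Qed.
Lemma ev_full (h : mhom N N) : exists b, forall v, ev b v = h v.
Proof.
have: (h : 'End(N)) \in limg phi by rewrite phi_img; apply/homsP/mhomP.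
by case/memv_imgP=> b _ send; exists b => v; rewrite /ev -send.
Qed.

(** Chosen by epsilon in order to be total in [v]; meaningful only for
    [v |> w j = 0], which is what lets [g j] go to [v]. *)
Definition send j v : B := epsilon (inhabits 0)
  (fun b => forall i, ev b (g i) = if i == j then v else 0).
Lemma sendP j v : v |> w j = 0 -> forall i, ev (send j v) (g i) = if i == j then v else 0.
Proof.
move=> vw; pose P b := forall i, ev b (g i) = if i == j then v else 0.
have [b Pb] : exists b, P b; last exact: (@epsilon_spec _ (inhabits 0) P (ex_intro _ b Pb)).
have [|h hE] := @gens_hom N (fun i => if i == j then v else 0).
  by move=> i; case: eqP => [->|_]; rewrite ?linear0.
by have [b bE] := ev_full h; exists b => i; rewrite bE.
Qed.
Lemma send_gen j v : v |> w j = 0 -> ev (send j v) (g j) = v.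
Proof. by move=> vw; rewrite sendP // eqxx. Qed.
Lemma send_other j v i : v |> w j = 0 -> i != j -> ev (send j v) (g i) = 0.
Proof. by move=> vw /negPf ij; rewrite sendP // ij. Qed.

Let g0w (v : N) : v |> w ord0 = 0. Proof. by rewrite weight0 ract0r. Qed.
Lemma gw i : g i |> w i = 0.
Proof.
have := cyc.2 (fun j => if j == i then w i else 0); rewrite (bigD1 i) //= eqxx.
rewrite big1 ?addr0 => [[_ ->]//|j /negPf->]; last by rewrite ract0r.
by move=> j; case: eqP => [->|_]; [exists 1; rewrite mulr1|exists 0; rewrite mulr0].
Qed.

(** * Coordinates of elements of [N] *)

Lemma coord0_ex : exists h : mhom N (regular A), forall i, h (g i) = (i == ord0)%:R.
Proof.
apply: gens_hom => i; rewrite regular_actE.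
by case: eqP => [->|_]; rewrite ?weight0 ?mulr0 ?mul0r.
Qed.
Definition coord0 : mhom N (regular A) := sval (constructive_indefinite_description _ coord0_ex).
Lemma coord0_g i : coord0 (g i) = (i == ord0)%:R.
Proof. exact: (svalP (constructive_indefinite_description _ coord0_ex)). Qed.
Lemma coord0A v a : coord0 (v |> a) = (coord0 v : A) * a :> A.
Proof. by rewrite mhomP regular_actE. Qed.
Lemma coord0_g0 a : coord0 (g ord0 |> a) = a.
Proof. by rewrite coord0A coord0_g eqxx mul1r. Qed.

Lemma gens_eq0 (a : 'I_n.+1 -> A) :
  \sum_i g i |> a i = 0 <-> a ord0 = 0 /\ forall j, uA (u (c j)) (a (lift ord0 j)).
Proof.
split=> [/(cyc.2) h|[h0 h]].
  split=> [|j]; first by have [v ->] := h ord0; rewrite weight0 mul0r.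
  by have := h (lift ord0 j); rewrite weightS.
apply/(cyc.2) => i; case: (unliftP ord0 i) => [j|] ->; first by rewrite weightS; apply: h.
by exists 0; rewrite mulr0.
Qed.

Lemma aug_weight i : aug (w i) = 0.
Proof. by rewrite /w; case: (unlift ord0 i) => [j|]; [exact: aug_u|exact: linear0]. Qed.

(** [A] acts on [K] through the augmentation, which kills all weights: the
    coordinates of [N] modulo its radical are module maps. *)
Lemma eta_ex j : exists h : 'Hom(N, K^o),
  (forall i, h (g i) = (i == j)%:R) /\ forall v a, h (v |> a) = h v * aug a.
Proof.
pose act (a : A) (k : K^o) : K^o := k * aug a.
have act_lin a : linear (act a) by move=> k p q; rewrite /act mulrDl scalerAl.
have act_linl k : linear (act^~ k).
  by move=> s a b; rewrite /act linearP mulrDr scalerAr.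
have act_1 k : act 1 k = k by rewrite /act aug1 mulr1.
have act_M a b k : act (a * b) k = act b (act a k) by rewrite /act augM mulrA.
have [|h hE] := @gens_hom (rmod_of act_lin act_linl act_1 act_M) (fun i => (i == j)%:R : K^o).
  by move=> i; rewrite rmod_ofE /act aug_weight mulr0.
by exists h; split=> // v a; rewrite [LHS](mhomP h) rmod_ofE.
Qed.
Definition eta_sig j := constructive_indefinite_description _ (eta_ex j).
Definition eta j : 'Hom(N, K^o) := sval (eta_sig j).
Lemma eta_g j i : eta j (g i) = (i == j)%:R. Proof. by case: (svalP (eta_sig j)). Qed.
Lemma etaA j v a : eta j (v |> a) = eta j v * aug a.
Proof. by case: (svalP (eta_sig j)). Qed.

(** * The idempotent of [A] and the form on its corner *)

Definition eA : B := send ord0 (g ord0).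
Lemma ev_e v : ev eA v = g ord0 |> (coord0 v : A).
Proof.
have [h hE] := @free_hom _ _ 1 N (fun=> g ord0).
have [||h' h'E] := @ex_hom _ _ (regular A) N (fun a => g ord0 |> a).
- by move=> k a b; rewrite ractDr ractZr.
- by move=> a b; rewrite regular_actE ract_mul.
rewrite -h'E -comphE; apply: (@gens_ext N (ev_hom eA) (comph h' coord0)) => i.
rewrite comphE h'E coord0_g [LHS]sendP //.
by case: eqP => _; rewrite ?ract_1 ?ract0r.
Qed.
Lemma ev_send0 v t : ev (send ord0 v) t = v |> (coord0 t : A).
Proof.
have [||h' h'E] := @ex_hom _ _ (regular A) N (fun a => v |> a).
- by move=> k a b; rewrite ractDr ractZr.
- by move=> a b; rewrite regular_actE ract_mul.
rewrite -h'E -comphE; apply: (@gens_ext N (ev_hom (send ord0 v)) (comph h' coord0)) => i.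
rewrite comphE h'E coord0_g [LHS]sendP //.
by case: eqP => _; rewrite ?ract_1 ?ract0r.
Qed.

(** Besides the identity of [A] the maps [u (c j / r)] from [M_(c j)] to [A]
    suffice, as they are injective by [u_annr]. *)
Lemma cogenerated v : (forall b, coord0 (ev b v) = 0) -> v = 0.
Proof.
have [a ->] := cyc.1 v => h; apply/gens_eq0.
have hi i l : l * w i = 0 -> l * a i = 0.
  move=> lw; have lw' : (g ord0 |> l) |> w i = 0 by rewrite -ract_mul lw ract0r.
  have := h (send i (g ord0 |> l)).
  have -> : ev (send i (g ord0 |> l)) (\sum_j g j |> a j) = g ord0 |> (l * a i).
    rewrite /ev linear_sum (bigD1 i) //= -!/(ev _ _) evA send_gen // ract_mul.
    rewrite big1 ?addr0 // => j ji; rewrite -/(ev _ _) evA send_other //.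
    exact: linear0.
  by rewrite coord0_g0.
split=> [|j]; first by rewrite -[LHS]mul1r; apply: hi; rewrite weight0 mulr0.
have [cr rcr] : c j / r != 0 /\ r * (c j / r) = c j.
  by rewrite mulf_neq0 ?invr_eq0 // mulrC divfK.
have := hi (lift ord0 j) (u (c j / r)); rewrite weightS => hj.
have [v' ->] : exists v', a (lift ord0 j) = u (r * (c j / r)) * v'.
  apply/(u_annr hr0 hA)/hj; apply/(u_annr hr0 hA); exists 1.
  by rewrite mulr1 rcr.
by exists v'; rewrite rcr.
Qed.

Lemma lam_ex : exists h : 'Hom(B, K^o), forall b, h b = socle_form (coord0 (ev b (g ord0))).
Proof.
have [|h hE] := @linear_lfun K B K^o (fun b => socle_form (coord0 (ev b (g ord0)))).
  by move=> k a b; rewrite evDl evZl !linearP.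
by exists h.
Qed.
Definition lam := sval (constructive_indefinite_description _ lam_ex).
Lemma lamE b : lam b = socle_form (coord0 (ev b (g ord0))).
Proof. exact: (svalP (constructive_indefinite_description _ lam_ex)). Qed.

(** Every element of [N] is a value of a map from [A], and is detected by maps
    to [A]; the trace form of the symmetric algebra [A] does the rest. *)
Lemma end_corner : gendo_corner eA lam.
Proof.
split.
- by apply: ev_eq => v; rewrite evM !ev_e coord0_g0.
- move=> b h; apply: ev_eq => v; rewrite ev0l.
  have := congr1 (ev^~ (g ord0)) (h (send ord0 v)).
  by rewrite ev0l !evM ev_e coord0_g eqxx ract_1 send_gen.
- move=> b h; apply: ev_eq => v; rewrite ev0l; apply: cogenerated => a.
  have := congr1 (fun t => coord0 (ev t v)) (h a).
  by rewrite ev0l linear0 !evM ev_e coord0_g0.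
- by move=> b; rewrite !lamE !evM !ev_e coord0_g0 coord0_g eqxx ract_1.
- move=> b h; apply: ev_eq => v; rewrite evM ev_e ev0l.
  suff -> : coord0 (ev b v) = 0 by rewrite ract0r.
  apply: (socle_form_nondegenerate (hr0:=hr0) (hA:=hA)) => a.
  by rewrite -coord0A -evA -(send_gen (g0w (v |> a))) -evM -lamE h.
move=> b h; apply: ev_eq => v; rewrite evM ev_e ev0l evA.
suff -> : ev b (g ord0) = 0 by exact: linear0.
apply: cogenerated => b'; apply: (socle_form_nondegenerate (hr0:=hr0) (hA:=hA)) => a.
have := h (send ord0 (g ord0 |> a) * b').
by rewrite lamE !evM ev_send0 coord0A coord0_g0 socle_formC.
Qed.

(** * The left ideal [B eA] is [N] *)

Definition pt v : B := send ord0 v.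
Lemma ev_pt v t : ev (pt v) t = v |> (coord0 t : A). Proof. exact: ev_send0. Qed.
Lemma ev_pt0 v : ev (pt v) (g ord0) = v. Proof. exact: send_gen. Qed.
Lemma mul_pt b v : b * pt v = pt (ev b v).
Proof. by apply: ev_eq => t; rewrite evM !ev_pt evA. Qed.
Lemma mul_e b : b * eA = pt (ev b (g ord0)). Proof. exact: mul_pt. Qed.
Lemma pt_e v : pt v * eA = pt v. Proof. by rewrite mul_pt ev_pt0. Qed.
Lemma pt_mul v a : pt v * pt (g ord0 |> a) = pt (v |> a).
Proof. by rewrite mul_pt ev_pt coord0_g0. Qed.
Lemma e_pt a : eA * pt (g ord0 |> a) = pt (g ord0 |> a).
Proof. by rewrite mul_pt ev_e coord0_g0. Qed.
Lemma pt_inj v v' : pt v = pt v' -> v = v'.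
Proof. by move=> h; rewrite -(ev_pt0 v) h ev_pt0. Qed.
Lemma pt0 : pt 0 = 0.
Proof. by apply: ev_eq => t; rewrite ev_pt ev0l linear0. Qed.
Lemma ptP k v v' : pt (k *: v + v') = k *: pt v + pt v'.
Proof. by apply: ev_eq => t; rewrite evDl evZl !ev_pt linearP. Qed.

Lemma tfP (M : rmod B) : tf eA M <-> forall v : M, (forall t, v |> pt t = 0) -> v = 0.
Proof.
split=> h v hv; apply: h => b; last by rewrite -(pt_e b) hv.
by rewrite mul_e hv.
Qed.

Let cor := end_corner.

(** * The dominant dimension of [B] *)

(** Double centralizer property: an element [p] of [I] whose multiples by [B eA]
    lie in [B] acts on [B eA = N] as an endomorphism over [A], that is, as an
    element of [B]; by torsion-freeness of [I] it is that element. *)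
Lemma tf_coker_regular (I : rmod B) (i : mhom (regular B) I) :
  is_mono i -> tf eA I -> tf eA (coker i).
Proof.
move=> mi tI; pose q := quop (@limg_submod _ _ _ _ i).
apply/tfP => zq zqt; have [p pE] := (epiP q).1 (@quop_epi _ _ _ _ _) zq.
have th_ex t : exists s, p |> pt t = i (pt s).
  have := zqt t; rewrite -pE -mhomP => /quop_eq0/memv_imgP[b _ pb].
  exists (ev b (g ord0)); rewrite -mul_e -(pt_e t) ract_mul pb -mhomP.
  by rewrite regular_actE.
pose th t := sval (constructive_indefinite_description _ (th_ex t)).
have thE t : p |> pt t = i (pt (th t)).
  exact: (svalP (constructive_indefinite_description _ (th_ex t))).
have thU t s : p |> pt t = i (pt s) -> th t = s.
  by rewrite thE => /(mhom_inj mi)/pt_inj.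
have [||h hE] := @ex_hom _ _ N N th.
- move=> k t t'; apply: thU; rewrite !ptP ractDr ractZr !thE linearD linearZ //.
- move=> a t; apply: thU; rewrite -[pt (t |> a)]pt_mul ract_mul thE -mhomP.
  by rewrite regular_actE pt_mul.
have [b bE] := ev_full h.
rewrite -pE; apply/quop_eq0; suff -> : p = i b by rewrite memv_img ?memvf.
apply/eqP; rewrite -subr_eq0; apply/eqP; apply: (tfP I).1 => // t.
by rewrite [LHS]linearB [X in X - _]thE -[X in _ - X](mhomP i) regular_actE mul_pt bE hE subrr.
Qed.

Lemma gens_coord j t a s : g (lift ord0 j) |> a = t |> s ->
  exists v, uA (u (c j)) (a - v * s).
Proof.
have [b ->] := cyc.1 t => h.
have /gens_eq0[_ /(_ j)] :
    \sum_k g k |> ((if k == lift ord0 j then a else 0) - b k * s) = 0.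
  under eq_bigr do rewrite ractBr ract_mul.
  rewrite sumrB (bigD1 (lift ord0 j)) //= eqxx big1 => [|k /negPf->]; last exact: ract0r.
  by rewrite addr0 h linear_sum subrr.
by rewrite eqxx => hu; exists (b (lift ord0 j)).
Qed.

Lemma gens_uA j a : uA (u (c j)) a -> g (lift ord0 j) |> a = 0.
Proof. by case=> v ->; rewrite ract_mul -weightS gw linear0. Qed.

(** By injectivity [u c] divides the element [y] of the summand [M_c] in [I], with
    quotient [q]; modulo [B], [q] defines a map on [M_c], which extends to an
    element [s] of [J].  It is torsion modulo the first cosyzygy, and would lie
    in it only if [y] were divisible by [u c] in [M_c], against
    [y_self_extension]. *)
Lemma ntf_second_cosyzygy (j : 'I_n) (I J : rmod B) (i : mhom (regular B) I)
    (k : mhom (coker i) J) :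
  injective_mod I -> is_mono i -> tf eA (coker i) -> injective_mod J -> is_mono k ->
  ~ tf eA (coker k).
Proof.
move=> injI mi tZ injJ mk tW; pose gj := g (lift ord0 j); pose cj := c j.
pose p := quop (@limg_submod _ _ _ _ i).
have [yu yn] := y_self_extension hr0 hA cj.
have [q qE] : exists q, q |> pt (g ord0 |> u cj) = i (pt (gj |> y)).
  apply: injective_div injI _ => b ab0.
  rewrite -(mhomP i) regular_actE (_ : pt _ * b = 0) ?linear0 //.
  apply: ev_eq => t; rewrite ev0l evM ev_pt -ract_mul.
  have /(u_annr hr0 hA)[v ->] : u cj * coord0 (ev b t) = 0.
    have := congr1 (fun b => coord0 (ev b t)) ab0.
    by rewrite evM ev_pt ev0l linear0 -ract_mul coord0_g0.
  by rewrite mulrA ract_mul gens_uA ?linear0.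
have qu : p q |> pt (g ord0 |> u cj) = 0.
  by rewrite -(mhomP p) qE; apply/quop_eq0; rewrite memv_img ?memvf.
have [s sE] : exists s, s |> pt gj = k (p q |> eA).
  apply: injective_div injJ _ => b gb0.
  rewrite -(mhomP k) -ract_mul (_ : p q |> (eA * b) = 0) ?linear0 //.
  apply: (tfP _).1 tZ _ _ => t; rewrite -ract_mul mul_pt evM ev_e.
  have [v ->] : uA (u cj) (coord0 (ev b t)).
    have := congr1 (ev^~ t) gb0; rewrite evM ev_pt ev0l => h.
    have [] := @gens_coord j 0 (coord0 (ev b t)) 0; first by rewrite h linear0.
    by move=> v; rewrite mulr0 subr0.
  by rewrite ract_mul -pt_mul ract_mul qu linear0.
have gjw : gj |> w (lift ord0 j) = 0 by exact: gw.
pose ep := send (lift ord0 j) gj.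
suff /quop_eq0/memv_imgP[ze _ zeE] : quop (@limg_submod _ _ _ _ k) (s |> ep) = 0.
  have [w' w'E] := (epiP p).1 (@quop_epi _ _ _ _ _) ze.
  have : p (w' |> pt gj - q |> eA) = 0.
    have E1 : k (p (w' |> pt gj)) = s |> pt gj.
      by rewrite (mhomP p) (mhomP k) w'E -zeE -ract_mul mul_pt send_gen.
    have E2 : k (p (q |> eA)) = s |> pt gj by rewrite (mhomP p) sE.
    have pB a b : p (a - b) = p a - p b by exact: linearB.
    have kB a b : k (a - b) = k a - k b by exact: linearB.
    by apply: (mhom_inj mk); rewrite linear0 pB kB E1 E2 subrr.
  move=> /quop_eq0/memv_imgP[b _ hb].
  have h : i (pt (ev b (g ord0) |> u cj)) = - i (pt (gj |> y)).
    transitivity (i b |> pt (g ord0 |> u cj)).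
      by rewrite -(mhomP i) regular_actE mul_pt evA.
    rewrite -hb -qE; transitivity (w' |> pt gj |> pt (g ord0 |> u cj)
        - q |> eA |> pt (g ord0 |> u cj)); first exact: linearB.
    by rewrite -!ract_mul pt_mul e_pt -weightS gjw pt0 ract0r sub0r.
  have [v] : exists v, uA (u cj) (y - v * u cj); last by move/yn.
  apply: (@gens_coord j (- ev b (g ord0))); apply: pt_inj; apply: (mhom_inj mi).
  have -> : - ev b (g ord0) |> u cj = (-1) *: (ev b (g ord0) |> u cj) + 0.
    by rewrite addr0 scaleN1r linearN.
  rewrite ptP pt0 addr0 scaleN1r [RHS]linearN /= h opprK //.
apply: tW => b; rewrite -(mhomP (quop _)); apply/quop_eq0.
rewrite -ract_mul mul_e mul_pt.
have [a aE] := cyc.1 (ev b (g ord0)).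
have -> : ev ep (ev b (g ord0)) = gj |> a (lift ord0 j).
  rewrite aE /ev linear_sum (bigD1 (lift ord0 j)) //= -!/(ev _ _) evA send_gen //.
  rewrite big1 ?addr0 // => k' kj; rewrite -/(ev _ _) evA send_other //.
  exact: linear0.
by rewrite -pt_mul ract_mul sE -(mhomP k) memv_img ?memvf.
Qed.

Lemma end_domdim (j : 'I_n) : has_domdim (regular B) 2.
Proof.
apply: (DD_domdim cor).
have tR := tf_regular cor; set i := hull_map (regular B).
have tZ := tf_coker_regular (hull_mono _) (tf_hull tR).
apply: (@DDS _ _ _ _ _ _ i (quop (@limg_submod _ _ _ _ i))).
- exact: hull_mono.
- exact: quop_epi.
- by rewrite lker_quop.
- exact: hull_injective.
- exact: tf_hull.
set k := hull_map (coker i).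
apply: (@DDS _ _ _ _ _ _ k (quop (@limg_submod _ _ _ _ k))).
- exact: hull_mono.
- exact: quop_epi.
- by rewrite lker_quop.
- exact: hull_injective.
- exact: tf_hull.
apply: DD0.
exact: (ntf_second_cosyzygy j (@hull_injective _ _ _) (hull_mono _) tZ
  (@hull_injective _ _ _) (hull_mono _)).
Qed.

(** * Codominant dimension *)

Lemma cor_op : @gendo_corner K B^c eA lam. Proof. exact: gendo_corner_op. Qed.

Local Notation Be := (@corner_mod K B^c eA).
Local Notation inBe := (@corner_incl K B^c eA).

Lemma Be_pt (m : Be) : inBe m = pt (ev (inBe m) (g ord0)).
Proof. by rewrite -mul_e -[LHS](corner_inclE cor_op). Qed.
Lemma Be_ex t : exists m : Be, inBe m = pt t.
Proof. by apply: corner_incl_ex; rewrite -[LHS]/((pt t : B) * eA) pt_e. Qed.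

(** Over the opposite algebra, [corner_mod] is the left ideal [B eA], that is
    [N], on which the right action of [A] is by module maps. *)
Lemma rmul_Be_ex a : exists h : mhom Be Be,
  forall m t, inBe m = pt t -> inBe (h m) = pt (t |> a).
Proof.
pose s : B^c := pt (g ord0 |> a).
have lE (v : B^c) : left_mul s v = (v : B) * pt (g ord0 |> a) :> B by rewrite [LHS]lfunE.
have [|h hE] := @lift_mono _ _ Be Be _ inBe (comph (left_mul s) inBe) (incl_mono _).
  move=> m; rewrite comphE; apply: corner_incl_ex.
  by rewrite lE -[LHS]/((_ * _ : B) * eA) Be_pt pt_mul pt_e.
by exists h => m t mt; rewrite hE comphE lE mt pt_mul.
Qed.
Definition rmul_Be a := sval (constructive_indefinite_description _ (rmul_Be_ex a)).
Lemma rmul_BeE a m t : inBe m = pt t -> inBe (rmul_Be a m) = pt (t |> a).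
Proof. exact: (svalP (constructive_indefinite_description _ (rmul_Be_ex a))). Qed.

(** As a left module, [pencil_ker b] is [Hom(M_b, N)]. *)
Definition pencil_ker b : rmod B^c := subm (@lker_submod _ _ _ _ (rmul_Be (u b))).

(** The summand [A] of [N] contributes by the annihilators of the pencil, the
    summands [M_(c j)] by the absence of resonance. *)
Lemma rmul_Be_exact b : b != 0 -> (forall j, ~~ resonant r b (c j)) ->
  limg (rmul_Be (u b)) = lker (rmul_Be (u (r * b))).
Proof.
move=> b0 res; apply/exactP => m; have [t mt] : exists t, inBe m = pt t.
  by eexists; apply: Be_pt.
have pt_in0 (m' : Be) t' : inBe m' = pt t' -> (m' = 0 <-> t' = 0).
  move=> m't'; split=> [m0|t0].
    by apply: pt_inj; rewrite -m't' m0 linear0 pt0.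
  by apply: (mhom_inj (incl_mono _)); rewrite [LHS]m't' t0 pt0 linear0.
rewrite (pt_in0 _ _ (rmul_BeE _ mt)); split=> [tu|[m' m'm]]; last first.
  move: mt; rewrite -m'm (rmul_BeE _ (Be_pt m')) => /pt_inj <-.
  rewrite -ract_mul (_ : u b * u (r * b) = 0) ?ract0r //.
  by apply/(u_annr hr0 hA); exists 1; rewrite mulr1.
suff [t' t'E] : exists t', t = t' |> u b.
  have [m' m't'] := Be_ex t'; exists m'.
  by apply: (mhom_inj (incl_mono _)); rewrite [LHS](rmul_BeE _ m't') -t'E -mt.
have [a aE] := cyc.1 t; move: tu; rewrite aE linear_sum /=.
under eq_bigr do rewrite -ract_mul.
move=> /(@gens_eq0)[h0 h].
have [v0 v0E] := (u_annl hr0 hA _ b0).1 h0.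
have hv j : exists v, uA (u (c j)) (a (lift ord0 j) - v * u b).
  exact: (resonant_exactr hr0 hA b0 (res j) (h j)).
pose v i := if unlift ord0 i is Some j then sval (constructive_indefinite_description _ (hv j)) else v0.
exists (\sum_i g i |> v i); rewrite linear_sum /=.
apply/eqP; rewrite -subr_eq0 -sumrB; apply/eqP.
under eq_bigr do rewrite -ract_mul -ractBr.
apply/gens_eq0; rewrite /v; split=> [|j]; first by rewrite unlift_none v0E subrr.
by rewrite liftK; apply: (svalP (constructive_indefinite_description _ (hv j))).
Qed.

(** The obstruction [z] in [M_(c j)] is torsion: every map to [A] takes it to a
    left annihilator of [u (r * b)], hence to a multiple of [u b]. *)
Lemma ntf_resonance b j : b != 0 -> c j = r ^+ 3 * b ->
  ~ @tf K B^c eA (quo (@limg_submod _ _ _ _ (rmul_Be (u b)))).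
Proof.
move=> b0 cb; pose q := quop (@limg_submod _ _ _ _ (rmul_Be (u b))).
have [zu zn] := resonant_nonexactr hr0 hA cb.
have [m mE] := Be_ex (g (lift ord0 j) |> z) => tq.
have /quop_eq0/memv_imgP[m' _ m'E] : q m = 0.
  apply: tq => s; rewrite -(mhomP q); apply/quop_eq0.
  have sE : inBe (m |> ((s : B^c) * eA)) = pt (ev (eA * (s : B)) (g (lift ord0 j) |> z)).
    by rewrite (mhomP inBe) [LHS]regular_actE -mul_pt -mE.
  have [|v vE] := (u_annl hr0 hA (coord0 (ev s (g (lift ord0 j) |> z))) b0).1.
    by rewrite -coord0A -evA -ract_mul gens_uA // ev_0 linear0.
  have [m' m'E] := Be_ex (g ord0 |> v).
  apply/memv_imgP; exists m'; rewrite ?memvf //.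
  apply: (mhom_inj (incl_mono _)); rewrite [RHS](rmul_BeE _ m'E) [LHS]sE.
  by rewrite evM ev_e vE ract_mul.
have h : g (lift ord0 j) |> z = ev (inBe m') (g ord0) |> u b.
  by apply: pt_inj; rewrite -mE m'E (rmul_BeE _ (Be_pt m')).
by have [v] := gens_coord h; apply: zn.
Qed.

Lemma pencil_ker_DD m b j : b != 0 -> r ^+ (m + 3) * b = c j ->
  (forall i l, (0 < l)%N -> r ^+ l * c i != c j) -> @DD K B^c eA (pencil_ker b) m.+2.
Proof.
move=> + + jmin; elim: m b => [|m IH] b b0 bj.
  pose jm := incl (@limg_submod _ _ _ _ (rmul_Be (u b))).
  have [|p [ep kp]] := @ker_cover _ _ Be Be _ (rmul_Be (u b)) jm (incl_mono _).
    by rewrite limg_incl.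
  apply: (DDS (incl_mono _) ep kp (corner_mod_injective cor_op) (corner_mod_tf cor_op)).
  apply: (DDS (incl_mono _) (@quop_epi _ _ _ _ _) _ (corner_mod_injective cor_op)
     (corner_mod_tf cor_op) (DD0 (ntf_resonance b0 (esym bj)))).
  by rewrite limg_incl lker_quop.
have res i : ~~ resonant r b (c i).
  (* a resonance [c i = r ^+ t * b] makes [c j] a proper multiple of [c i] *)
  have nr t : (t < 4)%N -> c i != r ^+ t * b.
    move=> t4; apply/negP=> /eqP cE; have t4' : (t < m.+4)%N by apply: leq_trans t4 _.
    have lt0 : (0 < m.+4 - t)%N by rewrite subn_gt0.
    move/negP: (jmin i _ lt0); apply.
    by rewrite cE mulrA -exprD subnK 1?ltnW // -bj addSn addn3.
  rewrite /resonant !negb_or; apply/and4P; split.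
  - by rewrite -[b]mul1r -(expr0 r) nr.
  - by rewrite -[X in X * b](expr1 r) nr.
  - exact: nr.
  - exact: nr.
have [|p [ep kp]] := @ker_cover _ _ Be Be _ (rmul_Be (u b))
    (incl (@lker_submod _ _ _ _ (rmul_Be (u (r * b))))) (incl_mono _).
  by rewrite limg_incl rmul_Be_exact.
apply: (DDS (incl_mono _) ep kp (corner_mod_injective cor_op) (corner_mod_tf cor_op)).
apply: IH; first by rewrite mulf_neq0.
by rewrite mulrA -exprSr.
Qed.

Lemma end_infinite_finitistic_codomdim j :
  (forall i l, (0 < l)%N -> r ^+ l * c i != c j) -> infinite_finitistic_codomdim B.
Proof.
move=> jmin m; pose b := r ^- (m + 3) * c j.
have b0 : b != 0 by rewrite mulf_neq0 ?invr_eq0 ?expf_neq0.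
have bj : r ^+ (m + 3) * b = c j by rewrite /b mulrA divff ?mul1r ?expf_neq0.
exists (ldual (pencil_ker b)), m.+2; split; last by rewrite !leqW.
apply: has_domdim_iso (double_dual_iso _) _.
exact: (DD_domdim cor_op (pencil_ker_DD b0 bj jmin)).
Qed.

(** * Failure of the left weak Gorenstein property *)

(** An element of [eA B] is a family of maps from the summands of [N] to [A];
    exactness is checked on each of them. *)
Lemma gens_exactl b (beta : B) : (forall j, ~~ resonant r b (c j)) ->
  pt (g ord0 |> u b) * beta = 0 ->
  exists s, eA * s = s /\ eA * beta = pt (g ord0 |> u (r * b)) * s.
Proof.
move=> res h.
have hk i : u b * coord0 (ev beta (g i)) = 0.
  have := congr1 (fun t => coord0 (ev t (g i))) h.
  by rewrite evM ev_pt ev0l linear0 -ract_mul coord0_g0.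
have hw i : (coord0 (ev beta (g i)) : A) * w i = 0.
  by rewrite -coord0A -evA gw ev_0 linear0.
have hv i : exists v, v * w i = 0 /\ coord0 (ev beta (g i)) = u (r * b) * v :> A.
  have := hw i; have := hk i; case: (unliftP ord0 i) => [j|] -> h1 h2.
    move: h2; rewrite weightS => h2.
    by have [v v1 v2] := resonant_exactl hr0 hA (hc0 j) (res j) h2 h1; exists v.
  have /(u_annr hr0 hA)[v vE] := h1.
  by exists v; rewrite weight0 mulr0.
pose v i := sval (constructive_indefinite_description _ (hv i)).
have vP i : v i * w i = 0 /\ coord0 (ev beta (g i)) = u (r * b) * v i :> A.
  exact: (svalP (constructive_indefinite_description _ (hv i))).
have [|t tE] := @gens_hom N (fun i => g ord0 |> v i).
  by move=> i; rewrite -ract_mul (vP i).1 ract0r.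
have [s sE] := ev_full t; exists s.
split; apply: ev_gens => i; first by rewrite evM ev_e sE tE coord0_g0.
by rewrite !evM ev_e ev_pt sE tE coord0_g0 (vP i).2 ract_mul.
Qed.

Lemma ptu_mul a : pt (g ord0 |> u a) * pt (g ord0 |> u (r * a)) = 0.
Proof.
rewrite pt_mul -ract_mul (_ : u a * u (r * a) = 0) ?ract0r ?pt0 //.
by apply/(u_annr hr0 hA); exists 1; rewrite mulr1.
Qed.

Section NotWeaklyGorenstein.
Variable j : 'I_n.
Hypothesis jmax : forall i l, (0 < l)%N -> c i != r ^+ l * c j.

Let a k := r ^+ k.+1 * c j.
Let s k := pt (g ord0 |> u (a k)).
Let ra k : r * a k = a k.+1. Proof. by rewrite /a mulrA -exprS. Qed.
Let a0 k : a k != 0. Proof. by rewrite mulf_neq0 ?expf_neq0. Qed.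
Let ss k : s k * s k.+1 = 0. Proof. by rewrite /s -ra ptu_mul. Qed.
Let se k : s k * eA = s k. Proof. exact: pt_e. Qed.
Let es k : eA * s k = s k. Proof. exact: e_pt. Qed.
Let ee : eA * eA = eA. Proof. exact: corner_idem cor. Qed.
Let nores k i : ~~ resonant r (a k) (c i).
Proof.
rewrite /resonant /a !mulrA -exprS -!exprD !negb_or !jmax //.
Qed.

(** The resolution of [eA B / s 0 B] by copies of [eA B], made cyclic over [B]:
    the complement [(1 - eA) B] is mapped identically by every other
    differential, and remains as a projective summand of [B / syz 0 B]. *)
Let syz k := s k + (if odd k then 1 - eA else 0).

Let s1e k : s k * (1 - eA) = 0. Proof. by rewrite mulrBr mulr1 se subrr. Qed.
Let es1 k : (1 - eA) * s k = 0. Proof. by rewrite mulrBl mul1r es subrr. Qed.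
Let e1e : eA * (1 - eA) = 0. Proof. by rewrite mulrBr mulr1 ee subrr. Qed.
Let ee1 : (1 - eA) * eA = 0. Proof. by rewrite mulrBl mul1r ee subrr. Qed.
Let e1e1 : (1 - eA) * (1 - eA) = 1 - eA. Proof. by rewrite mulrBr mulr1 ee1 subr0. Qed.

Let syz_annr k b : syz k * b = 0 <-> exists t, b = syz k.+1 * t.
Proof.
have ex : s k * b = 0 -> exists t, eA * t = t /\ eA * b = s k.+1 * t.
  by move=> sb; rewrite /s -ra; apply: gens_exactl sb; apply: nores.
rewrite /syz /=; case: (odd k) => /=; rewrite ?addr0.
  split=> [h|[t ->]]; last by rewrite mulrA mulrDl ss es1 addr0 mul0r.
  have sb : s k * b = 0.
    have := congr1 (fun t => eA * t) h.
    by rewrite mulr0 mulrA mulrDr es e1e addr0.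
  have [t [et bt]] := ex sb; exists t; rewrite -bt.
  by move: h; rewrite mulrDl sb add0r mulrBl mul1r => /eqP; rewrite subr_eq0 => /eqP.
split=> [/ex[t [et bt]]|[t ->]]; last by rewrite mulrA mulrDr ss s1e addr0 mul0r.
(* [f] stands for [1 - eA] *)
have key (f : B) : s k.+1 * f = 0 -> f * f = f -> f * t = 0 -> eA * b + f * b = b ->
    b = (s k.+1 + f) * (t + f * b).
  move=> sf ff ft eb; rewrite mulrDr !mulrDl -bt ft addr0 !mulrA sf mul0r add0r.
  by rewrite ff eb.
exists (t + (1 - eA) * b); apply: key => //.
  by rewrite -et mulrA ee1 mul0r.
by rewrite -mulrDl addrC subrK mul1r.
Qed.

Let syz_annl k b : b * syz k.+1 = 0 -> exists t, b = t * syz k.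
Proof.
have ex : b * s k.+1 = 0 -> exists t, b * eA = t * s k.
  move=> bs; have [t tE] : exists t, ev b (g ord0) = t |> u (a k).
    have h : ev b (g ord0) |> u (r * a k) = 0.
      by apply: pt_inj; rewrite -evA -mul_pt ra pt0.
    have [m mE] := Be_ex (ev b (g ord0)).
    have : rmul_Be (u (r * a k)) m = 0.
      by apply: (mhom_inj (incl_mono _)); rewrite [LHS](rmul_BeE _ mE) h pt0 linear0.
    move=> /((exactP _ _).1 (rmul_Be_exact (a0 k) (nores k)))[m' m'E].
    exists (ev (inBe m') (g ord0)); apply: pt_inj.
    by rewrite -mE -m'E (rmul_BeE _ (Be_pt m')).
  by exists (pt t); rewrite mul_e tE pt_mul.
rewrite /syz /=; case: (odd k) => /=; rewrite ?addr0.
  move=> /ex[t tE]; exists (t * eA + b * (1 - eA)).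
  (* [f] stands for [1 - eA] *)
  have key (f : B) : eA * f = 0 -> f * s k = 0 -> f * f = f -> b * eA + b * f = b ->
      b = (t * eA + b * f) * (s k + f).
    move=> ef fs ff be; rewrite mulrDl !mulrDr -!mulrA es ef fs ff !mulr0 addr0 add0r.
    by rewrite -tE be.
  by apply: key => //; rewrite -mulrDr addrC subrK mulr1.
rewrite mulrDr => h; have [|t tE] := ex.
  have := congr1 (fun t => t * eA) h.
  by rewrite mul0r mulrDl -!mulrA se ee1 mulr0 addr0.
exists t; rewrite -tE; have := congr1 (fun t => t * (1 - eA)) h.
rewrite mul0r mulrDl -!mulrA s1e e1e1 mulr0 add0r mulrBr mulr1 => /eqP.
by rewrite subr_eq0 => /eqP.
Qed.

Let M := coker (left_mul (syz 0)).
Let q : mhom (regular B) M := quop (@limg_submod _ _ _ _ (left_mul (syz 0))).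
Let gj := g (lift ord0 j).

Let star_val (sg : star M) : B := vsval sg (q (1 : B)).
Let valE (sg : star M) (b : B) : vsval sg (q b) = star_val sg * b :> B.
Proof.
have [h hE] := star_hom sg; rewrite /star_val -!hE -[in LHS](mul1r b).
by rewrite -[1 * b]/((1 : B) * b) -regular_actE (mhomP q) (mhomP h) regular_actE.
Qed.
Let nval sg := ev (star_val sg) (g ord0).
Let nval_u sg : nval sg |> u (a 0) = 0.
Proof.
have: star_val sg * syz 0 = 0.
  rewrite -valE (_ : q (syz 0) = 0) ?linear0 //; apply/quop_eq0.
  by apply/memv_imgP; exists (1 : B); rewrite ?memvf // left_mulE mulr1.
by rewrite /syz addr0 mul_pt evA => h; apply: pt_inj; rewrite pt0.
Qed.
Let zx_w (t : N) : t |> u (a 0) = 0 -> t |> (z * x) |> w (lift ord0 j) = 0.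
Proof.
move=> tu; rewrite weightS -ract_mul (zx_commutation hr0 hA (a 0)).
by rewrite ractZr ract_mul tu linear0 scaler0.
Qed.

(** Coupling with the stable map [1 |-> zx] from [M_c] to [M_(r c)]: it defines
    a functional on [star M], and a restriction from [star B] would make that
    map factor through [A]. *)
Lemma end_not_left_weakly_Gorenstein : ~ left_weakly_Gorenstein B.
Proof.
have extM : ext_pos_eq0 M (regular B) := ext_cyclic syz_annr syz_annl.
move=> /(_ M extM) GP.
have [||f fE] := @ex_hom _ _ (star M) (regular B^c)
    (fun sg => send (lift ord0 j) (nval sg |> (z * x))).
- move=> k sg tau; apply: ev_gens => i.
  rewrite evDl evZl !sendP ?zx_w //; case: eqP => _; last by rewrite scaler0 addr0.
  rewrite -linearP /=; congr (_ |> _).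
  rewrite /nval -evZl -evDl; congr (ev _ _).
  by rewrite /star_val linearP add_lfunE scale_lfunE.
- move=> b sg; apply: ev_gens => i; rewrite regular_actE -[RHS]/(ev ((b : B) * _) (g i)).
  rewrite evM !sendP ?zx_w //; case: eqP => _; last by rewrite ev_0.
  by rewrite /nval /star_val star_actE evM evA.
have eq : is_epi q by exact: quop_epi.
have [F FE] := Gorenstein_projective_extend eq GP f.
(* the extended functional is right multiplication by its value [t] at the identity *)
have [id1 id1E] := star_elt (idh (regular B)).
pose t : B := F id1.
have Ft sg : send (lift ord0 j) (nval sg |> (z * x)) = star_val sg * t.
  rewrite -fE -FE (_ : star_map q sg = id1 |> (star_val sg : B^c)).
    by rewrite (mhomP F) regular_actE.
  by apply: star_eq => b; rewrite star_mapE star_actE id1E idhE valE.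
have [|h hE] := @factor_epi _ _ _ _ _ q (left_mul (pt (g ord0 |> u (c j)))) eq.
  move=> b /quop_eq0/memv_imgP[b' _ ->]; rewrite !left_mulE /syz addr0 /s /a expr1.
  by rewrite mulrA ptu_mul mul0r.
(* the embedding of [M_(r c)] in [A] by [u c] detects the factorization *)
have [sg sgE] := star_elt h.
have vsg : star_val sg = pt (g ord0 |> u (c j)) by rewrite /star_val sgE hE left_mulE mulr1.
have := congr1 (fun b => coord0 (ev b gj)) (Ft sg).
rewrite /nval vsg ev_pt0 evM ev_pt send_gen; last first.
  by apply: zx_w; rewrite -[X in X |> u (a 0)](ev_pt0 (g ord0 |> u (c j))) -vsg nval_u.
rewrite -!ract_mul !coord0_g0 => /esym.
apply: (zx_not_projective hr0 hA (hc0 j)).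
by rewrite -weightS -coord0A -evA gw ev_0 linear0.
Qed.
End NotWeaklyGorenstein.

(** * Simple modules *)

Section Simples.
Hypothesis hc : injective c.

Lemma eta_sum i (a : 'I_n.+1 -> A) : eta i (\sum_k g k |> a k) = aug (a i).
Proof.
rewrite linear_sum (bigD1 i) //= etaA eta_g eqxx mul1r big1 ?addr0 // => k /negPf ki.
by rewrite etaA eta_g ki mul0r.
Qed.

Lemma eta_ev_sum i b (a : 'I_n.+1 -> A) :
  eta i (ev b (\sum_k g k |> a k)) = \sum_k eta i (ev b (g k)) * aug (a k).
Proof. by rewrite /ev !linear_sum; apply: eq_bigr => k _ /=; rewrite -!/(ev _ _) evA etaA. Qed.

(** Between different summands only maps that start at [A] can be onto. *)
Lemma eta_offdiag b i k : k != i -> k != ord0 -> eta i (ev b (g k)) = 0.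
Proof.
case: (unliftP ord0 k) => [k' ->|-> _]; last by rewrite eqxx.
move=> ki _; have [a aE] := cyc.1 (ev b (g (lift ord0 k'))).
have : ev b (g (lift ord0 k')) |> u (c k') = 0 by rewrite -weightS -evA gw ev_0.
rewrite aE eta_sum linear_sum /=; under eq_bigr do rewrite -ract_mul.
move=> /gens_eq0[h0 h]; case: (unliftP ord0 i) ki => [i'|] ->; last first.
  by move=> _; apply: (aug_annl hr0 hA h0).
rewrite (inj_eq lift_inj) => ki; apply: (aug_transport hr0 hA _ (h i')).
by rewrite (inj_eq hc).
Qed.

Definition chi i b : K := eta i (ev b (g i)).
Lemma chiM i b b' : chi i (b * b') = chi i b * chi i b'.
Proof.
have [a aE] := cyc.1 (ev b' (g i)).
rewrite /chi evM aE eta_ev_sum eta_sum (bigD1 i) //= big1 ?addr0 // => k ki.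
have [k0|k0] := eqVneq k ord0; last by rewrite eta_offdiag // mul0r.
have ik : i != k by rewrite eq_sym.
by rewrite -(eta_sum k) -aE (eta_offdiag _ ik) ?mulr0 // -k0.
Qed.
Lemma chi1 i : chi i 1 = 1. Proof. by rewrite /chi ev1 eta_g eqxx. Qed.
Lemma chiP i k b b' : chi i (k *: b + b') = k * chi i b + chi i b'.
Proof. by rewrite /chi evDl evZl linearP. Qed.

Definition idem i : B := send i (g i).
Lemma ev_idem i k : ev (idem i) (g k) = if k == i then g i else 0.
Proof. by rewrite /idem sendP ?gw. Qed.
Lemma chi_idem i k : chi i (idem k) = (i == k)%:R.
Proof.
rewrite /chi ev_idem; case: eqP => [->|_]; first by rewrite eta_g eqxx.
by rewrite linear0.
Qed.
Lemma sum_idem : \sum_i idem i = 1.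
Proof.
apply: ev_gens => k; rewrite ev1 /ev linear_sum sum_lfunE (bigD1 k) //= -!/(ev _ _).
rewrite ev_idem eqxx big1 ?addr0 // => i ik; rewrite -/(ev _ _) ev_idem.
by rewrite eq_sym (negPf ik).
Qed.

Section SimpleModule.
Variable i : 'I_n.+1.
Let act (b : B) (k : K^o) : K^o := k * chi i b.
Let act_lin b : linear (act b). Proof. by move=> k p q; rewrite /act mulrDl scalerAl. Qed.
Let act_linl k : linear (act^~ k).
Proof. by move=> t a b; rewrite /act chiP mulrDr scalerAr. Qed.
Let act_1 k : act 1 k = k. Proof. by rewrite /act chi1 mulr1. Qed.
Let act_M a b k : act (a * b) k = act b (act a k).
Proof. by rewrite /act chiM mulrA. Qed.
Definition simple_of : rmod B := rmod_of act_lin act_linl act_1 act_M.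
Lemma simple_ofE (k : simple_of) b : k |> b = (k : K) * chi i b :> K.
Proof. by rewrite [LHS]rmod_ofE. Qed.

Lemma simple_of_simple : simple_mod simple_of.
Proof.
split=> [h|U sU].
  have := memvf (1 : K^o); rewrite -[fullv]/(fullv : {vspace simple_of}) h memv0.
  by rewrite oner_eq0.
have [->|U0] := eqVneq U 0%VS; [by left|right].
apply/eqP; rewrite eqEsubv subvf /=; apply/subvP=> k _.
have := memv_pick U; rewrite -vpick0 in U0; set p := vpick U => pU.
have -> : k = (k : K) / (p : K) *: p by rewrite -[RHS]/((k : K) / p * p) divfK.
exact: memvZ.
Qed.
End SimpleModule.

Lemma simple_of_inj i k : iso (simple_of i) (simple_of k) -> i = k.
Proof.
case=> f [mf _]; apply/eqP/negPn/negP => ik.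
have : f (1 : K^o) = 0.
  rewrite (_ : (1 : K^o) = (1 : simple_of i) |> idem i); last first.
    by rewrite simple_ofE chi_idem eqxx mulr1.
  by rewrite (mhomP f) [LHS]simple_ofE chi_idem eq_sym (negPf ik) mulr0.
by move/((monoP f).1 mf)/eqP; rewrite oner_eq0.
Qed.

(** This turns out to be the Jacobson radical of [B]: it is nilpotent, and the
    quotient is a product of copies of [K]. *)
Definition radB b := forall i, chi i b = 0.

(** The radical layers of [N]; two successive elements of [radB] move down by one. *)
Definition in_rad k v := exists2 a : 'I_n.+1 -> A, v = \sum_i g i |> a i &
  forall i, aug_pow r x y z k (a i).

Lemma in_rad1 v : (forall i, eta i v = 0) -> in_rad 1 v.
Proof.
have [a ->] := cyc.1 v => h; exists a => // i.
by apply/(aug_pow1P hr0 hA); rewrite -eta_sum.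
Qed.

(** The first factor maps [N] to elements with radical coordinate in [A]; the
    coordinate in [A] is the only one from which the second factor can reach
    other summands without passing to the radical. *)
Lemma radB_square b b' v : radB b -> radB b' -> in_rad 1 (ev b (ev b' v)).
Proof.
move=> rb rb'; apply: in_rad1 => i; have [a aE] := cyc.1 (ev b' v).
rewrite aE eta_ev_sum big1 // => k _.
have [->|ki] := eqVneq k i; first by rewrite [eta _ _]rb mul0r.
have [k0|k0] := eqVneq k ord0; last by rewrite eta_offdiag // mul0r.
suff -> : aug (a k) = 0 by rewrite mulr0.
rewrite -eta_sum -aE k0; have [d ->] := cyc.1 v; rewrite eta_ev_sum big1 // => l _.
have [->|l0] := eqVneq l ord0; first by rewrite [eta _ _]rb' mul0r.
by rewrite eta_offdiag // mul0r.
Qed.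

Lemma aug_pow_sum k (I : finType) (F : I -> A) :
  (forall i, aug_pow r x y z k (F i)) -> aug_pow r x y z k (\sum_i F i).
Proof.
move=> hF; elim/big_rec: _ => [|i a _ ha]; last by apply: aug_powD.
exists (0, 0, 0, 0, 0, 0, 0, 0); first exact: elt_zero.
by rewrite /aug_pow_coords !eqxx !implybT.
Qed.

Lemma in_rad_square b b' k v : radB b -> radB b' -> in_rad k v -> in_rad k.+1 (ev b (ev b' v)).
Proof.
move=> rb rb' [a -> ha].
have h i : exists m, ev b (ev b' (g i)) = \sum_l g l |> m l /\ forall l, aug_pow r x y z 1 (m l).
  by have [m mE m1] := radB_square (g i) rb rb'; exists m.
pose m i := sval (constructive_indefinite_description _ (h i)).
have mP i : ev b (ev b' (g i)) = \sum_l g l |> m i l /\ forall l, aug_pow r x y z 1 (m i l).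
  exact: (svalP (constructive_indefinite_description _ (h i))).
exists (fun l => \sum_i m i l * a i); last first.
  by move=> l; apply: aug_pow_sum => i; apply: (aug_pow_mul hr0 hA) => //; case: (mP i).
rewrite -evM /ev linear_sum /=.
transitivity (\sum_i \sum_l g l |> (m i l * a i)).
  apply: eq_bigr => i _; rewrite -/(ev _ _) evA evM (mP i).1 linear_sum.
  by apply: eq_bigr => l _; rewrite /= ract_mul.
by rewrite exchange_big; apply: eq_bigr => l _; rewrite ract_sumr.
Qed.

Lemma radB_nilpotent b0 b1 b2 b3 b4 b5 b6 b7 :
  radB b0 -> radB b1 -> radB b2 -> radB b3 ->
  radB b4 -> radB b5 -> radB b6 -> radB b7 ->
  b0 * (b1 * (b2 * (b3 * (b4 * (b5 * (b6 * b7)))))) = 0.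
Proof.
move=> r0 r1 r2 r3 r4 r5 r6 r7; apply: ev_eq => v; rewrite !evM ev0l.
have v0 : in_rad 0 v.
  by have [a ->] := cyc.1 v; exists a => // i; apply: (aug_pow0 hr0 hA).
have := in_rad_square r0 r1 (in_rad_square r2 r3 (in_rad_square r4 r5 (in_rad_square r6 r7 v0))).
case=> a -> ha; rewrite big1 // => i _.
by rewrite (aug_pow4 (ha i)) ract0r.
Qed.

(** Otherwise some product of eight elements of [radB] would be nonzero on [X]. *)
Lemma simple_radB (X : rmod B) : simple_mod X ->
  exists v : X, v <> 0 /\ forall b, radB b -> v |> b = 0.
Proof.
move=> [X0 _]; apply: NNPP => nex.
have step (v : X) : v <> 0 -> exists b, radB b /\ v |> b <> 0.
  move=> v0; apply: NNPP => nb; apply: nex; exists v; split=> // b rb.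
  by apply: NNPP => vb; apply: nb; exists b.
have v0 : vpick (fullv : {vspace X}) <> 0.
  by move/eqP; rewrite vpick0 => /eqP.
have [b0 [r0 {}v0]] := step _ v0; have [b1 [r1 {}v0]] := step _ v0.
have [b2 [r2 {}v0]] := step _ v0; have [b3 [r3 {}v0]] := step _ v0.
have [b4 [r4 {}v0]] := step _ v0; have [b5 [r5 {}v0]] := step _ v0.
have [b6 [r6 {}v0]] := step _ v0; have [b7 [r7 {}v0]] := step _ v0.
apply: v0; rewrite -!ract_mul.
by rewrite radB_nilpotent ?ract0r.
Qed.

Lemma simple_cyclic (X : rmod B) (v : X) : simple_mod X -> v <> 0 ->
  forall w, exists b, w = v |> b.
Proof.
move=> [_ sX] v0 t; have [||h hE] := @ex_hom _ _ (regular B) X (fun b => v |> b).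
- by move=> k a b; rewrite ractDr ractZr.
- by move=> a b; rewrite regular_actE ract_mul.
case: (sX _ (@limg_submod _ _ _ _ h)) => H.
  case: v0; apply/eqP; rewrite -memv0 -H; apply/memv_imgP; exists (1 : B).
    exact: memvf.
  by rewrite hE ract_1.
have : t \in limg h by rewrite H memvf.
by case/memv_imgP=> b _ ->; exists b; rewrite hE.
Qed.

Lemma simple_complete (X : rmod B) : simple_mod X -> exists i, iso X (simple_of i).
Proof.
move=> sX; have [v [v0 vr]] := simple_radB sX.
have [i xi] : exists i, v |> idem i <> 0.
  apply: NNPP => nex; apply: v0; rewrite -[v]ract_1 -sum_idem ract_sumr big1 // => i _.
  by apply: NNPP => h; apply: nex; exists i.
(* [B] acts on [p] by the character [chi i] *)
set p := v |> idem i in xi.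
have pE b : p |> b = chi i b *: p.
  apply/eqP; rewrite -subr_eq0 -ractZr -ract_mul -ractBr; apply/eqP/vr => k.
  have -> : idem i * b - chi i b *: idem i = (- chi i b) *: idem i + idem i * b.
    by rewrite addrC scaleNr.
  rewrite chiP chiM chi_idem; case: eqP => [->|_]; first by rewrite mulr1 mul1r addNr.
  by rewrite mulr0 mul0r addr0.
have [||f fE] := @ex_hom _ _ (simple_of i) X (fun k => (k : K) *: p).
- by move=> k a b; rewrite scalerDl scalerA.
- by move=> b k; rewrite simple_ofE linearZ /= pE scalerA.
have mf : is_mono f.
  apply/monoP=> k; rewrite fE => /eqP; rewrite scaler_eq0 => /orP[/eqP//|/eqP//].
have ef : is_epi f.
  apply/epiP=> t; have [b ->] := simple_cyclic sX xi t.
  by exists (chi i b : simple_of i); rewrite fE pE.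
have [f' [f'f ff']] := iso_ex mf ef; exists i, f'; split.
  by apply/monoP=> t f't; rewrite -(ff' t) f't linear0.
by apply/epiP=> k; exists (f k).
Qed.

Lemma end_number_of_simples : number_of_simples B n.+1.
Proof.
exists simple_of; split.
- exact: simple_of_simple.
- exact: simple_of_inj.
- exact: simple_complete.
Qed.
End Simples.

(** * Connectedness and generation *)

(** A central [ep] commutes with [eA] and with the maps [pt v] from [A], so it is
    the right multiplication by an idempotent of the local algebra [A]. *)
Lemma end_connected : connected_algebra B.
Proof.
move=> ep epep epC; set a : A := coord0 (ev ep (g ord0)).
have epE v : ev ep v = v |> a.
  have ep0 : ev ep (g ord0) = g ord0 |> a.
    by rewrite -ev_e -evM epC evM ev_e coord0_g eqxx ract_1.
  by rewrite -[in LHS](ev_pt0 v) -evM -epC evM ep0 evA ev_pt0.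
have aa : a * a = a.
  have := congr1 (fun b => coord0 (ev b (g ord0))) epep.
  by rewrite evM !epE -ract_mul !coord0_g0.
case: (Liu_Schulz_idempotent hr0 hA aa) => a01; [left|right]; apply: ev_eq => v.
  by rewrite epE a01 ract0r ev0l.
by rewrite epE a01 ract_1 ev1.
Qed.

Lemma end_not_semisimple : ~ semisimple_algebra B.
Proof.
apply: (@not_semisimple _ _ (pt (g ord0 |> (x * y * z)))) => [h|t].
  apply: (xyz_neq0 hr0 hA); rewrite -[LHS]coord0_g0 -[X in coord0 X]ev_pt0 h ev0l.
  exact: linear0.
rewrite -mulrA !mul_pt ev_pt evA coord0A -ract_mul mulrA.
by rewrite (xyz_sandwich hr0 hA) ract0r pt0.
Qed.

Lemma gens_generator : generator N.
Proof.
move=> M; have h (v : M) : exists f : mhom N M, f (g ord0) = v.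
  have [|f fE] := @gens_hom M (fun i => if i == ord0 then v else 0).
    by move=> i; case: eqP => [->|_]; rewrite ?weight0 ?ract0r ?linear0.
  by exists f; rewrite fE eqxx.
pose f i := sval (constructive_indefinite_description _ (h (vbasis (fullv : {vspace M}))`_i)).
exists (\dim (fullv : {vspace M})), (fun i => f i).
apply/eqP; rewrite eqEsubv subvf /=; apply/subvP=> v _.
rewrite (coord_vbasis (memvf v)); apply: memv_sumr => i _; apply: memvZ.
have <- : f i (g ord0) = (vbasis (fullv : {vspace M}))`_i.
  exact: (svalP (constructive_indefinite_description _ (h _))).
by rewrite memv_img ?memvf.
Qed.
End EndomorphismAlgebra.

(** * Choice of the parameters *)
(** No orbit of multiplication by [q] returns, so a finite set of scalars has
    an element with no proper multiple [q ^+ l * _] in the set. *)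
Lemma orbit_extremal (K : fieldType) (q : K) n (c : 'I_n -> K) :
  (0 < n)%N -> (forall i, c i != 0) -> (forall l, (0 < l)%N -> q ^+ l != 1) ->
  exists j, forall i l, (0 < l)%N -> c i != q ^+ l * c j.
Proof.
move=> n0 c0 q1; apply: NNPP => nex.
have step j : exists i, exists l, (0 < l)%N /\ c i = q ^+ l * c j.
  apply: NNPP => nj; apply: nex; exists j => i l l0; apply/negP=> /eqP cE.
  by apply: nj; exists i, l.
pose next j := sval (constructive_indefinite_description _ (step j)).
have nextP j : exists l, (0 < l)%N /\ c (next j) = q ^+ l * c j.
  exact: (svalP (constructive_indefinite_description _ (step j))).
have iterP m j : exists l, (m <= l)%N /\ c (iter m next j) = q ^+ l * c j.
  elim: m => [|m [l [ml lE]]]; first by exists 0; rewrite mul1r.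
  have [l' [l'0 l'E]] := nextP (iter m next j).
  by exists (l' + l)%N; rewrite iterS l'E lE mulrA exprD -add1n leq_add.
pose f (k : 'I_n.+1) := iter k next (Ordinal n0).
have [finj|/injectivePn[k [k' kk' fk]]] := altP (injectiveP f).
  by have := leq_card f finj; rewrite !card_ord ltnn.
wlog lt : k k' kk' fk / (k < k')%N.
  move=> W; have [lt|lt|/val_inj E] := ltngtP k k'; first exact: (W k k').
    by apply: (W k' k) => //; rewrite eq_sym.
  by rewrite E eqxx in kk'.
have [l [lm]] := iterP (k' - k)%N (f k).
rewrite -iterD subnK 1?ltnW // -[iter _ _ _]/(f k') -fk.
have l0 : (0 < l)%N by rewrite (leq_trans _ lm) // subn_gt0.
move/eqP; rewrite -{1}[c _]mul1r (inj_eq (mulIf (c0 _))) eq_sym.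
by rewrite (negPf (q1 _ l0)).
Qed.

Lemma Liu_Schulz_standing (K : fieldType) (r : K) (A : falgType K) (x y z : A) :
  r != 0 -> is_Liu_Schulz r x y z -> standing_algebra A.
Proof.
move=> hr0 hA; split=> [a aa _|].
  exact: (Liu_Schulz_idempotent hr0 hA aa).
apply: (not_semisimple (xyz_neq0 hr0 hA)) => t.
exact: (xyz_sandwich hr0 hA).
Qed.

Theorem theorem5p5 (K : fieldType) (r : K) (hr0 : r != 0)
    (hr : forall l, (1 <= l)%N -> r ^+ l != 1)
    (n : nat) (hn : (0 < n)%N)
    (c : 'I_n -> K) (hc0 : forall i, c i != 0) (hc : injective c)
    (A : falgType K) (x y z : A) (hA : is_Liu_Schulz r x y z)
    (B : falgType K)
    (hB : is_endomorphism_algebra (Liu_Schulz_sum x y c) B) :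
  [/\ gendo_symmetric B, algebra_domdim B 2 & number_of_simples B n.+1] /\
  (infinite_finitistic_codomdim B /\ ~ weakly_Gorenstein B).
Proof.
have [phi [phi_ker phi_img phi_1 phi_M]] := hB.
have [g cyc] : exists g, cyclic_sum g (weight x y c) := Liu_Schulz_sum_cyclic x y c.
have [jmax jmaxP] := orbit_extremal hn hc0 hr.
have [|jmin jminP] := @orbit_extremal _ r^-1 _ _ hn hc0.
  by move=> l l0; rewrite exprVn invr_eq1 hr.
split; last split.
- split.
  + split; first split.
    * exact: (end_connected hr0 hA cyc phi_ker phi_img phi_1 phi_M).
    * exact: (end_not_semisimple hr0 hA cyc phi_ker phi_img phi_M).
    exists A, (Liu_Schulz_sum x y c); split=> //.
    * exact: (Liu_Schulz_standing hr0 hA).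
    * exact: (Liu_Schulz_symmetric hr0 hA).
    * exact: (gens_generator cyc).
  + exact: (end_domdim hr0 hA hc0 cyc phi_ker phi_img phi_M jmax).
  exact: (end_number_of_simples hr0 hA cyc phi_ker phi_img phi_1 phi_M hc).
- apply: (end_infinite_finitistic_codomdim hr0 hA hc0 cyc phi_ker phi_img phi_M (j := jmin)).
  move=> i l l0.
  have := jminP i l l0; apply: contra => /eqP <-.
  by rewrite exprVn mulKf ?expf_neq0.
case=> lwG _.
exact: (end_not_left_weakly_Gorenstein hr0 hA hc0 cyc phi_ker phi_img phi_M jmaxP lwG).
Qed.
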